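(* Let $\lambda>2+\sqrt2$ and let $P(z)=z^2-\lambda$, with (real) Julia set $E_0$. Let $H$ be the Green's fundamental domain associated with $\Omega=\overline{\mathbb C}\setminus E_0$, let $T:H\to\tilde\Omega$ be the Green's mapping, and let $a=a(\lambda)>0$ be the slit parameter of $H$ (all as defined in the context). Then for every $N\in\mathbb N$ there exists $C_N<\infty$ such that for every $\psi\in F_N$ $$\int_{e^{-\pi a}}^1 |T''(re^{-i\pi\psi})|\,dr\le C_N .$$ Moreover there is a constant $c>0$, independent of $N$, such that for every $N\in\mathbb N$ the Hausdorff dimension of $F_N$ satisfies $$\mathrm{Hdim}(F_N)>1-\frac cN .$$
   Context: $\mathbb N=\{1,2,\dots\}$. For $\lambda>2$ and $P(z)=z^2-\lambda$, $P^{\circ n}$ is the $n$-fold iterate, and the Julia set is $E_0=\mathbb C\setminus\{z\in\mathbb C: P^{\circ n}(z)\to\infty\}$, which is a subset of $\mathbb R$. Let $\xi=\frac{1+\sqrt{1+4\lambda}}2$ be the positive fixed point of $P$; $[-\xi,\xi]$ is the smallest interval containing $E_0$. Let $g(z)=g(z,\infty)$ be the Green's function of $\Omega=\overline{\mathbb C}\setminus E_0$ with pole at $\infty$. Green's fundamental domain and Green's mapping: put $\tilde\Omega=\overline{\mathbb C}\setminus[-\xi,\xi]$. Let $G$ be the analytic function on $\tilde\Omega$ with $|G(z)|=e^{-g(z)}$ and $zG(z)\to1$ as $z\to\infty$ (so $G(\infty)=0$; $G$ is the Böttcher function, $G(P(z))=G(z)^2$ near $\infty$). $G$ is injective on $\tilde\Omega$;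 $H=G(\tilde\Omega)$ is a subdomain of the unit disc and $T:H\to\tilde\Omega$ is the inverse of $G$ (so $T(0)=\infty$). The domain $H$ is symmetric with respect to $\mathbb R$, contains $(-1,1)$, and there is a unique $a=a(\lambda)>0$ such that the part of $H$ in the lower half plane is the half disc $\{|\zeta|<1,\ \mathrm{Im}\,\zeta<0\}$ with the following radial slits removed: $\{e^{-\pi(h+ik/2^m)}: 0<h\le a/2^m\}$, for $m\in\mathbb N$ and $k$ odd, $1\le k\le 2^m$. The set $F_N$: it consists of all $\psi=\sum_{k\ge1}\varepsilon_k2^{-k}\in[0,1]$, $\varepsilon_k\in\{0,1\}$, such that for every $k\in\mathbb N$, $\varepsilon_k=\varepsilon_{k+1}=\dots=\varepsilon_{k+N}$ implies $\varepsilon_{k+N+1}\ne\varepsilon_{k+N}$ (i.e. no digit is repeated more than $N+1$ times in succession). *)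

(* Defs.v *)
From Stdlib Require Import Reals.
From Coquelicot Require Import Coquelicot.

Open Scope R_scope.

Definition Cexp (z : C) : C :=
  (exp (fst z) * cos (snd z), exp (fst z) * sin (snd z)).

Definition quad (lam : R) (z : C) : C := (z * z - RtoC lam)%C.

Definition escapes (lam : R) (z : C) : Prop :=
  is_lim_seq (fun n => Cmod (Nat.iter n (quad lam) z)) p_infty.

Definition julia (lam : R) (z : C) : Prop := ~ escapes lam z.

Definition xi (lam : R) : R := (1 + sqrt (1 + 4 * lam)) / 2.

(** Domains of the Riemann sphere containing infinity are represented by the
    set of their finite points; conditions at infinity are stated separately. *)
Definition Omega (lam : R) (z : C) : Prop := ~ julia lam z.

Definition tOmega (lam : R) (z : C) : Prop :=
  ~ (snd z = 0 /\ - xi lam <= fst z <= xi lam).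

Definition holomorphic_on (D : C -> Prop) (f : C -> C) : Prop :=
  forall z : C, D z -> ex_derive (K := C_AbsRing) (V := C_NormedModule) f z.

(** [u] is C^2 on the open set [D], with vanishing Laplacian. *)
Definition harmonic_on (D : C -> Prop) (u : C -> R) : Prop :=
  let v := fun x y : R => u (x, y) in
  forall x y : R, D (x, y) ->
    ex_diff_n v 2 x y /\
    partial_derive 2 0 v x y + partial_derive 0 2 v x y = 0.

(** Green's function with pole at infinity of a domain all of whose boundary
    points are regular. Since [D] is open, the limit condition at a point [w]
    outside [D] is vacuous unless [w] is a boundary point of [D]. *)
Definition greens_function (D : C -> Prop) (g : C -> R) : Prop :=
  harmonic_on D g /\
  (exists M r : R, forall z : C, r < Cmod z ->
     Rabs (g z - ln (Cmod z)) <= M) /\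
  (forall w : C, ~ D w -> filterlim g (within D (locally w)) (locally 0)).

(** Analyticity at infinity, with value [0] there, follows from the
    normalization [z * G z --> 1]. *)
Definition greens_coordinate (lam : R) (g : C -> R) (G : C -> C) : Prop :=
  holomorphic_on (tOmega lam) G /\
  (forall z : C, tOmega lam z -> Cmod (G z) = exp (- g z)) /\
  (forall eps : R, 0 < eps -> exists r : R, forall z : C,
     r < Cmod z -> Cmod (z * G z - 1)%C < eps).

(** The image of [tOmega] under [G]; the point [0] is the image of infinity. *)
Definition greens_domain (lam : R) (G : C -> C) (zeta : C) : Prop :=
  zeta = RtoC 0 \/ exists z : C, tOmega lam z /\ zeta = G z.

(** [T] is the inverse of [G]; its value at [0], which should be infinity, is
    left unspecified. *)
Definition greens_mapping (lam : R) (G T : C -> C) : Prop :=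
  forall z : C, tOmega lam z -> T (G z) = z.

Definition slits (a : R) (zeta : C) : Prop :=
  exists (m k : nat) (h : R),
    (1 <= m)%nat /\ Nat.Odd k /\ (1 <= k <= 2 ^ m)%nat /\
    0 < h <= a / 2 ^ m /\
    zeta = Cexp (- PI * (h + Ci * (INR k / 2 ^ m)%R))%C.

Definition slit_parameter (H : C -> Prop) (a : R) : Prop :=
  0 < a /\
  forall zeta : C, snd zeta < 0 ->
    (H zeta <-> Cmod zeta < 1 /\ ~ slits a zeta).

(** The digit [eps 0] is not used. *)
Definition F (N : nat) (psi : R) : Prop :=
  exists eps : nat -> bool,
    is_series (fun k => (if eps (S k) then 1 else 0) / 2 ^ S k) psi /\
    forall k : nat, (1 <= k)%nat ->
      (forall j : nat, (j <= N)%nat -> eps (k + j)%nat = eps k) ->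
      eps (k + N + 1)%nat <> eps (k + N)%nat.

(** Only meaningful for bounded sets; equal to [0] for the empty set. *)
Definition diam (U : R -> Prop) : R :=
  real (Lub_Rbar (fun d => exists x y : R, U x /\ U y /\ d = Rabs (x - y))).

(** [d ^ s] for [0 <= d] and [0 < s]; note that [Rpower 0 s = 1]. *)
Definition dpow (d s : R) : R := if Rlt_dec 0 d then Rpower d s else 0.

(** Covers for which the series diverges are omitted: they would contribute
    [p_infty], which is also the infimum of the empty set. *)
Definition hausdorff_premeasure (s delta : R) (A : R -> Prop) : Rbar :=
  Glb_Rbar (fun total => exists U : nat -> R -> Prop,
    (forall (i : nat) (x y : R), U i x -> U i y -> Rabs (x - y) <= delta) /\
    (forall x : R, A x -> exists i : nat, U i x) /\
    is_series (fun i => dpow (diam (U i)) s) total).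

Definition hausdorff_measure (s : R) (A : R -> Prop) : Rbar :=
  Rbar_lub (fun v => exists delta : R,
    0 < delta /\ v = hausdorff_premeasure s delta A).

Definition Hdim (A : R -> Prop) : Rbar :=
  Glb_Rbar (fun s => 0 < s /\ hausdorff_measure s A = Finite 0).

(* Main.v *)
(** Let [P z = z^2 - lam] and [z_j] the orbit of [z]. By the maximum principle [g] is the limit of [2^-n ln |z_n|], whence [G (P z) = (G z)^2] and [G'/G = - 1/W] with [W z = W (z_n) / (z_0 ... z_(n-1))], so that [T' = - W(T)/zeta] and [T'' = W(T) (1 + W'(T)) / zeta^2]. On the part of the ray where [z_n] is the first iterate outside a large disc, [1 - r] is of order at most [2^-n], and [W'] is of order at most [2^n] while [W] is of order [1 / |z_0 ... z_(n-1)|]. The hypothesis [lam > 2 + sqrt 2] says that the central gap of the Julia set contains the closed unit disc; hence [|z_j| >= q > 1] except for the last few [j], and there [|z_j|] is bounded below because the digits of [psi] keep the argument of [zeta^(2^j)] away from that of the tip of the central slit. Thus [|T''|] is at most a constant times [(2/q)^n], which is integrable.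

For the dimension, the numbers in [F N] whose digits form blocks [0 1 b ... b] with [N] free digits are mapped onto [[0,1)] by a Hoelder map of exponent [N / (N + 2)]. *)

Require Import Defs.
From Stdlib Require Import Reals Lra Lia Psatz Arith List Classical ClassicalEpsilon.
From Coquelicot Require Import Coquelicot.

Open Scope R_scope.

Implicit Types (z w : C) (n : nat).

(** * Complex differentiation *)

(** Of holomorphic functions only the derivative at a point, the mean value inequality and a maximum
    principle for the Laplacian are used. This shapes the treatment of W: near infinity it is the
    limit of explicit approximants [Wn] whose logarithmic derivatives [Sn] and their derivatives
    [Dn] are bounded uniformly in n, so that the limit can be differentiated; the functional
    equation then carries W to all of [tOmega]. The hypotheses describe [G] by its modulus and its
    behaviour at infinity. Identities for [G] itself come from quotients of modulus one: they are
    constant on rays to infinity, where z G(z) --> 1 fixes their value. [T] is given as a left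
    inverse of [G], so its differentiability rests on the openness of [G]. The growth (2/q)^n is
    integrable because 2^n (1 - r) is bounded: (2/q)^n is at most a constant times (1 - r)^(-theta)
    with theta = 1 - log_2 q < 1. In the dimension estimate the fixed digits 0 1 of a block do two
    things: they put the number into [F N], and they remove the ambiguity of binary expansions, so
    that close numbers must share digits. *)

Lemma pow2_pos n : 0 < 2 ^ n.
Proof. apply pow_lt. lra. Qed.

(** No quotient appears, and the bound is non-strict so that it also holds at h = 0. *)
Definition Cder (f : C -> C) (z l : C) : Prop :=
  forall eps : R, 0 < eps -> exists d : R, 0 < d /\ forall h : C,
    Cmod h < d -> Cmod (f (z + h) - f z - l * h)%C <= eps * Cmod h.

Definition Ccont (f : C -> C) z : Prop :=
  forall eps : R, 0 < eps -> exists d : R, 0 < d /\ forall h : C,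
    Cmod h < d -> Cmod (f (z + h) - f z)%C < eps.

Lemma Cmod_sub_sym (a b : C) : Cmod (a - b)%C = Cmod (b - a)%C.
Proof. rewrite <- Cmod_opp. f_equal. ring. Qed.

Lemma Cmod_sub_triangle (a b : C) : Cmod a - Cmod b <= Cmod (a - b)%C.
Proof.
  generalize (Cmod_triangle (a - b) b)%C.
  replace (a - b + b)%C with a by ring. lra.
Qed.

Lemma Cmod_add_sub (a b : C) : Cmod a - Cmod b <= Cmod (a + b)%C.
Proof.
  generalize (Cmod_sub_triangle a (- b)%C). rewrite Cmod_opp.
  replace (a - - b)%C with (a + b)%C by ring. lra.
Qed.

Lemma Cmod_minus_le (a b : C) : Cmod (a - b)%C <= Cmod a + Cmod b.
Proof. generalize (Cmod_triangle a (- b)%C). rewrite Cmod_opp. auto. Qed.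

Lemma Cder_is_derive (f : C -> C) (z l : C) :
  Cder f z l <-> is_derive (K := C_AbsRing) (V := C_NormedModule) f z l.
Proof.
  split.
  - intros H. split.
    + apply (is_linear_scal_l (K := C_AbsRing) (V := C_NormedModule)).
    + intros x Hx eps.
      apply (is_filter_lim_locally_unique (K := C_AbsRing)
               (V := AbsRing_NormedModule C_AbsRing)) in Hx. subst x.
      destruct (H eps (cond_pos eps)) as (d & Hd & Hh).
      exists (mkposreal d Hd). intros y Hy.
      specialize (Hh (y - z)%C Hy).
      assert (E : forall a b : C, (a + (b - a))%C = b) by (intros; ring).
      rewrite E in Hh.
      change (Cmod (f y - f z - (y - z) * l)%C <= eps * Cmod (y - z)%C).
      rewrite (Cmult_comm (y - z)%C l). exact Hh.
  - intros [_ H] eps He.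
    specialize (H z (fun P HP => HP) (mkposreal eps He)).
    destruct H as [d Hd]. exists d. split; [apply cond_pos|].
    intros h Hh. specialize (Hd (z + h)%C).
    change (Cmod (z + h - z)%C < d ->
      Cmod (f (z + h)%C - f z - (z + h - z) * l)%C <= eps * Cmod (z + h - z)%C) in Hd.
    replace (z + h - z)%C with h in Hd by ring.
    rewrite Cmult_comm. now apply Hd.
Qed.

Lemma Ccont_near (f : C -> C) z : Ccont f z -> forall eps, 0 < eps ->
  exists d, 0 < d /\ forall w, Cmod (w - z)%C < d -> Cmod (f w - f z)%C < eps.
Proof.
  intros H eps He. destruct (H eps He) as (d & Hd & Hh). exists d. split; auto.
  intros w Hw. specialize (Hh _ Hw). now replace (z + (w - z))%C with w in Hh by ring.
Qed.

Lemma Cder_unique (f : C -> C) (z l : C) : Cder f z l -> C_derive f z = l.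
Proof. intros H. apply is_C_derive_unique, Cder_is_derive, H. Qed.

Lemma Cder_ext_loc (f g : C -> C) (z l : C) (d : R) :
  0 < d -> (forall h : C, Cmod h < d -> f (z + h)%C = g (z + h)%C) ->
  Cder f z l -> Cder g z l.
Proof.
  intros Hd Hfg H eps He. destruct (H eps He) as (d' & Hd' & Hh).
  exists (Rmin d d'). split; [now apply Rmin_pos|].
  intros h Hlt. generalize (Rmin_l d d') (Rmin_r d d'); intros.
  rewrite <- (Hfg h) by lra.
  replace (g z) with (f z); [apply Hh; lra|].
  replace z with (z + 0)%C by ring. apply Hfg. rewrite Cmod_0. lra.
Qed.

Lemma Cder_ext (f g : C -> C) (z l : C) :
  (forall x : C, f x = g x) -> Cder f z l -> Cder g z l.
Proof. intros H. apply (Cder_ext_loc f g z l 1); [lra|]. auto. Qed.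

Lemma Cder_const (c z : C) : Cder (fun _ => c) z 0%C.
Proof.
  intros eps He. exists 1. split; [lra|]. intros h _.
  replace (c - c - 0 * h)%C with (RtoC 0) by ring. rewrite Cmod_0.
  generalize (Cmod_ge_0 h). nra.
Qed.

Lemma Cder_id z : Cder (fun x => x) z 1%C.
Proof.
  intros eps He. exists 1. split; [lra|]. intros h _.
  replace (z + h - z - 1 * h)%C with (RtoC 0) by ring. rewrite Cmod_0.
  generalize (Cmod_ge_0 h). nra.
Qed.

(** With [near0] this unfolds to [Ccont], with [eventually] to convergence of sequences; the sum and
    product rules are proved once for both. *)
Definition Ctends {A : Type} (F : (A -> Prop) -> Prop) (f : A -> C) (l : C) : Prop :=
  forall eps : R, 0 < eps -> F (fun t => Cmod (f t - l)%C < eps).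

Definition near0 (P : C -> Prop) : Prop :=
  exists d : R, 0 < d /\ forall h : C, Cmod h < d -> P h.

Lemma Rlt_Rmin (x a b : R) : x < Rmin a b -> x < a /\ x < b.
Proof. generalize (Rmin_l a b) (Rmin_r a b). lra. Qed.

Global Instance near0_filter : Filter near0.
Proof.
  split.
  - exists 1. split; [lra|auto].
  - intros P Q (d & Hd & HP) (d' & Hd' & HQ). exists (Rmin d d'). split; [now apply Rmin_pos|].
    intros h Hh. apply Rlt_Rmin in Hh. split; [apply HP|apply HQ]; tauto.
  - intros P Q HPQ (d & Hd & HP). exists d. auto.
Qed.

Section Tends.
Context {A : Type} (F : (A -> Prop) -> Prop) {FF : Filter F}.

Lemma Ctends_const (c : C) : Ctends F (fun _ => c) c.
Proof.
  intros eps He. apply filter_forall. intros t.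
  replace (c - c)%C with (RtoC 0) by ring. now rewrite Cmod_0.
Qed.

Lemma Ctends_plus (f g : A -> C) (l m : C) :
  Ctends F f l -> Ctends F g m -> Ctends F (fun t => f t + g t)%C (l + m)%C.
Proof.
  intros Hf Hg eps He.
  assert (He2 : 0 < eps / 2) by lra.
  generalize (filter_and _ _ (Hf _ He2) (Hg _ He2)).
  apply filter_imp. intros t [H1 H2].
  replace (f t + g t - (l + m))%C with ((f t - l) + (g t - m))%C by ring.
  eapply Rle_lt_trans; [apply Cmod_triangle|]. lra.
Qed.

Lemma Ctends_mult (f g : A -> C) (l m : C) :
  Ctends F f l -> Ctends F g m -> Ctends F (fun t => f t * g t)%C (l * m)%C.
Proof.
  intros Hf Hg eps He.
  pose proof (Cmod_ge_0 l). pose proof (Cmod_ge_0 m).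
  set (K := Cmod l + Cmod m + 1). assert (HK : 0 < K) by (unfold K; lra).
  set (e := Rmin 1 (eps / (2 * K))).
  assert (He' : 0 < e) by (apply Rmin_pos; [lra|]; apply Rdiv_lt_0_compat; lra).
  assert (HeK : e * (2 * K) <= eps).
  { apply Rle_trans with (eps / (2 * K) * (2 * K)).
    - apply Rmult_le_compat_r; [lra|]. apply Rmin_r.
    - right. field. lra. }
  assert (e <= 1) by apply Rmin_l.
  generalize (filter_and _ _ (Hf e He') (Hg e He')). apply filter_imp. intros t [H2 H3].
  replace (f t * g t - l * m)%C with ((f t - l) * (m + (g t - m)) + l * (g t - m))%C by ring.
  eapply Rle_lt_trans; [apply Cmod_triangle|]. rewrite !Cmod_mult.
  pose proof (Cmod_triangle m (g t - m)%C).
  pose proof (Cmod_ge_0 (f t - l)%C). pose proof (Cmod_ge_0 (g t - m)%C).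
  pose proof (Cmod_ge_0 (m + (g t - m))%C). unfold K in *. nra.
Qed.

Lemma Ctends_ext (f g : A -> C) (l m : C) :
  (forall t, f t = g t) -> l = m -> Ctends F f l -> Ctends F g m.
Proof. intros E <- H eps He. generalize (H eps He). apply filter_imp. intros t. now rewrite E. Qed.
End Tends.

Lemma Ctends_near0 : Ctends near0 (fun h => h) 0%C.
Proof.
  intros eps He. exists eps. split; auto. intros h Hh. now replace (h - 0)%C with h by ring.
Qed.

(** The slope takes the value [l] at [0]. *)
Lemma Cder_slope (f : C -> C) (z l : C) :
  Cder f z l <-> exists phi : C -> C, (forall h, f (z + h) = f z + phi h * h)%C /\ Ctends near0 phi l.
Proof.
  split.
  - intros H. exists (fun h => if Req_EM_T (Cmod h) 0 then l else (f (z + h) - f z) / h)%C. split.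
    + intros h. destruct (Req_EM_T (Cmod h) 0) as [E|E].
      * rewrite (Cmod_eq_0 h E). replace (z + 0)%C with z by ring. ring.
      * field. intros ->. now rewrite Cmod_0 in E.
    + intros eps He. destruct (H (eps / 2)) as (d & Hd & Hh); [lra|].
      exists d. split; auto. intros h Hlt. destruct (Req_EM_T (Cmod h) 0) as [E|E].
      * replace (l - l)%C with (RtoC 0) by ring. now rewrite Cmod_0.
      * assert (H0 : h <> 0%C) by (intros ->; now rewrite Cmod_0 in E).
        replace ((f (z + h) - f z) / h - l)%C with ((f (z + h) - f z - l * h) / h)%C by (field; auto).
        rewrite Cmod_div by auto. apply Cmod_gt_0 in H0. specialize (Hh h Hlt).
        apply Rmult_lt_reg_r with (Cmod h); auto.
        replace (Cmod (f (z + h) - f z - l * h)%C / Cmod h * Cmod h)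
          with (Cmod (f (z + h) - f z - l * h)%C) by (field; auto). nra.
  - intros (phi & E & H) eps He. destruct (H eps He) as (d & Hd & Hh).
    exists d. split; auto. intros h Hlt. rewrite E.
    replace (f z + phi h * h - f z - l * h)%C with ((phi h - l) * h)%C by ring.
    rewrite Cmod_mult. apply Rmult_le_compat_r; [apply Cmod_ge_0|]. left. now apply Hh.
Qed.

Lemma Cder_cont (f : C -> C) (z l : C) : Cder f z l -> Ccont f z.
Proof.
  intros H. apply Cder_slope in H. destruct H as (phi & E & H).
  refine (Ctends_ext near0 (fun h => f z + phi h * h)%C _ (f z + l * 0)%C _ _ _ _); [auto|ring|].
  apply Ctends_plus; auto using near0_filter, Ctends_const.
  apply Ctends_mult; auto using near0_filter, Ctends_near0.
Qed.

Lemma Cder_plus (f g : C -> C) (z l m : C) :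
  Cder f z l -> Cder g z m -> Cder (fun x => f x + g x)%C z (l + m)%C.
Proof.
  rewrite !Cder_slope. intros (phi & E & H) (psi & E' & H').
  exists (fun h => phi h + psi h)%C. split; [intros h; rewrite E, E'; ring|].
  now apply Ctends_plus; auto using near0_filter.
Qed.

Lemma Cder_mult (f g : C -> C) (z l m : C) :
  Cder f z l -> Cder g z m -> Cder (fun x => f x * g x)%C z (l * g z + f z * m)%C.
Proof.
  intros Hf Hg. pose proof (Cder_cont g z m Hg) as Hc. revert Hf Hg.
  rewrite !Cder_slope. intros (phi & E & H) (psi & E' & H').
  exists (fun h => phi h * g (z + h) + f z * psi h)%C. split; [intros h; rewrite E, E'; ring|].
  apply Ctends_plus; [apply near0_filter| |]; apply Ctends_mult; auto using near0_filter, Ctends_const.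
Qed.

(** In terms of slopes the composite has slope psi(phi(h) h) phi(h), so no case distinction is
    needed where the inner increment vanishes. *)
Lemma Cder_comp (f g : C -> C) (z l m : C) :
  Cder f z l -> Cder g (f z) m -> Cder (fun x => g (f x)) z (m * l)%C.
Proof.
  rewrite !Cder_slope. intros (phi & E & H) (psi & E' & H').
  exists (fun h => psi (phi h * h) * phi h)%C. split; [intros h; rewrite E, E'; ring|].
  apply Ctends_mult; auto using near0_filter. intros eps He.
  destruct (H' eps He) as (d & Hd & Hpsi).
  pose proof (Ctends_mult near0 phi (fun h => h) l 0%C H Ctends_near0 d Hd) as Hk.
  revert Hk. apply filter_imp. intros h Hh. apply Hpsi.
  now replace (phi h * h - l * 0)%C with (phi h * h)%C in Hh by ring.
Qed.

Lemma Cder_inv z : z <> 0%C -> Cder (fun x => / x)%C z (- / (z * z))%C.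
Proof.
  intros Hz eps He.
  assert (Hm : 0 < Cmod z) by now apply Cmod_gt_0.
  (* The error of the linear approximation is h^2 / (z^2 (z + h)). The first bound keeps |z + h| >=
     |z|/2, the second then makes the error at most eps |h|. *)
  exists (Rmin (Cmod z / 2) (eps * Cmod z ^ 3 / 2)). split.
  { apply Rmin_pos; [lra|]. assert (0 < Cmod z ^ 3) by now apply pow_lt. nra. }
  intros h Hlt.
  destruct (Rlt_Rmin _ _ _ Hlt) as [L1 L2].
  assert (Hzh : Cmod z / 2 <= Cmod (z + h)%C) by (generalize (Cmod_add_sub z h); lra).
  assert (Hzh0 : (z + h)%C <> 0%C) by (apply Cmod_gt_0; lra).
  replace (/ (z + h) - / z - - / (z * z) * h)%C with (h * h / (z * z * (z + h)))%C
    by (field; auto).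
  rewrite Cmod_div by (repeat apply Cmult_neq_0; auto).
  rewrite !Cmod_mult.
  assert (Q : 0 < Cmod z * Cmod z * Cmod (z + h)) by (repeat apply Rmult_lt_0_compat; lra).
  apply Rmult_le_reg_r with (Cmod z * Cmod z * Cmod (z + h)); auto.
  replace (Cmod h * Cmod h / (Cmod z * Cmod z * Cmod (z + h)) * (Cmod z * Cmod z * Cmod (z + h)))
    with (Cmod h * Cmod h) by (field; lra).
  pose proof (Cmod_ge_0 h).
  replace (eps * Cmod h * (Cmod z * Cmod z * Cmod (z + h)))
    with (Cmod h * (eps * (Cmod z * Cmod z * Cmod (z + h)))) by ring.
  apply Rmult_le_compat_l; auto.
  apply Rle_trans with (eps * (Cmod z * Cmod z * (Cmod z / 2))); [simpl in L2; lra|].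
  apply Rmult_le_compat_l; [lra|]. apply Rmult_le_compat_l; auto. nra.
Qed.

Lemma Cder_opp (f : C -> C) (z l : C) : Cder f z l -> Cder (fun x => - f x)%C z (- l)%C.
Proof.
  intros H. apply (Cder_ext (fun x => (-(1)) * f x)%C); [intros; ring|].
  replace (- l)%C with (0 * f z + (-(1)) * l)%C by ring.
  apply (Cder_mult (fun _ => (-(1))%C) f); auto. apply Cder_const.
Qed.

Lemma Cder_minus (f g : C -> C) (z l m : C) :
  Cder f z l -> Cder g z m -> Cder (fun x => f x - g x)%C z (l - m)%C.
Proof. intros Hf Hg. apply (Cder_plus f (fun x => - g x)%C); auto. now apply Cder_opp. Qed.

Lemma Cder_div (f g : C -> C) (z l m : C) :
  g z <> 0%C -> Cder f z l -> Cder g z m ->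
  Cder (fun x => f x / g x)%C z ((l * g z - f z * m) / (g z * g z))%C.
Proof.
  intros Hz Hf Hg.
  replace ((l * g z - f z * m) / (g z * g z))%C
    with (l * / g z + f z * (- / (g z * g z) * m))%C by (field; auto).
  apply (Cder_mult f (fun x => / g x)%C); auto.
  apply (Cder_comp g (fun x => / x)%C); auto. now apply Cder_inv.
Qed.

Lemma Cder_val (f : C -> C) (z l m : C) : Cder f z l -> l = m -> Cder f z m.
Proof. now intros H <-. Qed.

Lemma Cder_eq (f : C -> C) (z l m : C) : Cder f z l -> Cder f z m -> l = m.
Proof. intros H1 H2. now rewrite <- (Cder_unique _ _ _ H1), <- (Cder_unique _ _ _ H2). Qed.

Lemma Cder_pow (f : C -> C) (z l : C) n :
  Cder f z l -> Cder (fun x => f x ^ n)%C z (RtoC (INR n) * f z ^ (pred n) * l)%C.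
Proof.
  intros H. induction n as [|n IH].
  - apply (Cder_val _ _ 0%C); [exact (Cder_const 1 z)|]. simpl. ring.
  - change (Cder (fun x => f x * f x ^ n)%C z (RtoC (INR (S n)) * f z ^ n * l)%C).
    eapply Cder_val; [apply (Cder_mult f (fun x => f x ^ n)%C); [exact H|exact IH]|].
    rewrite S_INR, RtoC_plus. destruct n; simpl; ring.
Qed.

Lemma Ccont_comp (f g : C -> C) z : Ccont f z -> Ccont g (f z) -> Ccont (fun x => g (f x)) z.
Proof.
  intros Hf Hg eps He. destruct (Hg eps He) as (d & Hd & H1).
  destruct (Hf d Hd) as (d' & Hd' & H2). exists d'. split; auto.
  intros h Hh. specialize (H1 _ (H2 h Hh)).
  now replace (f z + (f (z + h) - f z))%C with (f (z + h)%C) in H1 by ring.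
Qed.

Lemma Ccont_plus (f g : C -> C) z :
  Ccont f z -> Ccont g z -> Ccont (fun x => f x + g x)%C z.
Proof. exact (Ctends_plus near0 _ _ _ _). Qed.

Lemma Ccont_mult (f g : C -> C) z :
  Ccont f z -> Ccont g z -> Ccont (fun x => f x * g x)%C z.
Proof. exact (Ctends_mult near0 _ _ _ _). Qed.

Lemma Ccont_const (c z : C) : Ccont (fun _ => c) z.
Proof. apply (Cder_cont _ _ 0%C), Cder_const. Qed.

Lemma Ccont_inv (f : C -> C) z : f z <> 0%C -> Ccont f z -> Ccont (fun x => / f x)%C z.
Proof.
  intros Hz Hf. apply (Ccont_comp f (fun x => / x)%C); auto.
  eapply Cder_cont. now apply Cder_inv.
Qed.

Lemma Ccont_ext_loc (f g : C -> C) z (d : R) :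
  0 < d -> (forall h : C, Cmod h < d -> f (z + h)%C = g (z + h)%C) -> Ccont f z -> Ccont g z.
Proof.
  intros Hd Hfg H eps He. destruct (H eps He) as (d' & Hd' & Hh).
  exists (Rmin d d'). split; [now apply Rmin_pos|].
  intros h Hlt. generalize (Rmin_l d d') (Rmin_r d d'); intros.
  rewrite <- (Hfg h) by lra.
  replace (g z) with (f z); [apply Hh; lra|].
  replace z with (z + 0)%C by ring. apply Hfg. rewrite Cmod_0. lra.
Qed.

(** * Restriction to real lines and the mean value inequality *)

Lemma Re_le_Cmod z : Re z <= Cmod z.
Proof. generalize (re_le_Cmod z) (Rle_abs (Re z)). lra. Qed.

Lemma Im_le_Cmod z : Rabs (Im z) <= Cmod z.
Proof. eapply Rle_trans; [apply Rmax_r|apply Rmax_Cmod]. Qed.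

Lemma line_near (z u : C) (d : R) : 0 < d -> locally 0 (fun t : R => Cmod (z + t * u - z)%C < d).
Proof.
  intros Hd. pose proof (Cmod_ge_0 u).
  assert (Hd' : 0 < d / (Cmod u + 1)) by (apply Rdiv_lt_0_compat; lra).
  exists (mkposreal _ Hd'). intros t Ht. change (Rabs (t - 0) < d / (Cmod u + 1)) in Ht.
  rewrite Rminus_0_r in Ht.
  replace (z + t * u - z)%C with (t * u)%C by ring. rewrite Cmod_mult, Cmod_R.
  apply (Rmult_lt_compat_r (Cmod u + 1)) in Ht; [|lra].
  replace (d / (Cmod u + 1) * (Cmod u + 1)) with d in Ht by (field; lra).
  pose proof (Rabs_pos t). nra.
Qed.

Lemma Cder_line_Re (f : C -> C) (z u l : C) (t : R) :
  Cder f (z + t * u)%C l ->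
  is_derive (fun s : R => Re (f (z + s * u)%C)) t (Re (l * u)%C).
Proof.
  intros H. apply is_derive_Reals. intros eps He.
  pose proof (Cmod_ge_0 u) as Hu.
  destruct (H (eps / (2 * (Cmod u + 1)))) as (d & Hd & Hh).
  { apply Rdiv_lt_0_compat; lra. }
  assert (Hd' : 0 < d / (Cmod u + 1)) by (apply Rdiv_lt_0_compat; lra).
  exists (mkposreal _ Hd'). intros s Hs0 Hs. simpl in Hs.
  assert (Hsu : Cmod (s * u)%C = Rabs s * Cmod u) by now rewrite Cmod_mult, Cmod_R.
  assert (Hs2 : Rabs s * (Cmod u + 1) < d).
  { apply Rlt_le_trans with (d / (Cmod u + 1) * (Cmod u + 1)).
    - apply Rmult_lt_compat_r; lra.
    - right. field. lra. }
  assert (Hsp : 0 < Rabs s) by now apply Rabs_pos_lt.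
  specialize (Hh (s * u)%C ltac:(rewrite Hsu; nra)).
  replace (z + t * u + s * u)%C with (z + (t + s)%R * u)%C in Hh
    by (rewrite RtoC_plus; ring).
  set (X := (f (z + (t + s)%R * u) - f (z + t * u) - l * (s * u))%C) in *.
  replace ((Re (f (z + (t + s)%R * u)%C) - Re (f (z + t * u)%C)) / s - Re (l * u)%C)
    with (Re X / s).
  2:{ replace (Re X) with (Re (f (z + (t + s)%R * u)%C) - Re (f (z + t * u)%C) - s * Re (l * u)%C).
      - field. auto.
      - unfold X. unfold Re. simpl. ring. }
  unfold Rdiv. rewrite Rabs_mult, Rabs_inv.
  apply Rle_lt_trans with (eps / (2 * (Cmod u + 1)) * (Rabs s * Cmod u) * / Rabs s).
  - apply Rmult_le_compat_r; [left; now apply Rinv_0_lt_compat|].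
    rewrite <- Hsu. eapply Rle_trans; [apply re_le_Cmod|]. exact Hh.
  - replace (eps / (2 * (Cmod u + 1)) * (Rabs s * Cmod u) * / Rabs s)
      with (eps * (Cmod u / (2 * (Cmod u + 1)))) by (field; lra).
    rewrite <- (Rmult_1_r eps) at 2. apply Rmult_lt_compat_l; auto.
    apply Rmult_lt_reg_r with (2 * (Cmod u + 1)); [lra|].
    replace (Cmod u / (2 * (Cmod u + 1)) * (2 * (Cmod u + 1))) with (Cmod u) by (field; lra).
    lra.
Qed.

Lemma Cder_line_Im (f : C -> C) (z u l : C) (t : R) :
  Cder f (z + t * u)%C l ->
  is_derive (fun s : R => Im (f (z + s * u)%C)) t (Im (l * u)%C).
Proof.
  intros H.
  assert (H' : Cder (fun x => (- Ci) * f x)%C (z + t * u)%C (- Ci * l)%C).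
  { eapply Cder_val; [apply (Cder_mult (fun _ => (- Ci)%C) f); [apply Cder_const|exact H]|]. ring. }
  apply Cder_line_Re in H'.
  replace (Im (l * u)%C) with (Re (- Ci * l * u)%C) by (unfold Re, Im; simpl; ring).
  eapply is_derive_ext; [|exact H'].
  intros s. unfold Re, Im. simpl. ring.
Qed.

(** This plays the part of ln |f| = Re (log f) without choosing a branch. It yields the harmonicity
    of ln |f| and, since |G| = exp(-g), the link between g and G'/G. *)
Lemma Cder_line_ln_Cmod (f : C -> C) (z u l : C) (t : R) :
  f (z + t * u)%C <> 0%C -> Cder f (z + t * u)%C l ->
  is_derive (fun s : R => ln (Cmod (f (z + s * u)%C))) t (Re (l / f (z + t * u) * u)%C).
Proof.
  intros Hz H.
  pose proof (Cder_line_Re _ _ _ _ _ H) as HR.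
  pose proof (Cder_line_Im _ _ _ _ _ H) as HI.
  set (w := f (z + t * u)%C) in *.
  assert (Hw : 0 < Re w ^ 2 + Im w ^ 2).
  { rewrite <- Cmod2_alt. apply pow_lt. now apply Cmod_gt_0. }
  assert (Hs : 0 < sqrt (Re w ^ 2 + Im w ^ 2)) by now apply sqrt_lt_R0.
  assert (Hsq : sqrt (Re w ^ 2 + Im w ^ 2) * sqrt (Re w ^ 2 + Im w ^ 2) = Re w ^ 2 + Im w ^ 2)
    by (apply sqrt_sqrt; lra).
  set (F := fun s : R => f (z + s * u)%C) in *.
  change (is_derive (fun s => ln (sqrt (Re (F s) ^ 2 + Im (F s) ^ 2))) t (Re (l / w * u)%C)).
  change (is_derive (fun s => Re (F s)) t (Re (l * u)%C)) in HR.
  change (is_derive (fun s => Im (F s)) t (Im (l * u)%C)) in HI.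
  pose proof (is_derive_unique _ _ _ HR) as DR. pose proof (is_derive_unique _ _ _ HI) as DI.
  assert (FR : Re (F t) = Re w) by reflexivity.
  assert (FI : Im (F t) = Im w) by reflexivity.
  set (a := fun s => Re (F s)) in *. set (b := fun s => Im (F s)) in *.
  change (is_derive (fun s => ln (sqrt (a s ^ 2 + b s ^ 2))) t (Re (l / w * u)%C)).
  change (a t = Re w) in FR. change (b t = Im w) in FI.
  change (Derive a t = Re (l * u)%C) in DR. change (Derive b t = Im (l * u)%C) in DI.
  assert (Ea : ex_derive a t) by (eexists; exact HR).
  assert (Eb : ex_derive b t) by (eexists; exact HI).
  clearbody a b. auto_derive.
  - rewrite !FR, !FI. replace (Re w * (Re w * 1) + Im w * (Im w * 1)) with (Re w ^ 2 + Im w ^ 2) by ring.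
    repeat split; auto.
  - change (fun x => a x) with a. change (fun x => b x) with b.
    rewrite DR, DI, FR, FI.
    replace (Re w * (Re w * 1) + Im w * (Im w * 1)) with (Re w ^ 2 + Im w ^ 2) by ring.
    unfold Rdiv. rewrite <- !Rmult_assoc.
    set (S := sqrt (Re w ^ 2 + Im w ^ 2)) in *.
    replace (Re (l / w * u)%C)
      with ((Re w * Re (l * u) + Im w * Im (l * u)) / (Re w ^ 2 + Im w ^ 2)).
    + rewrite <- Hsq. field. lra.
    + unfold Re, Im in *. destruct w as [w1 w2], l as [l1 l2], u as [u1 u2].
      simpl in *. field. lra.
Qed.

Lemma mvt_unit (phi phi' : R -> R) : (forall t, 0 <= t <= 1 -> is_derive phi t (phi' t)) ->
  exists c, 0 <= c <= 1 /\ phi 1 - phi 0 = phi' c.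
Proof.
  intros H. destruct (MVT_cor2 phi phi' 0 1) as (c & Hc & Hc'); [lra| |].
  - intros c Hc. now apply is_derive_Reals, H.
  - exists c. split; [lra|]. rewrite Hc. ring.
Qed.

(** Rotating the increment to the positive real axis reduces the complex mean value inequality to the real mean value theorem. *)
Lemma Cder_lipschitz (f f' : C -> C) z w (M : R) :
  (forall t : R, 0 <= t <= 1 -> Cder f (z + t * (w - z))%C (f' (z + t * (w - z))%C)) ->
  (forall t : R, 0 <= t <= 1 -> Cmod (f' (z + t * (w - z))%C) <= M) ->
  Cmod (f w - f z)%C <= M * Cmod (w - z)%C.
Proof.
  intros Hd HM. set (D := (f w - f z)%C).
  destruct (Req_dec (Cmod D) 0) as [H0|H0].
  { rewrite H0. apply Rmult_le_pos; [|apply Cmod_ge_0].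
    eapply Rle_trans; [apply Cmod_ge_0|apply (HM 0); lra]. }
  assert (Hpos : 0 < Cmod D) by (generalize (Cmod_ge_0 D); lra).
  set (phi := fun t : R => Re ((fun x => Cconj D * f x)%C (z + t * (w - z))%C)).
  set (phi' := fun t : R => Re (Cconj D * f' (z + t * (w - z)) * (w - z))%C).
  assert (Hphi : forall t, 0 <= t <= 1 -> is_derive phi t (phi' t)).
  { intros t Ht. apply Cder_line_Re.
    eapply Cder_val; [apply (Cder_mult (fun _ => Cconj D) f); [apply Cder_const|apply (Hd t Ht)]|].
    ring. }
  destruct (mvt_unit phi phi' Hphi) as (c & Hc & Heq).
  assert (E : phi 1 - phi 0 = Cmod D ^ 2).
  { unfold phi. replace (z + RtoC 1 * (w - z))%C with w by ring.
    replace (z + RtoC 0 * (w - z))%C with z by ring.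
    rewrite Cmod2_alt. unfold D, Re, Im. simpl. ring. }
  assert (L : phi' c <= Cmod D * (M * Cmod (w - z)%C)).
  { unfold phi'. eapply Rle_trans; [apply Re_le_Cmod|].
    rewrite !Cmod_mult, Cmod_conj, Rmult_assoc. apply Rmult_le_compat_l; [lra|].
    apply Rmult_le_compat_r; [apply Cmod_ge_0|]. now apply HM. }
  assert (Cmod D ^ 2 <= Cmod D * (M * Cmod (w - z)%C)) by lra.
  apply Rmult_le_reg_l with (Cmod D); [lra|]. simpl in H. lra.
Qed.

(** * Limits of sequences of complex functions *)

Definition Cseq_lim (u : nat -> C) (l : C) : Prop :=
  forall eps : R, 0 < eps -> exists N : nat, forall n : nat, (N <= n)%nat ->
    Cmod (u n - l)%C < eps.

Lemma Cseq_lim_le (u : nat -> C) (l : C) (B : R) :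
  Cseq_lim u l -> (forall n, Cmod (u n) <= B) -> Cmod l <= B.
Proof.
  intros H HB. apply Rnot_lt_le. intros Hlt.
  destruct (H (Cmod l - B)) as (N & HN); [lra|].
  specialize (HN N (Nat.le_refl N)). specialize (HB N).
  rewrite Cmod_sub_sym in HN. generalize (Cmod_sub_triangle l (u N)). lra.
Qed.

Lemma Cseq_lim_plus (u v : nat -> C) (l m : C) :
  Cseq_lim u l -> Cseq_lim v m -> Cseq_lim (fun n => u n + v n)%C (l + m)%C.
Proof. exact (Ctends_plus eventually u v l m). Qed.

Lemma Cseq_lim_mult (u v : nat -> C) (l m : C) :
  Cseq_lim u l -> Cseq_lim v m -> Cseq_lim (fun n => u n * v n)%C (l * m)%C.
Proof. exact (Ctends_mult eventually u v l m). Qed.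

Lemma Cseq_lim_opp (u : nat -> C) (l : C) : Cseq_lim u l -> Cseq_lim (fun n => - u n)%C (- l)%C.
Proof.
  intros Hu eps He. destruct (Hu eps He) as (N & H). exists N. intros n Hn.
  replace (- u n - - l)%C with (- (u n - l))%C by ring. rewrite Cmod_opp. auto.
Qed.

(** A Lipschitz constant common to all f'_n gives, by the mean value inequality for f_n(x) - f'_n(z)
    x, the Taylor bound M |h|^2 uniformly in n. It survives pointwise limits. *)
Lemma Cder_lim (f f' : nat -> C -> C) (F F' : C -> C) z (r M : R) :
  0 < r ->
  (forall n w, Cmod (w - z)%C < r -> Cder (f n) w (f' n w)) ->
  (forall n w v, Cmod (w - z)%C < r -> Cmod (v - z)%C < r ->
     Cmod (f' n w - f' n v)%C <= M * Cmod (w - v)%C) ->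
  (forall w, Cmod (w - z)%C < r -> Cseq_lim (fun n => f n w) (F w)) ->
  (forall w, Cmod (w - z)%C < r -> Cseq_lim (fun n => f' n w) (F' w)) ->
  Cder F z (F' z).
Proof.
  intros Hr Hder Hlip HF HF'.
  assert (M0 : 0 <= M).
  { assert (Hz : Cmod (z - z)%C < r) by (replace (z - z)%C with (RtoC 0) by ring; rewrite Cmod_0; lra).
    specialize (Hlip 0%nat (z + (r / 2)%R)%C z).
    replace (z + (r / 2)%R - z)%C with (RtoC (r / 2)) in Hlip by ring.
    rewrite Cmod_R, (Rabs_pos_eq (r / 2)) in Hlip by lra.
    specialize (Hlip ltac:(lra) Hz).
    generalize (Cmod_ge_0 (f' 0%nat (z + (r / 2)%R)%C - f' 0%nat z)%C). nra. }
  assert (Key : forall h, Cmod h < r ->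
            Cmod (F (z + h) - F z - F' z * h)%C <= M * Cmod h * Cmod h).
  { intros h Hh.
    assert (Hz : Cmod (z - z)%C < r) by (replace (z - z)%C with (RtoC 0) by ring; rewrite Cmod_0; lra).
    assert (Hzh : Cmod (z + h - z)%C < r) by (replace (z + h - z)%C with h by ring; auto).
    apply (Cseq_lim_le (fun n => f n (z + h) + - f n z + - (f' n z * h))%C).
    { apply Cseq_lim_plus; [apply Cseq_lim_plus|]; [now apply HF|now apply Cseq_lim_opp, HF|].
      apply Cseq_lim_opp, (Cseq_lim_mult (fun n => f' n z) (fun _ => h)); [now apply HF'|].
      exact (Ctends_const eventually h). }
    intros n.
      pose proof (Cder_lipschitz (fun x => f n x - f' n z * x)%C (fun x => f' n x - f' n z)%C
                    z (z + h)%C (M * Cmod h)) as L.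
      replace (z + h - z)%C with h in L by ring.
      replace (f n (z + h) + - f n z + - (f' n z * h))%C
        with ((f n (z + h) - f' n z * (z + h)) - (f n z - f' n z * z))%C by ring.
      assert (Hin : forall t, 0 <= t <= 1 -> Cmod (t * h)%C <= Cmod h).
      { intros t Ht. rewrite Cmod_mult, Cmod_R, Rabs_pos_eq by lra.
        generalize (Cmod_ge_0 h). nra. }
      apply L.
      - intros t Ht. specialize (Hin t Ht). apply Cder_minus.
        + apply Hder. replace (z + t * h - z)%C with (t * h)%C by ring. lra.
        + eapply Cder_val;
            [apply (Cder_mult (fun _ => f' n z) (fun x => x)); [apply Cder_const|apply Cder_id]|].
          ring.
      - intros t Ht. specialize (Hin t Ht).
        eapply Rle_trans; [apply Hlip|].
        + replace (z + t * h - z)%C with (t * h)%C by ring. lra.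
        + replace (z - z)%C with (RtoC 0) by ring. rewrite Cmod_0. lra.
        + replace (z + t * h - z)%C with (t * h)%C by ring. nra. }
  intros eps He.
  exists (Rmin r (eps / (M + 1))). split; [apply Rmin_pos; auto; apply Rdiv_lt_0_compat; lra|].
  intros h Hlt. specialize (Key h (Rlt_le_trans _ _ _ Hlt (Rmin_l _ _))).
  assert (Hlt' := Rlt_le_trans _ _ _ Hlt (Rmin_r _ _)).
  eapply Rle_trans; [apply Key|]. apply Rmult_le_compat_r; [apply Cmod_ge_0|].
  apply Rle_trans with ((M + 1) * (eps / (M + 1))).
  - apply Rmult_le_compat; auto using Cmod_ge_0; lra.
  - right. field. lra.
Qed.

(** * Dynamics of the quadratic map *)

Section Julia.
Context (lam : R) (Hlam : 2 + sqrt 2 < lam).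

Definition orb n z : C := Nat.iter n (quad lam) z.

Lemma orb_S n z : orb (S n) z = quad lam (orb n z).
Proof. reflexivity. Qed.

Lemma orb_add (m n : nat) z : orb (m + n) z = orb m (orb n z).
Proof. apply Nat.iter_add. Qed.

Lemma orb_S_l n z : orb (S n) z = orb n (quad lam z).
Proof. replace (S n) with (n + 1)%nat by lia. apply orb_add. Qed.

Lemma Cmod_quad_ge z : Cmod z * Cmod z - Rabs lam <= Cmod (quad lam z).
Proof.
  unfold quad. rewrite <- Cmod_mult, <- (Cmod_R lam). apply Cmod_sub_triangle.
Qed.

Lemma Cmod_quad_ge' z : Rabs lam - Cmod z * Cmod z <= Cmod (quad lam z).
Proof.
  unfold quad. rewrite Cmod_sub_sym, <- Cmod_mult, <- (Cmod_R lam). apply Cmod_sub_triangle.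
Qed.

Lemma Cmod_quad_le z : Cmod (quad lam z) <= Cmod z * Cmod z + Rabs lam.
Proof.
  unfold quad. rewrite <- Cmod_mult, <- (Cmod_R lam). apply Cmod_minus_le.
Qed.

(** At lam = 2 + sqrt 2 one has 1 + 4 lam = (1 + 2 sqrt 2)^2, so xi = 1 + sqrt 2. Since lam - xi =
    (xi - 1)^2 - 1, the last inequality is exactly the assumption on lam. *)
Lemma xi_facts : xi lam * xi lam = xi lam + lam /\ 2 < xi lam /\ 1 < lam - xi lam.
Proof.
  assert (Hs : sqrt 2 * sqrt 2 = 2) by (apply sqrt_sqrt; lra).
  assert (Hs1 : 1 < sqrt 2) by (rewrite <- sqrt_1 at 1; apply sqrt_lt_1; lra).
  assert (HS : sqrt (1 + 4 * lam) * sqrt (1 + 4 * lam) = 1 + 4 * lam) by (apply sqrt_sqrt; lra).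
  pose proof (sqrt_pos (1 + 4 * lam)) as HS0.
  unfold xi. set (S := sqrt (1 + 4 * lam)) in *. set (s := sqrt 2) in *.
  assert (HS1 : 1 + 2 * s < S) by nra.
  repeat split; nra.
Qed.

Lemma lam_pos : 3 < lam.
Proof. destruct xi_facts as (_ & H1 & H2). lra. Qed.

Lemma Rabs_lam : Rabs lam = lam.
Proof. generalize lam_pos. intros. apply Rabs_pos_eq. lra. Qed.

(** Because xi^2 - lam = xi, an excess t of |z| over xi becomes at least 2 xi t after one step, and
    xi > 2. *)
Lemma orb_ge z (e : R) n :
  0 <= e -> xi lam + e <= Cmod z -> xi lam + 4 ^ n * e <= Cmod (orb n z).
Proof.
  intros He Hz. destruct xi_facts as (H1 & H2 & H3).
  induction n as [|n IH]; [simpl; change (orb 0 z) with z; lra|].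
  rewrite orb_S. eapply Rle_trans; [|apply Cmod_quad_ge]. rewrite Rabs_lam.
  set (w := Cmod (orb n z)) in *.
  assert (0 < 4 ^ n) by (apply pow_lt; lra). assert (0 <= 4 ^ n * e) by nra.
  simpl. nra.
Qed.

Lemma escapes_shift n z : escapes lam (orb n z) <-> escapes lam z.
Proof.
  unfold escapes. rewrite (is_lim_seq_incr_n (fun k => Cmod (Nat.iter k (quad lam) z)) n).
  split; apply is_lim_seq_ext; intros k; f_equal; [symmetry|]; apply orb_add.
Qed.

Lemma pow4_unbounded (e B : R) : 0 < e -> exists N : nat, forall n, (N <= n)%nat -> B < 4 ^ n * e.
Proof.
  intros He. destruct (Pow_x_infinity 4 ltac:(rewrite Rabs_pos_eq; lra) ((Rabs B + 1) / e)) as (N & HN).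
  exists N. intros n Hn. specialize (HN n Hn).
  rewrite Rabs_pos_eq in HN by (apply pow_le; lra).
  apply Rge_le in HN. apply (Rmult_le_compat_r e) in HN; [|lra].
  replace ((Rabs B + 1) / e * e) with (Rabs B + 1) in HN by (field; lra).
  generalize (Rle_abs B). lra.
Qed.

Lemma escapes_of_gt z : xi lam < Cmod z -> escapes lam z.
Proof.
  intros Hz. apply is_lim_seq_spec. intros M.
  destruct (pow4_unbounded (Cmod z - xi lam) M) as (N & HN); [lra|].
  exists N. intros n Hn. specialize (HN n Hn).
  pose proof (orb_ge z (Cmod z - xi lam) n ltac:(lra) ltac:(lra)) as H.
  change (Nat.iter n (quad lam) z) with (orb n z).
  destruct xi_facts as (_ & H2 & _). lra.
Qed.

Lemma julia_bounded z n : julia lam z -> Cmod (orb n z) <= xi lam.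
Proof.
  intros Hz. apply Rnot_lt_le. intros H. apply Hz, (escapes_shift n), escapes_of_gt, H.
Qed.

Lemma Omega_escapes z : Omega lam z <-> escapes lam z.
Proof.
  unfold Omega, julia. split; [apply NNPP|]. intros H H'. now apply H'.
Qed.

Lemma Omega_orb z n (B : R) :
  Omega lam z -> exists m, (n <= m)%nat /\ B < Cmod (orb m z).
Proof.
  intros H. apply Omega_escapes in H. apply is_lim_seq_spec in H.
  destruct (H B) as (N & HN). exists (n + N)%nat. split; [lia|]. apply HN. lia.
Qed.

Lemma tOmega_quad z : tOmega lam z -> tOmega lam (quad lam z).
Proof.
  intros Hz [H1 H2]. apply Hz. destruct xi_facts as (F1 & F2 & F3).
  destruct z as [x y]. unfold quad in *. simpl in *.
  assert (Hxy : x * y = 0) by lra.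
  (* A purely imaginary z is impossible, as then P(z) <= -lam < -xi; for real z the bound P(z) <= xi
     reads x^2 <= lam + xi = xi^2. *)
  apply Rmult_integral in Hxy. destruct Hxy as [-> | ->]; [nra|].
  split; auto. split; nra.
Qed.

Lemma tOmega_orb z n : tOmega lam z -> tOmega lam (orb n z).
Proof. intros Hz. induction n; auto. rewrite orb_S. now apply tOmega_quad. Qed.

Lemma tOmega_gt z : xi lam < Cmod z -> tOmega lam z.
Proof.
  intros Hz [H1 H2]. destruct z as [x y]. simpl in *. subst y.
  change (xi lam < Cmod (RtoC x)) in Hz. rewrite Cmod_R in Hz.
  apply Rabs_le in H2. lra.
Qed.

(** A point of the Julia set stays in [1 <= |Re|], where [P] at least doubles the imaginary part. *)
Lemma tOmega_Omega z : tOmega lam z -> Omega lam z.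
Proof.
  intros Hz Hj. apply Hz. destruct xi_facts as (F1 & F2 & F3).
  assert (Hx : forall n, 1 <= Rabs (fst (orb n z))).
  { intros n. apply Rnot_lt_le. intros Hlt.
    pose proof (julia_bounded z (S n) Hj) as Hb. rewrite orb_S in Hb.
    set (w := orb n z) in *. pose proof (re_le_Cmod (quad lam w)) as Hr.
    destruct w as [x y]. unfold quad, Re in Hr. simpl in Hr, Hlt.
    apply Rabs_def2 in Hlt. rewrite Rabs_left1 in Hr by nra.
    unfold quad in Hb. nra. }
  assert (Hy : forall n, 2 ^ n * Rabs (snd z) <= Rabs (snd (orb n z))).
  { induction n as [|n IH]; [change (orb 0 z) with z; simpl; lra|].
    rewrite orb_S. specialize (Hx n). set (w := orb n z) in *.
    destruct w as [x y]. unfold quad. simpl in *.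
    replace (x * y + y * x + - 0) with (2 * (x * y)) by ring.
    rewrite !Rabs_mult, (Rabs_pos_eq 2) by lra.
    pose proof (Rabs_pos y). nra. }
  assert (Hy0 : snd z = 0).
  { destruct (Req_dec (snd z) 0) as [E|E]; auto. exfalso.
    apply Rabs_pos_lt in E.
    destruct (Pow_x_infinity 2 ltac:(rewrite Rabs_pos_eq; lra) ((xi lam + 1) / Rabs (snd z))) as (N & HN).
    specialize (HN N (Nat.le_refl N)). specialize (Hy N).
    rewrite Rabs_pos_eq in HN by (apply pow_le; lra).
    apply Rge_le, (Rmult_le_compat_r (Rabs (snd z))) in HN; [|lra].
    replace ((xi lam + 1) / Rabs (snd z) * Rabs (snd z)) with (xi lam + 1) in HN by (field; lra).
    pose proof (Im_le_Cmod (orb N z)). unfold Im in H.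
    pose proof (julia_bounded z N Hj). lra. }
  split; auto. pose proof (julia_bounded z 0 Hj) as Hb.
  change (orb 0 z) with z in Hb. pose proof (re_le_Cmod z). unfold Re in H.
  apply Rabs_le_between. lra.
Qed.

(** This is where [lam > 2 + sqrt 2] is essential: the central gap has half-length [sqrt (lam - xi)], which exceeds [1]. *)
Lemma gap_radius : exists q : R, 1 < q < 2 /\ q * q < lam - xi lam.
Proof.
  destruct xi_facts as (F1 & F2 & F3).
  exists (1 + Rmin (1 / 2) ((lam - xi lam - 1) / 4)).
  pose proof (Rmin_l (1 / 2) ((lam - xi lam - 1) / 4)).
  pose proof (Rmin_r (1 / 2) ((lam - xi lam - 1) / 4)).
  assert (0 < Rmin (1 / 2) ((lam - xi lam - 1) / 4)) by (apply Rmin_pos; lra).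
  split; [lra|]. nra.
Qed.

(** One step maps the disc outside the circle of radius xi + (lam - xi - q^2). This excess does not
    depend on z, so a single M serves the whole disc. *)
Lemma gap_escapes (q B : R) : 0 < q -> q * q < lam - xi lam ->
  exists M : nat, forall z : C, Cmod z < q -> forall n, (M <= n)%nat -> B < Cmod (orb n z).
Proof.
  intros Hq Hqq. destruct (pow4_unbounded (lam - xi lam - q * q) B) as (M & HM); [lra|].
  exists (S M). intros z Hz n Hn. destruct n as [|n]; [lia|].
  rewrite orb_S_l. specialize (HM n ltac:(lia)).
  eapply Rlt_le_trans; [apply HM|].
  destruct xi_facts as (F1 & F2 & F3).
  eapply Rle_trans; [|apply (orb_ge _ (lam - xi lam - q * q)); [lra|]]; [lra|].
  eapply Rle_trans; [|apply Cmod_quad_ge']. rewrite Rabs_lam.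
  pose proof (Cmod_ge_0 z). nra.
Qed.

(** * The logarithmic derivative of G near infinity *)

(** Built coordinatewise from the total function [Lim_seq], hence meaningful only for convergent
    sequences. *)
Definition Clim (u : nat -> C) : C :=
  (real (Lim_seq (fun n => Re (u n))), real (Lim_seq (fun n => Im (u n)))).

Lemma Cmod_le_Re_Im z : Cmod z <= Rabs (Re z) + Rabs (Im z).
Proof.
  replace z with (RtoC (Re z) + Ci * RtoC (Im z))%C at 1.
  - eapply Rle_trans; [apply Cmod_triangle|]. rewrite Cmod_mult, Cmod_Ci, !Cmod_R. lra.
  - destruct z as [x y]. unfold Re, Im, Ci, RtoC, Cplus, Cmult. simpl. f_equal; ring.
Qed.

Lemma Clim_geometric (u : nat -> C) (A : R) :
  (forall n, Cmod (u (S n) - u n)%C <= A * (/ 2) ^ n) -> Cseq_lim u (Clim u).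
Proof.
  intros H.
  assert (HA : 0 <= A).
  { specialize (H 0%nat). simpl in H. generalize (Cmod_ge_0 (u 1%nat - u 0%nat)%C). lra. }
  assert (Hc : forall p : C -> R, (forall a b, p (a - b)%C = p a - p b) ->
            (forall a, Rabs (p a) <= Cmod a) ->
            is_lim_seq (fun n => p (u n)) (real (Lim_seq (fun n => p (u n))))).
  { intros p Hp1 Hp2.
    assert (Hs : ex_series (fun n => p (u (S n)) - p (u n))).
    { apply (ex_series_le (K := R_AbsRing) (V := R_CompleteNormedModule) _ (fun n => A * (/ 2) ^ n)).
      - intros n. change (Rabs (p (u (S n)) - p (u n)) <= A * (/ 2) ^ n).
        rewrite <- Hp1. eapply Rle_trans; [apply Hp2|apply H].
      - apply (ex_series_scal (K := R_AbsRing) (V := R_NormedModule) A (fun n => (/ 2) ^ n)).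
        apply ex_series_geom. rewrite Rabs_pos_eq; lra. }
    destruct Hs as [l Hl].
    assert (Hlim : is_lim_seq (fun n => p (u n)) (p (u 0%nat) + l)).
    { apply is_lim_seq_incr_1.
      apply is_lim_seq_ext with (fun n => p (u 0%nat) + sum_n (fun n => p (u (S n)) - p (u n)) n).
      - intros n. induction n as [|n IH]; [rewrite sum_O; ring|].
        rewrite sum_Sn. change plus with Rplus. rewrite <- IH. simpl. lra.
      - apply is_lim_seq_plus'; [apply is_lim_seq_const|exact Hl]. }
    rewrite (is_lim_seq_unique _ _ Hlim). exact Hlim. }
  pose proof (Hc Re ltac:(intros; unfold Re; simpl; ring) re_le_Cmod) as H1.
  pose proof (Hc Im ltac:(intros; unfold Im; simpl; ring) Im_le_Cmod) as H2.
  intros eps He.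
  apply is_lim_seq_spec in H1, H2.
  destruct (H1 (mkposreal (eps / 2) ltac:(lra))) as (N1 & HN1).
  destruct (H2 (mkposreal (eps / 2) ltac:(lra))) as (N2 & HN2).
  exists (N1 + N2)%nat. intros n Hn. specialize (HN1 n ltac:(lia)). specialize (HN2 n ltac:(lia)).
  simpl in HN1, HN2.
  eapply Rle_lt_trans; [apply Cmod_le_Re_Im|].
  replace (Re (u n - Clim u)%C) with (Re (u n) - real (Lim_seq (fun n => Re (u n))))
    by (unfold Clim, Re; simpl; ring).
  replace (Im (u n - Clim u)%C) with (Im (u n) - real (Lim_seq (fun n => Im (u n))))
    by (unfold Clim, Im; simpl; ring).
  lra.
Qed.

Lemma Cseq_lim_ge (u : nat -> C) (l : C) (B : R) :
  Cseq_lim u l -> (forall n, B <= Cmod (u n)) -> B <= Cmod l.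
Proof.
  intros H HB. apply Rnot_lt_le. intros Hlt.
  destruct (H (B - Cmod l)) as (N & HN); [lra|].
  specialize (HN N (Nat.le_refl N)). specialize (HB N).
  generalize (Cmod_sub_triangle (u N) l). lra.
Qed.

Fixpoint dorb (n : nat) (z : C) : C :=
  match n with O => 1 | S k => 2 * orb k z * dorb k z end%C.

Fixpoint porb (n : nat) (z : C) : C :=
  match n with O => 1 | S k => orb k z * porb k z end%C.

Lemma dorb_porb n z : dorb n z = (RtoC (2 ^ n) * porb n z)%C.
Proof. induction n as [|n IH]; simpl; [ring|]. rewrite IH, RtoC_mult. ring. Qed.

Lemma Cder_quad z : Cder (quad lam) z (2 * z)%C.
Proof.
  eapply Cder_val.
  - apply (Cder_minus (fun z => z * z)%C (fun _ => RtoC lam));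
      [apply (Cder_mult (fun z => z) (fun z => z)); apply Cder_id|apply Cder_const].
  - simpl. ring.
Qed.

Lemma Cder_orb n z : Cder (orb n) z (dorb n z).
Proof.
  induction n as [|n IH]; [exact (Cder_id z)|].
  apply (Cder_comp (orb n) (quad lam)); auto. apply Cder_quad.
Qed.

Lemma Cder_dorb n z : exists l, Cder (dorb n) z l.
Proof.
  induction n as [|n [l IH]]; [exists 0%C; exact (Cder_const 1 z)|].
  eexists. apply (Cder_mult (fun z => 2 * orb n z)%C (dorb n)); [|exact IH].
  apply (Cder_mult (fun _ => 2%C) (orb n)); [apply Cder_const|apply Cder_orb].
Qed.

(** [Wn n z = z_n / (z_0 ... z_(n-1))] converges to [- G/G']; [Sn n] is the logarithmic derivative of [Wn n], and [Dn n] the derivative of [Sn n]. *)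
Fixpoint Wn (n : nat) (z : C) : C :=
  match n with
  | O => z
  | S k => Wn k z * (1 - lam / (orb k z * orb k z))
  end%C.

(** The logarithmic derivative of the factor 1 - lam / z_k^2, after substituting z_k' = 2^k z_k /
    W_k. *)
Definition sigma (k : nat) z : C :=
  (RtoC (2 ^ S k) * (lam / (orb k z * orb k z)) / Wn (S k) z)%C.

Fixpoint Sn (n : nat) (z : C) : C :=
  match n with O => / z | S k => Sn k z + sigma k z end%C.

Fixpoint Dn (n : nat) (z : C) : C :=
  match n with
  | O => - / (z * z)
  | S k => Dn k z - sigma k z * (RtoC (2 ^ S k) / Wn k z + Sn (S k) z)
  end%C.

(** Beyond this radius |P(z)| >= 8 |z|, so lam / z_n^2 decays like 64^-n and outweighs the powers of
    2 that differentiation produces. The inequality (lam + 16)^2 >= 64 lam provides one further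
    factor 1/64. *)
Definition Rinf : R := lam + 16.

Lemma orb_inf z n : Rinf <= Cmod z -> 8 ^ n * Cmod z <= Cmod (orb n z).
Proof.
  intros Hz. pose proof lam_pos. unfold Rinf in Hz.
  induction n as [|n IH]; [change (orb 0 z) with z; simpl; lra|].
  rewrite orb_S. eapply Rle_trans; [|apply Cmod_quad_ge]. rewrite Rabs_lam by auto.
  set (w := Cmod (orb n z)) in *.
  assert (H8 : 1 <= 8 ^ n) by (apply pow_R1_Rle; lra).
  assert (Hw : lam + 16 <= w) by nra.
  assert (8 * w <= w * w - lam) by nra. simpl. lra.
Qed.

Lemma orb_inf_neq0 z n : Rinf <= Cmod z -> orb n z <> 0%C.
Proof.
  intros Hz. pose proof (orb_inf z n Hz). pose proof lam_pos.
  apply Cmod_gt_0. unfold Rinf in Hz.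
  assert (1 <= 8 ^ n) by (apply pow_R1_Rle; lra). nra.
Qed.

Lemma q_bound z n : Rinf <= Cmod z ->
  Cmod (lam / (orb n z * orb n z))%C <= (/ 64) ^ S n.
Proof.
  intros Hz. pose proof lam_pos as Hl. pose proof (orb_inf z n Hz) as H.
  pose proof (orb_inf_neq0 z n Hz) as H0.
  rewrite Cmod_div by (now apply Cmult_neq_0).
  rewrite Cmod_mult, Cmod_R, Rabs_lam by auto. unfold Rinf in Hz.
  set (w := Cmod (orb n z)) in *.
  assert (H8 : 1 <= 8 ^ n) by (apply pow_R1_Rle; lra).
  assert (Hw : 0 < w) by nra.
  assert (E : (/ 64) ^ S n = / (64 * (8 ^ n * 8 ^ n))).
  { rewrite <- Rpow_mult_distr. replace (8 * 8) with 64 by ring.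
    replace (64 * 64 ^ n) with (64 ^ S n) by reflexivity. now rewrite pow_inv. }
  rewrite E. apply Rmult_le_reg_r with (64 * (8 ^ n * 8 ^ n) * (w * w)); [|].
  { repeat apply Rmult_lt_0_compat; lra. }
  replace (lam / (w * w) * (64 * (8 ^ n * 8 ^ n) * (w * w))) with (64 * lam * (8 ^ n * 8 ^ n))
    by (field; lra).
  replace (/ (64 * (8 ^ n * 8 ^ n)) * (64 * (8 ^ n * 8 ^ n) * (w * w))) with (w * w)
    by (field; lra).
  apply Rle_trans with ((8 ^ n * Cmod z) * (8 ^ n * Cmod z)).
  - replace ((8 ^ n * Cmod z) * (8 ^ n * Cmod z)) with (Cmod z * Cmod z * (8 ^ n * 8 ^ n)) by ring.
    apply Rmult_le_compat_r; [nra|]. pose proof (Rle_0_sqr (lam - 16)) as Hsq. unfold Rsqr in Hsq.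
    apply Rle_trans with ((lam + 16) * (lam + 16)); [nra|]. apply Rmult_le_compat; lra.
  - apply Rmult_le_compat; nra.
Qed.

(** The terms in (1/64)^n strengthen the induction hypothesis: the room given up at step n pays for
    the next factor 1 - lam / z_n^2. [Sn_bound] and [Dn_bound] use the same device. *)
Lemma Wn_bounds z n : Rinf <= Cmod z ->
  Cmod z * (1 / 2 + (/ 64) ^ n / 2) <= Cmod (Wn n z) <= Cmod z * (2 - (/ 64) ^ n).
Proof.
  intros Hz. pose proof lam_pos as Hl.
  induction n as [|n IH]; [simpl; split; lra|].
  pose proof (q_bound z n Hz) as Hq.
  change (Wn (S n) z) with (Wn n z * (1 - lam / (orb n z * orb n z)))%C.
  rewrite Cmod_mult. set (q := (lam / (orb n z * orb n z))%C) in *.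
  pose proof (Cmod_sub_triangle 1 q) as Q1. pose proof (Cmod_minus_le 1 q) as Q2.
  rewrite Cmod_1 in Q1, Q2. simpl in Hq |- *.
  assert (X0 : 0 < (/ 64) ^ n) by (apply pow_lt; lra).
  assert (X1 : (/ 64) ^ n <= 1).
  { rewrite <- (pow1 n). apply pow_incr. lra. }
  set (x := (/ 64) ^ n) in *. unfold Rinf in Hz. set (m := Cmod z) in *.
  set (w := Cmod (Wn n z)) in *. set (v := Cmod (1 - q)) in *.
  destruct IH as [I1 I2]. split.
  - apply Rle_trans with (m * (1 / 2 + x / 2) * (1 - / 64 * x)).
    + rewrite Rmult_assoc. apply Rmult_le_compat_l; nra.
    + apply Rmult_le_compat; nra.
  - apply Rle_trans with (m * (2 - x) * (1 + / 64 * x)).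
    + apply Rmult_le_compat; try nra; apply Cmod_ge_0.
    + rewrite Rmult_assoc. apply Rmult_le_compat_l; nra.
Qed.

Lemma Wn_bounds' z n : Rinf <= Cmod z ->
  Cmod z / 2 <= Cmod (Wn n z) <= 2 * Cmod z.
Proof.
  intros Hz. pose proof (Wn_bounds z n Hz). pose proof (Cmod_ge_0 z).
  assert (X0 : 0 < (/ 64) ^ n) by (apply pow_lt; lra). nra.
Qed.

Lemma Wn_neq0 z n : Rinf <= Cmod z -> Wn n z <> 0%C.
Proof.
  intros Hz. pose proof (Wn_bounds' z n Hz). pose proof lam_pos.
  apply Cmod_gt_0. unfold Rinf in Hz. lra.
Qed.

Lemma Wn_porb z n : (forall k, (k < n)%nat -> orb k z <> 0%C) ->
  (Wn n z * porb n z = orb n z)%C.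
Proof.
  induction n as [|n IH]; intros H; [simpl; change (orb 0 z) with z; ring|].
  rewrite orb_S. simpl. specialize (IH ltac:(intros; apply H; lia)).
  specialize (H n ltac:(lia)).
  replace (Wn n z * (1 - lam / (orb n z * orb n z)) * (orb n z * porb n z))%C
    with ((Wn n z * porb n z) * (orb n z - lam / orb n z))%C by (field; auto).
  rewrite IH. unfold quad. field. auto.
Qed.

Lemma sig_bound z n : Rinf <= Cmod z -> Cmod (sigma n z) <= (/ 32) ^ S n.
Proof.
  intros Hz. pose proof lam_pos as Hl. unfold sigma.
  rewrite Cmod_div by now apply Wn_neq0. rewrite Cmod_mult, Cmod_R, Rabs_pos_eq
    by (apply pow_le; lra).
  pose proof (q_bound z n Hz) as Hq. pose proof (Wn_bounds' z (S n) Hz) as [Hw _].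
  set (w := Cmod (Wn (S n) z)) in *. unfold Rinf in Hz.
  replace ((/ 32) ^ S n) with (2 ^ S n * (/ 64) ^ S n)
    by (rewrite <- Rpow_mult_distr; f_equal; lra).
  assert (0 < 2 ^ S n) by (apply pow_lt; lra).
  assert (0 < (/ 64) ^ S n) by (apply pow_lt; lra).
  apply Rmult_le_reg_r with w; [lra|].
  set (x := Cmod (lam / (orb n z * orb n z))%C) in *.
  assert (0 <= x) by apply Cmod_ge_0.
  replace (2 ^ S n * x / w * w) with (2 ^ S n * x) by (field; lra).
  rewrite Rmult_assoc. apply Rmult_le_compat_l; nra.
Qed.

Lemma Sn_bound z n : Rinf <= Cmod z -> Cmod (Sn n z) <= 1 / 2 - (/ 32) ^ n / 4.
Proof.
  intros Hz. pose proof lam_pos as Hl.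
  induction n as [|n IH].
  - simpl. unfold Rinf in Hz. rewrite Cmod_inv by (apply Cmod_gt_0; lra).
    apply Rle_trans with (/ 16); [apply Rinv_le_contravar|]; lra.
  - simpl. eapply Rle_trans; [apply Cmod_triangle|].
    pose proof (sig_bound z n Hz) as H. simpl in H.
    assert (X0 : 0 < (/ 32) ^ n) by (apply pow_lt; lra). lra.
Qed.

Lemma Dn_bound z n : Rinf <= Cmod z -> Cmod (Dn n z) <= 1 - (/ 16) ^ n / 2.
Proof.
  intros Hz. pose proof lam_pos as Hl.
  induction n as [|n IH].
  - simpl. unfold Rinf in Hz.
    rewrite Cmod_opp, Cmod_inv, Cmod_mult.
    + apply Rle_trans with (/ 16); [apply Rinv_le_contravar|]; nra.
    + apply Cmult_neq_0; apply Cmod_gt_0; lra.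
  - change (Dn (S n) z) with (Dn n z - sigma n z * (RtoC (2 ^ S n) / Wn n z + Sn (S n) z))%C.
    eapply Rle_trans; [apply Cmod_minus_le|]. rewrite Cmod_mult.
    pose proof (sig_bound z n Hz) as H1. pose proof (Sn_bound z (S n) Hz) as H2.
    assert (X0 : 0 < (/ 16) ^ n) by (apply pow_lt; lra).
    assert (X1 : 0 < (/ 32) ^ S n) by (apply pow_lt; lra).
    assert (X2 : 1 <= 2 ^ S n) by (apply pow_R1_Rle; lra).
    assert (H3 : Cmod (RtoC (2 ^ S n) / Wn n z + Sn (S n) z)%C <= 2 ^ S n * 2).
    { eapply Rle_trans; [apply Cmod_triangle|].
      rewrite Cmod_div, Cmod_R, Rabs_pos_eq by (try apply Wn_neq0; auto; lra).
      pose proof (Wn_bounds' z n Hz) as [Hw _]. unfold Rinf in Hz.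
      assert (2 ^ S n / Cmod (Wn n z) <= 2 ^ S n).
      { apply Rmult_le_reg_r with (Cmod (Wn n z)); [lra|].
        replace (2 ^ S n / Cmod (Wn n z) * Cmod (Wn n z)) with (2 ^ S n) by (field; lra). nra. }
      lra. }
    assert (H4 : Cmod (sigma n z) * Cmod (RtoC (2 ^ S n) / Wn n z + Sn (S n) z)
                 <= (/ 32) ^ S n * (2 ^ S n * 2))
      by (apply Rmult_le_compat; auto using Cmod_ge_0).
    replace ((/ 32) ^ S n * (2 ^ S n * 2)) with ((/ 16) ^ S n * 2) in H4
      by (rewrite <- Rmult_assoc, <- Rpow_mult_distr; do 2 f_equal; lra).
    simpl in H4 |- *. lra.
Qed.

Lemma Cder_qn n z : orb n z <> 0%C ->
  Cder (fun z => lam / (orb n z * orb n z))%C z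
    (- 2 * lam * dorb n z / (orb n z * orb n z * orb n z))%C.
Proof.
  intros Hz. eapply Cder_val.
  - apply (Cder_div (fun _ => RtoC lam) (fun z => orb n z * orb n z)%C);
      [now apply Cmult_neq_0|apply Cder_const|].
    apply (Cder_mult (orb n) (orb n)); apply Cder_orb.
  - field. auto.
Qed.

Lemma Cder_Wn n z : Rinf <= Cmod z -> Cder (Wn n) z (Wn n z * Sn n z)%C.
Proof.
  intros Hz. induction n as [|n IH].
  - eapply Cder_val; [exact (Cder_id z)|]. simpl.
    pose proof (orb_inf_neq0 z 0 Hz) as H. change (orb 0 z) with z in H. field. auto.
  - pose proof (orb_inf_neq0 z n Hz) as H.
    pose proof (Wn_neq0 z (S n) Hz) as HW. pose proof (Wn_neq0 z n Hz) as HW'.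
    pose proof (Wn_porb z n (fun k _ => orb_inf_neq0 z k Hz)) as Hp.
    eapply Cder_val.
    + apply (Cder_mult (Wn n) (fun z => 1 - lam / (orb n z * orb n z))%C); [exact IH|].
      apply (Cder_minus (fun _ => 1%C)); [apply Cder_const|apply Cder_qn; auto].
    + cbv beta. simpl (Sn (S n) z). unfold sigma.
      replace (Wn (S n) z * (Sn n z + RtoC (2 ^ S n) * (lam / (orb n z * orb n z)) / Wn (S n) z))%C
        with (Wn (S n) z * Sn n z + RtoC (2 ^ S n) * (lam / (orb n z * orb n z)))%C
        by (field; auto).
      rewrite dorb_porb. simpl (Wn (S n) z). simpl (2 ^ S n). rewrite RtoC_mult.
      assert (E : porb n z = (orb n z / Wn n z)%C) by (rewrite <- Hp; field; auto).
      rewrite E. field. auto.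
Qed.

Lemma Cder_sig n z : Rinf <= Cmod z ->
  Cder (sigma n) z (- sigma n z * (RtoC (2 ^ S n) / Wn n z + Sn (S n) z))%C.
Proof.
  intros Hz. pose proof (orb_inf_neq0 z n Hz) as H.
  pose proof (Wn_neq0 z (S n) Hz) as HW. pose proof (Wn_neq0 z n Hz) as HW'.
  pose proof (Wn_porb z n (fun k _ => orb_inf_neq0 z k Hz)) as Hp.
  eapply Cder_val.
  - apply (Cder_div (fun z => RtoC (2 ^ S n) * (lam / (orb n z * orb n z)))%C (Wn (S n))).
    + exact HW.
    + apply (Cder_mult (fun _ => RtoC (2 ^ S n))); [apply Cder_const|apply Cder_qn; auto].
    + now apply Cder_Wn.
  - cbv beta. rewrite dorb_porb. unfold sigma.
    replace (2 * (RtoC (2 ^ n) * porb n z))%C with (RtoC (2 ^ S n) * porb n z)%C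
      by (simpl; rewrite RtoC_mult; ring).
    assert (E : (RtoC (2 ^ n) * porb n z = RtoC (2 ^ n) * orb n z / Wn n z)%C)
      by (rewrite <- Hp; field; auto).
    rewrite E. simpl (2 ^ S n). rewrite RtoC_mult.
    set (w' := Wn (S n) z) in *. set (w := Wn n z) in *. set (s := Sn (S n) z).
    field. auto.
Qed.

Lemma Cder_Sn n z : Rinf <= Cmod z -> Cder (Sn n) z (Dn n z).
Proof.
  intros Hz. induction n as [|n IH].
  - apply Cder_inv. apply (orb_inf_neq0 z 0 Hz).
  - eapply Cder_val; [apply (Cder_plus (Sn n) (sigma n)); [exact IH|apply Cder_sig; auto]|].
    change (Dn (S n) z) with (Dn n z - sigma n z * (RtoC (2 ^ S n) / Wn n z + Sn (S n) z))%C. ring.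
Qed.

Definition Winf z : C := Clim (fun n => Wn n z).
Definition Sinf z : C := Clim (fun n => Sn n z).

Lemma Wn_lim z : Rinf <= Cmod z -> Cseq_lim (fun n => Wn n z) (Winf z).
Proof.
  intros Hz. apply (Clim_geometric _ (2 * Cmod z)). intros n.
  change (Wn (S n) z) with (Wn n z * (1 - lam / (orb n z * orb n z)))%C.
  replace (Wn n z * (1 - lam / (orb n z * orb n z)) - Wn n z)%C
    with (- (Wn n z * (lam / (orb n z * orb n z))))%C
    by ring.
  rewrite Cmod_opp, Cmod_mult. apply Rmult_le_compat; auto using Cmod_ge_0.
  - apply Wn_bounds'; auto.
  - eapply Rle_trans; [apply q_bound; auto|]. simpl.
    assert (0 < (/ 64) ^ n) by (apply pow_lt; lra).
    assert ((/ 64) ^ n <= (/ 2) ^ n) by (apply pow_incr; lra). lra.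
Qed.

Lemma Sn_lim z : Rinf <= Cmod z -> Cseq_lim (fun n => Sn n z) (Sinf z).
Proof.
  intros Hz. apply (Clim_geometric _ 1). intros n.
  change (Sn (S n) z) with (Sn n z + sigma n z)%C.
  replace (Sn n z + sigma n z - Sn n z)%C with (sigma n z) by ring.
  eapply Rle_trans; [apply sig_bound; auto|]. simpl.
  assert (0 < (/ 32) ^ n) by (apply pow_lt; lra).
  assert ((/ 32) ^ n <= (/ 2) ^ n) by (apply pow_incr; lra). lra.
Qed.

Lemma Winf_bounds z : Rinf <= Cmod z -> Cmod z / 2 <= Cmod (Winf z) <= 2 * Cmod z.
Proof.
  intros Hz. split.
  - apply (Cseq_lim_ge _ _ _ (Wn_lim z Hz)). intros n. apply Wn_bounds'; auto.
  - apply (Cseq_lim_le _ _ _ (Wn_lim z Hz)). intros n. apply Wn_bounds'; auto.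
Qed.

Lemma Sinf_bound z : Rinf <= Cmod z -> Cmod (Sinf z) <= 1.
Proof.
  intros Hz. apply (Cseq_lim_le _ _ _ (Sn_lim z Hz)). intros n.
  eapply Rle_trans; [apply Sn_bound; auto|].
  assert (0 < (/ 32) ^ n) by (apply pow_lt; lra). lra.
Qed.

Lemma Winf_neq0 z : Rinf <= Cmod z -> Winf z <> 0%C.
Proof.
  intros Hz. apply Cmod_gt_0. pose proof (Winf_bounds z Hz). pose proof lam_pos.
  unfold Rinf in Hz. lra.
Qed.

Lemma ball_inf z w : Rinf + 1 <= Cmod z -> Cmod (w - z)%C < 1 -> Rinf <= Cmod w.
Proof.
  intros Hz Hw. rewrite Cmod_sub_sym in Hw. generalize (Cmod_sub_triangle z w). lra.
Qed.

Lemma segment_ball (z w v : C) (r t : R) : 0 <= t <= 1 ->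
  Cmod (w - z)%C < r -> Cmod (v - z)%C < r -> Cmod (v + t * (w - v) - z)%C < r.
Proof.
  intros Ht Hw Hv.
  replace (v + t * (w - v) - z)%C with (RtoC (1 - t) * (v - z) + RtoC t * (w - z))%C
    by (rewrite RtoC_minus; ring).
  eapply Rle_lt_trans; [apply Cmod_triangle|]. rewrite !Cmod_mult, !Cmod_R, !Rabs_pos_eq by lra.
  destruct (Req_dec t 0) as [->|]; [lra|]. nra.
Qed.

Lemma Sn_lipschitz n (z w v : C) : Rinf + 1 <= Cmod z ->
  Cmod (w - z)%C < 1 -> Cmod (v - z)%C < 1 -> Cmod (Sn n w - Sn n v)%C <= 1 * Cmod (w - v)%C.
Proof.
  intros Hz Hw Hv. apply (Cder_lipschitz (Sn n) (Dn n)).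
  - intros t Ht. apply Cder_Sn. apply (ball_inf z); auto. now apply segment_ball.
  - intros t Ht. eapply Rle_trans; [apply Dn_bound|].
    + apply (ball_inf z); auto. now apply segment_ball.
    + assert (0 < (/ 16) ^ n) by (apply pow_lt; lra). lra.
Qed.

(** Continuity suffices here, because [Sinf] enters T'' only through W', and T'' has to be
    continuous along the ray but not differentiable. *)
Lemma Sinf_cont z : Rinf + 1 <= Cmod z -> Ccont Sinf z.
Proof.
  intros Hz eps He. exists (Rmin 1 (eps / 2)). split; [apply Rmin_pos; lra|].
  intros h Hh. pose proof (Rmin_l 1 (eps / 2)). pose proof (Rmin_r 1 (eps / 2)).
  assert (Hzz : Cmod (z - z)%C < 1) by (replace (z - z)%C with (RtoC 0) by ring; rewrite Cmod_0; lra).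
  assert (Hhz : Cmod (z + h - z)%C < 1) by (replace (z + h - z)%C with h by ring; lra).
  apply Rle_lt_trans with (1 * Cmod h); [|lra].
  eapply (Cseq_lim_le (fun n => Sn n (z + h) - Sn n z)%C).
  - apply Cseq_lim_plus; [|apply Cseq_lim_opp]; apply Sn_lim.
    + apply (ball_inf z); auto.
    + lra.
  - intros n. pose proof (Sn_lipschitz n z _ _ Hz Hhz Hzz) as L.
    now replace (z + h - z)%C with h in L by ring.
Qed.

(** The constant is free of n, as [Cder_lim] requires. It comes from |W_n| <= 2 (|z| + 1) and |S_n^2
    + D_n| <= 2 on the unit disc about z. *)
Lemma Wn'_lipschitz n (z w v : C) : Rinf + 1 <= Cmod z ->
  Cmod (w - z)%C < 1 -> Cmod (v - z)%C < 1 ->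
  Cmod (Wn n w * Sn n w - Wn n v * Sn n v)%C <= (4 * (Cmod z + 1)) * Cmod (w - v)%C.
Proof.
  intros Hz Hw Hv.
  apply (Cder_lipschitz (fun z => Wn n z * Sn n z)%C
           (fun z => Wn n z * Sn n z * Sn n z + Wn n z * Dn n z)%C).
  - intros t Ht. assert (B : Rinf <= Cmod (v + t * (w - v))%C)
      by (apply (ball_inf z); auto; now apply segment_ball).
    apply (Cder_mult (Wn n) (Sn n)); [now apply Cder_Wn|now apply Cder_Sn].
  - intros t Ht. assert (B0 := segment_ball z w v 1 t Ht Hw Hv).
    set (x := (v + t * (w - v))%C) in *.
    assert (B : Rinf <= Cmod x) by (apply (ball_inf z); auto).
    pose proof (Wn_bounds' x n B) as [_ H1]. pose proof (Sn_bound x n B) as H2.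
    pose proof (Dn_bound x n B) as H3.
    assert (X0 : 0 < (/ 16) ^ n) by (apply pow_lt; lra).
    assert (X1 : 0 < (/ 32) ^ n) by (apply pow_lt; lra).
    pose proof (Cmod_sub_triangle x z).
    pose proof (Cmod_ge_0 (Wn n x)). pose proof (Cmod_ge_0 (Sn n x)). pose proof (Cmod_ge_0 (Dn n x)).
    eapply Rle_trans; [apply Cmod_triangle|]. rewrite !Cmod_mult.
    assert (Cmod (Sn n x) * Cmod (Sn n x) <= 1) by nra.
    nra.
Qed.

Lemma Cder_Winf z : Rinf + 1 <= Cmod z -> Cder Winf z (Winf z * Sinf z)%C.
Proof.
  intros Hz.
  apply (Cder_lim Wn (fun n z => Wn n z * Sn n z)%C Winf (fun z => Winf z * Sinf z)%C z 1
           (4 * (Cmod z + 1))).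
  - lra.
  - intros n w Hw. apply Cder_Wn. now apply (ball_inf z).
  - intros n w v Hw Hv. now apply Wn'_lipschitz.
  - intros w Hw. apply Wn_lim. now apply (ball_inf z).
  - intros w Hw. assert (Rinf <= Cmod w) by now apply (ball_inf z).
    apply Cseq_lim_mult; [now apply Wn_lim|now apply Sn_lim].
Qed.

Lemma Wn_inv_lipschitz n (z w v : C) : Rinf + 1 <= Cmod z ->
  Cmod (w - z)%C < 1 -> Cmod (v - z)%C < 1 ->
  Cmod (/ Wn n w - / Wn n v)%C <= 1 * Cmod (w - v)%C.
Proof.
  intros Hz Hw Hv.
  apply (Cder_lipschitz (fun z => / Wn n z)%C (fun z => - / (Wn n z * Wn n z) * (Wn n z * Sn n z))%C).
  - intros t Ht. assert (B : Rinf <= Cmod (v + t * (w - v))%C)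
      by (apply (ball_inf z); auto; now apply segment_ball).
    apply (Cder_comp (Wn n) (fun x => / x)%C); [now apply Cder_Wn|apply Cder_inv; now apply Wn_neq0].
  - intros t Ht. assert (B0 := segment_ball z w v 1 t Ht Hw Hv).
    set (x := (v + t * (w - v))%C) in *.
    assert (B : Rinf <= Cmod x) by (apply (ball_inf z); auto).
    pose proof (Wn_neq0 x n B) as HW.
    replace (- / (Wn n x * Wn n x) * (Wn n x * Sn n x))%C with (- (Sn n x / Wn n x))%C by (field; auto).
    rewrite Cmod_opp, Cmod_div by auto.
    pose proof (Wn_bounds' x n B) as [H1 _]. pose proof (Sn_bound x n B) as H2.
    pose proof lam_pos. unfold Rinf in B.
    assert (X1 : 0 < (/ 32) ^ n) by (apply pow_lt; lra).
    apply Rmult_le_reg_r with (Cmod (Wn n x)); [lra|].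
    replace (Cmod (Sn n x) / Cmod (Wn n x) * Cmod (Wn n x)) with (Cmod (Sn n x)) by (field; lra).
    lra.
Qed.

(** * The maximum principle *)

Definition square (B : R) z : Prop := Rabs (Re z) <= B /\ Rabs (Im z) <= B.

Lemma square_cover (B : R) (delta : C -> R) : (forall z, 0 < delta z) ->
  exists l : list C, forall z, square B z ->
    exists w, In w l /\ square B w /\ Cmod (z - w)%C < delta w.
Proof.
  intros Hd. apply NNPP. intros Hn.
  (* Half of [delta], since closeness is measured coordinatewise and |z| <= |Re z| + |Im z|. *)
  assert (Hd' : forall t : Compactness.Tn 2 R, 0 < delta (fst t, fst (snd t)) / 2)
    by (intros t; generalize (Hd (fst t, fst (snd t))); lra).
  apply (compactness_list 2 (- B, (- B, tt)) (B, (B, tt)) (fun t => mkposreal _ (Hd' t))).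
  intros (l & Hl). apply Hn.
  exists (map (fun t : Compactness.Tn 2 R => (fst t, fst (snd t))) l).
  intros z [Hz1 Hz2].
  destruct (Hl (Re z, (Im z, tt))) as (t & Hin & Hb & Hc).
  { simpl. apply Rabs_le_between in Hz1, Hz2. repeat split; lra. }
  destruct t as (t1 & t2 & []). exists (t1, t2). split.
  { apply (in_map (fun t : Compactness.Tn 2 R => (fst t, fst (snd t))) l _ Hin). }
  simpl in Hb, Hc. split.
  { split; apply Rabs_le; unfold Re, Im; simpl; lra. }
  eapply Rle_lt_trans; [apply Cmod_le_Re_Im|].
  unfold Re, Im in *; simpl in *. unfold Rminus in Hc. lra.
Qed.

Lemma list_argmax {A : Type} (phi : A -> R) (l : list A) : l <> nil ->
  exists m, In m l /\ forall x, In x l -> phi x <= phi m.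
Proof.
  induction l as [|a l IH]; intros Hl; [easy|].
  destruct l as [|b l'].
  - exists a. split; [now left|]. intros x [<-|[]]. lra.
  - destruct IH as (m & Hm & Hmax); [easy|].
    destruct (Rle_dec (phi a) (phi m)) as [H|H].
    + exists m. split; [now right|]. intros x [<-|Hx]; auto.
    + exists a. split; [now left|]. intros x [<-|Hx]; [lra|]. specialize (Hmax x Hx). lra.
Qed.

(** Without a maximum, every w has a neighbourhood on which f stays below some value f(w'). Finitely
    many such neighbourhoods cover the square; the largest of the corresponding w' lies in one of
    them, hence is beaten, a contradiction. Semicontinuity is the right generality because the
    functions used below are cut off by a jump. *)
Lemma usc_max (B : R) (f : C -> R) : 0 <= B ->
  (forall w eps, 0 < eps -> exists d, 0 < d /\ forall z, Cmod (z - w)%C < d -> f z < f w + eps) ->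
  exists m, square B m /\ forall z, square B z -> f z <= f m.
Proof.
  intros HB Husc. apply NNPP. intros Hn.
  assert (H0 : square B 0%C).
  { unfold square, Re, Im; simpl. rewrite Rabs_R0. lra. }
  assert (H : forall w, exists p : C * R, square B (fst p) /\ 0 < snd p /\
             (square B w -> forall z, Cmod (z - w)%C < snd p -> f z < f (fst p))).
  { intros w. destruct (classic (square B w)) as [Hw|Hw].
    - destruct (classic (exists w', square B w' /\ f w < f w')) as [(w' & H1 & H2)|Hno].
      + destruct (Husc w (f w' - f w)) as (d & Hd & Hz); [lra|].
        exists (w', d). simpl. repeat split; try apply H1; auto. intros _ z Hzd.
        specialize (Hz z Hzd). lra.
      + exfalso. apply Hn. exists w. split; auto. intros z Hz. apply Rnot_lt_le. intros Hlt.
        apply Hno. eauto.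
    - exists (RtoC 0, 1). simpl. split; [exact H0|]. split; [lra|]. intros Hw'. easy. }
  set (p := fun w => proj1_sig (constructive_indefinite_description _ (H w))).
  assert (Hp : forall w, square B (fst (p w)) /\ 0 < snd (p w) /\
             (square B w -> forall z, Cmod (z - w)%C < snd (p w) -> f z < f (fst (p w)))).
  { intros w. apply (proj2_sig (constructive_indefinite_description _ (H w))). }
  destruct (square_cover B (fun w => snd (p w))) as (l & Hl); [intros z; apply Hp|].
  destruct (list_argmax (fun w => f (fst (p w))) l) as (m & Hm & Hmax).
  { intros ->. destruct (Hl _ H0) as (w & [] & _). }
  destruct (Hl (fst (p m))) as (t & Ht & Hsq & Hlt); [apply Hp|].
  destruct (Hp t) as (_ & _ & Ht'). specialize (Ht' Hsq _ Hlt). specialize (Hmax t Ht). lra.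
Qed.

(** Only second derivatives along the two coordinate lines through the point are recorded: this is
    all the argument at a maximum uses, and it is stable under linear combinations. *)
Definition has_lap (u : C -> R) (x y l : R) : Prop :=
  exists (ux uy : R -> R) (a b : R),
    locally x (fun t => is_derive (fun s => u (s, y)) t (ux t)) /\ is_derive ux x a /\
    locally y (fun t => is_derive (fun s => u (x, s)) t (uy t)) /\ is_derive uy y b /\
    l = a + b.

Lemma is_derive_comb (f g : R -> R) (x l m c : R) :
  is_derive f x l -> is_derive g x m -> is_derive (fun t => f t + c * g t) x (l + c * m).
Proof.
  rewrite !is_derive_Reals. intros Hf Hg.
  apply (derivable_pt_lim_plus f (fun t => c * g t)); auto.
  now apply (derivable_pt_lim_scal g).
Qed.

Lemma has_lap_comb (u v : C -> R) (x y l m c : R) :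
  has_lap u x y l -> has_lap v x y m -> has_lap (fun z => u z + c * v z) x y (l + c * m).
Proof.
  intros (ux & uy & a & b & H1 & H2 & H3 & H4 & ->) (vx & vy & a' & b' & K1 & K2 & K3 & K4 & ->).
  exists (fun t => ux t + c * vx t), (fun t => uy t + c * vy t), (a + c * a'), (b + c * b').
  split; [|split; [|split; [|split]]].
  - generalize (filter_and _ _ H1 K1). apply filter_imp. intros t [L1 L2].
    exact (is_derive_comb _ _ _ _ _ c L1 L2).
  - now apply is_derive_comb.
  - generalize (filter_and _ _ H3 K3). apply filter_imp. intros t [L1 L2].
    exact (is_derive_comb _ _ _ _ _ c L1 L2).
  - now apply is_derive_comb.
  - ring.
Qed.

Lemma has_lap_const (c x y : R) : has_lap (fun _ => c) x y 0.
Proof.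
  exists (fun _ => 0), (fun _ => 0), 0, 0.
  split; [|split; [|split; [|split]]]; try (apply is_derive_Reals, derivable_pt_lim_const).
  - apply filter_forall. intros t. apply (is_derive_const (V := R_NormedModule)).
  - apply filter_forall. intros t. apply (is_derive_const (V := R_NormedModule)).
  - ring.
Qed.

Lemma has_lap_sq (x y : R) : has_lap (fun z => Re z * Re z + Im z * Im z) x y 4.
Proof.
  exists (fun t => 2 * t), (fun t => 2 * t), 2, 2. unfold Re, Im; simpl.
  split; [|split; [|split; [|split]]].
  - apply filter_forall. intros t. auto_derive; auto. ring.
  - auto_derive; auto. ring.
  - apply filter_forall. intros t. auto_derive; auto. ring.
  - auto_derive; auto. ring.
  - ring.
Qed.

(** A negative phi'(x) would give larger values just left of x. With phi'(x) >= 0, a positive second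
    derivative makes phi' positive just right of x, and the mean value theorem gives larger values
    there. *)
Lemma local_max_second_derivative (phi phi' : R -> R) (x a d : R) : 0 < d ->
  (forall t, Rabs (t - x) < d -> phi t <= phi x) ->
  locally x (fun t => is_derive phi t (phi' t)) -> is_derive phi' x a -> a <= 0.
Proof.
  intros Hd Hmax [e He] Ha. apply Rnot_lt_le. intros Hpos.
  assert (He' : forall t, Rabs (t - x) < e -> derivable_pt_lim phi t (phi' t)).
  { intros t Ht. apply is_derive_Reals, He. exact Ht. }
  apply is_derive_Reals in Ha.
  assert (He0 := cond_pos e).
  assert (H0 : 0 <= phi' x).
  { apply Rnot_lt_le. intros Hneg.
    destruct (He' x ltac:(rewrite Rminus_diag, Rabs_R0; lra) (- phi' x)) as (del & Hdel); [lra|].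
    assert (Hdel0 := cond_pos del).
    set (h := - (Rmin del d / 2)).
    assert (Hm : 0 < Rmin del d) by now apply Rmin_pos.
    pose proof (Rmin_l del d). pose proof (Rmin_r del d).
    assert (Hh : Rabs h = Rmin del d / 2) by (unfold h; rewrite Rabs_Ropp, Rabs_pos_eq; lra).
    specialize (Hdel h ltac:(unfold h; lra) ltac:(lra)).
    specialize (Hmax (x + h)). replace (x + h - x) with h in Hmax by ring.
    specialize (Hmax ltac:(lra)).
    apply Rabs_def2 in Hdel. destruct Hdel as [Hdel _].
    assert (E : (phi (x + h) - phi x) / h * h = phi (x + h) - phi x) by (field; unfold h; lra).
    assert (h < 0) by (unfold h; lra). nra. }
  destruct (Ha (a / 2)) as (del & Hdel); [lra|]. assert (Hdel0 := cond_pos del).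
  set (s := Rmin (Rmin del e) d / 2).
  assert (Hm : 0 < Rmin (Rmin del e) d) by (apply Rmin_pos; auto; now apply Rmin_pos).
  pose proof (Rmin_l (Rmin del e) d). pose proof (Rmin_r (Rmin del e) d).
  pose proof (Rmin_l del e). pose proof (Rmin_r del e).
  destruct (MVT_cor2 phi phi' x (x + s)) as (c & Hc & Hcx).
  - unfold s; lra.
  - intros c Hc. apply He'. rewrite Rabs_pos_eq; unfold s in *; lra.
  - assert (Hpc : 0 < phi' c).
    { specialize (Hdel (c - x) ltac:(lra) ltac:(rewrite Rabs_pos_eq; unfold s in *; lra)).
      replace (x + (c - x)) with c in Hdel by ring.
      apply Rabs_def2 in Hdel. destruct Hdel as [_ Hdel].
      assert (E : (phi' c - phi' x) / (c - x) * (c - x) = phi' c - phi' x) by (field; lra).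
      assert (0 < c - x) by lra. nra. }
    specialize (Hmax (x + s)). replace (x + s - x) with s in Hmax by ring.
    specialize (Hmax ltac:(rewrite Rabs_pos_eq; unfold s; lra)).
    replace (x + s - x) with s in Hc by ring. assert (0 < s) by (unfold s; lra). nra.
Qed.

Lemma Cmod_sq z : Cmod z * Cmod z = Re z * Re z + Im z * Im z.
Proof. generalize (Cmod2_alt z). simpl. lra. Qed.

(** A positive maximum of [u] is excluded by adding a small multiple of [|z|^2], whose Laplacian is [4]. *)
Lemma max_principle (U : C -> Prop) (u : C -> R) (B : R) :
  (forall x y, U (x, y) -> has_lap u x y 0) ->
  (forall z, U z -> forall eps, 0 < eps ->
     exists d, 0 < d /\ forall w, Cmod (w - z)%C < d -> U w /\ u w < u z + eps) ->
  (forall w, ~ U w -> forall eps, 0 < eps ->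
     exists d, 0 < d /\ forall z, U z -> Cmod (z - w)%C < d -> u z < eps) ->
  (forall z, U z -> B < Cmod z -> u z <= 0) ->
  forall z, U z -> u z <= 0.
Proof.
  intros Hlap Hin Hout Hinf z0 Hz0. apply Rnot_lt_le. intros Hpos.
  assert (Hz0B : Cmod z0 <= B) by (apply Rnot_lt_le; intros H; specialize (Hinf _ Hz0 H); lra).
  pose proof (Cmod_ge_0 z0) as HB0.
  (* On the square of half-side B + 1 one has |z|^2 <= 2 (B + 1)^2, so k |z|^2 stays below u(z0) and
     the perturbed function has its maximum where v > 0. The extra 1 leaves room for a neighbourhood
     of a maximum in |z| <= B. *)
  set (k := u z0 / (2 * ((B + 1) * (B + 1)) + 1)).
  assert (HD : 0 < 2 * ((B + 1) * (B + 1)) + 1) by nra.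
  assert (Hk : 0 < k) by now apply Rdiv_lt_0_compat.
  assert (Hkm : k * (2 * ((B + 1) * (B + 1)) + 1) = u z0) by (unfold k; field; lra).
  (* Extension of the positive part of u by 0: it is upper semicontinuous on the whole plane because
     u has boundary values at most 0. *)
  set (v := fun z => if excluded_middle_informative (U z) then Rmax 0 (u z) else 0).
  set (s := fun z : C => Re z * Re z + Im z * Im z).
  assert (Hs : forall w eps, 0 < eps -> exists d, 0 < d /\ forall z, Cmod (z - w)%C < d -> s z < s w + eps).
  { intros w eps He. pose proof (Cmod_ge_0 w).
    exists (Rmin 1 (eps / (2 * Cmod w + 2))). split.
    { apply Rmin_pos; [lra|]. apply Rdiv_lt_0_compat; lra. }
    intros z Hz. destruct (Rlt_Rmin _ _ _ Hz) as [L1 L2].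
    unfold s. rewrite <- !Cmod_sq.
    pose proof (Cmod_sub_triangle z w) as T. pose proof (Cmod_ge_0 z).
    set (dd := Cmod (z - w)%C) in *. assert (0 <= dd) by apply Cmod_ge_0.
    assert (E : eps / (2 * Cmod w + 2) * (2 * Cmod w + 2) = eps) by (field; lra).
    assert (dd * (2 * Cmod w + 2) < eps) by (rewrite <- E; apply Rmult_lt_compat_r; lra).
    destruct (Rle_dec (Cmod z) (Cmod w)); nra. }
  assert (Hv : forall w eps, 0 < eps -> exists d, 0 < d /\ forall z, Cmod (z - w)%C < d -> v z < v w + eps).
  { intros w eps He. unfold v. destruct (excluded_middle_informative (U w)) as [Hw|Hw].
    - destruct (Hin w Hw eps He) as (d & Hd & H). exists d. split; auto. intros z Hz.
      destruct (H z Hz) as [HU Hlt]. destruct (excluded_middle_informative (U z)) as [_|]; [|easy].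
      unfold Rmax. destruct (Rle_dec 0 (u z)), (Rle_dec 0 (u w)); lra.
    - destruct (Hout w Hw eps He) as (d & Hd & H). exists d. split; auto. intros z Hz.
      destruct (excluded_middle_informative (U z)) as [HU|]; [|lra].
      specialize (H z HU Hz). unfold Rmax. destruct (Rle_dec 0 (u z)); lra. }
  destruct (usc_max (B + 1) (fun z => v z + k * s z)) as (m & Hm & Hmax); [lra| |].
  { intros w eps He. destruct (Hv w (eps / 2)) as (d1 & Hd1 & H1); [lra|].
    destruct (Hs w (eps / (2 * k))) as (d2 & Hd2 & H2); [apply Rdiv_lt_0_compat; lra|].
    exists (Rmin d1 d2). split; [now apply Rmin_pos|]. intros z Hz.
    specialize (H1 z (Rlt_le_trans _ _ _ Hz (Rmin_l _ _))).
    specialize (H2 z (Rlt_le_trans _ _ _ Hz (Rmin_r _ _))).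
    assert (E : k * (eps / (2 * k)) = eps / 2) by (field; lra). nra. }
  assert (Hsm : 0 <= s m <= 2 * ((B + 1) * (B + 1))).
  { destruct Hm as [Hm1 Hm2]. unfold s.
    assert (F : forall a b, Rabs a <= b -> a * a <= b * b).
    { intros a b Hab. rewrite <- (Rabs_pos_eq (a * a)), Rabs_mult by nra.
      generalize (Rabs_pos a). nra. }
    apply F in Hm1, Hm2. nra. }
  assert (Hz0s : square (B + 1) z0).
  { split; [eapply Rle_trans; [apply re_le_Cmod|]|eapply Rle_trans; [apply Im_le_Cmod|]]; lra. }
  assert (Hvm : 0 < v m).
  { specialize (Hmax z0 Hz0s). simpl in Hmax.
    assert (u z0 <= v z0).
    { unfold v. destruct (excluded_middle_informative (U z0)); [apply Rmax_r|easy]. }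
    assert (0 <= s z0) by (unfold s; nra). nra. }
  assert (HUm : U m /\ 0 < u m /\ v m = u m).
  { unfold v in Hvm |- *. destruct (excluded_middle_informative (U m)) as [HU|]; [|lra].
    unfold Rmax in *. destruct (Rle_dec 0 (u m)); split; auto; lra. }
  destruct HUm as (HU & Hum & Evm).
  assert (HmB : Cmod m <= B) by (apply Rnot_lt_le; intros H; specialize (Hinf _ HU H); lra).
  destruct (Hin m HU 1) as (d & Hd & HUd); [lra|].
  assert (Hloc : forall z, Cmod (z - m)%C < Rmin d 1 -> u z + k * s z <= u m + k * s m).
  { intros z Hz. destruct (Rlt_Rmin _ _ _ Hz) as [L1 L2].
    destruct (HUd z L1) as [HUz _].
    assert (Hzs : square (B + 1) z).
    { pose proof (Cmod_sub_triangle z m).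
      split; [eapply Rle_trans; [apply re_le_Cmod|]|eapply Rle_trans; [apply Im_le_Cmod|]]; lra. }
    specialize (Hmax z Hzs). simpl in Hmax.
    assert (u z <= v z).
    { unfold v. destruct (excluded_middle_informative (U z)); [apply Rmax_r|easy]. }
    lra. }
  destruct m as [x y].
  destruct (has_lap_comb u s x y 0 4 k (Hlap x y HU) (has_lap_sq x y))
    as (ux & uy & a & b & K1 & K2 & K3 & K4 & Eab).
  assert (Ha : a <= 0).
  { apply (local_max_second_derivative (fun t => u (t, y) + k * s (t, y)) ux x a (Rmin d 1)); auto.
    - apply Rmin_pos; lra.
    - intros t Ht. apply Hloc. replace ((t, y) - (x, y))%C with (RtoC (t - x)).
      + now rewrite Cmod_R.
      + unfold RtoC, Cminus, Cplus, Copp; simpl. f_equal; ring. }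
  assert (Hb : b <= 0).
  { apply (local_max_second_derivative (fun t => u (x, t) + k * s (x, t)) uy y b (Rmin d 1)); auto.
    - apply Rmin_pos; lra.
    - intros t Ht. apply Hloc. replace ((x, t) - (x, y))%C with (Ci * RtoC (t - y))%C.
      + now rewrite Cmod_mult, Cmod_Ci, Cmod_R, Rmult_1_l.
      + unfold RtoC, Ci, Cminus, Cplus, Copp, Cmult; simpl. f_equal; ring. }
  lra.
Qed.

(** * Identification of the Green function *)

Lemma horizontal_point (y t : R) : ((0, y) + RtoC t * 1)%C = (t, y).
Proof. unfold RtoC, Cplus, Cmult; simpl. f_equal; ring. Qed.

Lemma vertical_point (x t : R) : ((x, 0) + RtoC t * Ci)%C = (x, t).
Proof. unfold RtoC, Ci, Cplus, Cmult; simpl. f_equal; ring. Qed.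

Lemma Cmod_horizontal (x y t : R) : Cmod ((t, y) - (x, y))%C = Rabs (t - x).
Proof.
  rewrite <- Cmod_R. f_equal. unfold RtoC, Cminus, Cplus, Copp; simpl. f_equal; ring.
Qed.

Lemma Cmod_vertical (x y t : R) : Cmod ((x, t) - (x, y))%C = Rabs (t - y).
Proof.
  rewrite <- Cmod_R, <- (Rmult_1_l (Cmod (RtoC (t - y)))), <- Cmod_Ci, <- Cmod_mult. f_equal.
  unfold RtoC, Ci, Cmult, Cminus, Cplus, Copp; simpl. f_equal; ring.
Qed.

(** The first partial derivatives are the real parts of f'/f and i f'/f; one more differentiation
    brings factors 1 and i^2 = -1, which cancel. *)
Lemma has_lap_ln_Cmod (f df : C -> C) (x y d : R) (l : C) : 0 < d ->
  (forall z, Cmod (z - (x, y))%C < d -> f z <> 0%C /\ Cder f z (df z)) ->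
  Cder df (x, y) l -> has_lap (fun z => ln (Cmod (f z))) x y 0.
Proof.
  intros Hd Hf Hdf.
  destruct (Hf (x, y)) as [H0 H1].
  { replace ((x, y) - (x, y))%C with (RtoC 0) by ring. rewrite Cmod_0. auto. }
  set (rho := fun z => (df z / f z)%C).
  assert (Hr : exists r, Cder rho (x, y) r).
  { eexists. apply Cder_div; eauto. }
  destruct Hr as [r Hr].
  exists (fun t => Re (rho (t, y))), (fun t => Re (rho (x, t) * Ci)%C), (Re r), (Re (r * Ci * Ci)%C).
  split; [|split; [|split; [|split]]].
  - exists (mkposreal d Hd). intros t Ht. change (Rabs (t - x) < d) in Ht.
    destruct (Hf (t, y)) as [K0 K1]; [now rewrite Cmod_horizontal|].
    pose proof (Cder_line_ln_Cmod f (0, y) 1%C (df (t, y)) t) as L.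
    rewrite horizontal_point in L. specialize (L K0 K1).
    rewrite Cmult_1_r in L. eapply is_derive_ext; [|exact L].
    intros s. simpl. now rewrite horizontal_point.
  - pose proof (Cder_line_Re rho (0, y) 1%C r x) as L. rewrite horizontal_point in L.
    specialize (L Hr). rewrite Cmult_1_r in L. eapply is_derive_ext; [|exact L].
    intros s. simpl. now rewrite horizontal_point.
  - exists (mkposreal d Hd). intros t Ht. change (Rabs (t - y) < d) in Ht.
    destruct (Hf (x, t)) as [K0 K1]; [now rewrite Cmod_vertical|].
    pose proof (Cder_line_ln_Cmod f (x, 0) Ci (df (x, t)) t) as L.
    rewrite vertical_point in L. specialize (L K0 K1).
    eapply is_derive_ext; [|exact L].
    intros s. simpl. now rewrite vertical_point.
  - pose proof (Cder_line_Re (fun z => rho z * Ci)%C (x, 0) Ci (r * Ci)%C y) as L.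
    rewrite vertical_point in L. eapply is_derive_ext; [|apply L].
    + intros s. simpl. now rewrite vertical_point.
    + eapply Cder_val; [apply (Cder_mult rho (fun _ => Ci)); [exact Hr|apply Cder_const]|]. ring.
  - unfold Re. simpl. ring.
Qed.

Context (g : C -> R) (Hg : greens_function (Omega lam) g).

Lemma orb_escape_nbhd z (B : R) : Omega lam z ->
  exists (n : nat) (d : R), 0 < d /\
    forall w, Cmod (w - z)%C < d -> forall m, (n <= m)%nat -> B < Cmod (orb m w).
Proof.
  intros Hz. set (B' := Rmax B (xi lam)).
  destruct (Omega_orb z 0 B' Hz) as (n & _ & Hn).
  destruct (Ccont_near _ _ (Cder_cont _ _ _ (Cder_orb n z)) (Cmod (orb n z) - B')) as (d & Hd & H); [lra|].
  exists n, d. split; auto. intros w Hw m Hm.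
  specialize (H w Hw).
  rewrite Cmod_sub_sym in H.
  pose proof (Cmod_sub_triangle (orb n z) (orb n w)).
  assert (Hnw : B' < Cmod (orb n w)) by lra.
  replace m with ((m - n) + n)%nat by lia. rewrite orb_add.
  pose proof (Rmax_l B (xi lam)). pose proof (Rmax_r B (xi lam)). fold B' in H1, H2.
  pose proof (orb_ge (orb n w) (Cmod (orb n w) - xi lam) (m - n)
    ltac:(lra) ltac:(lra)).
  assert (1 <= 4 ^ (m - n)) by (apply pow_R1_Rle; lra). nra.
Qed.

Lemma Omega_open z : Omega lam z ->
  exists d, 0 < d /\ forall w, Cmod (w - z)%C < d -> Omega lam w.
Proof.
  intros Hz. destruct (orb_escape_nbhd z (xi lam) Hz) as (n & d & Hd & H).
  exists d. split; auto. intros w Hw. apply Omega_escapes, (escapes_shift n).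
  apply escapes_of_gt; auto.
Qed.

Lemma green_has_lap (x y : R) : Omega lam (x, y) -> has_lap g x y 0.
Proof.
  destruct Hg as (Hharm & _ & _). intros HO.
  destruct (Omega_open _ HO) as (d & Hd & Hop).
  destruct (Hharm x y HO) as [(_ & _ & _ & (_ & E1 & _ & _ & _) & (_ & _ & E2 & _ & _)) Hl].
  exists (fun t => Derive (fun s => g (s, y)) t), (fun t => Derive (fun s => g (x, s)) t),
    (Derive (fun t => Derive (fun s => g (s, y)) t) x),
    (Derive (fun t => Derive (fun s => g (x, s)) t) y).
  split; [|split; [|split; [|split]]].
  - exists (mkposreal d Hd). intros t Ht. change (Rabs (t - x) < d) in Ht.
    destruct (Hharm t y) as [(_ & E & _) _]; [apply Hop; now rewrite Cmod_horizontal|].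
    apply Derive_correct, E.
  - apply Derive_correct, E1.
  - exists (mkposreal d Hd). intros t Ht. change (Rabs (t - y) < d) in Ht.
    destruct (Hharm x t) as [(_ & _ & E & _) _]; [apply Hop; now rewrite Cmod_vertical|].
    apply Derive_correct, E.
  - apply Derive_correct, E2.
  - symmetry. exact Hl.
Qed.

Lemma green_cont z : Omega lam z -> forall eps, 0 < eps ->
  exists d, 0 < d /\ forall w, Cmod (w - z)%C < d -> Rabs (g w - g z) < eps.
Proof.
  destruct Hg as (Hharm & _ & _). destruct z as [x y]. intros HO eps He.
  destruct (Hharm x y HO) as [(Hc & _) _].
  destruct (Hc (mkposreal eps He)) as [d Hd]. exists d. split; [apply cond_pos|].
  intros [u v] Hw.
  pose proof (re_le_Cmod ((u, v) - (x, y))%C) as H1. pose proof (Im_le_Cmod ((u, v) - (x, y))%C) as H2.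
  unfold Re, Im in H1, H2. simpl in H1, H2.
  apply Hd; unfold Rminus; lra.
Qed.

Lemma green_boundary (w : C) : ~ Omega lam w -> forall eps, 0 < eps ->
  exists d, 0 < d /\ forall z, Omega lam z -> Cmod (z - w)%C < d -> Rabs (g z) < eps.
Proof.
  destruct Hg as (_ & _ & Hb). intros Hw eps He.
  specialize (Hb w Hw).
  assert (Hl : locally 0 (fun t : R => Rabs t < eps)).
  { exists (mkposreal eps He). intros t Ht. change (Rabs (t - 0) < eps) in Ht.
    now rewrite Rminus_0_r in Ht. }
  specialize (Hb _ Hl). destruct Hb as [d Hd]. exists d. split; [apply cond_pos|].
  intros z Hz Hlt. apply Hd; auto. now apply C_NormedModule_mixin_compat1.
Qed.

(** The fixed point [xi] lies in the Julia set, so [z_n - xi] has no zero in [Omega]. *)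
Definition Ln n z : R := ln (Cmod (orb n z - xi lam)%C).

Lemma orb_xi_neq0 n z : Omega lam z -> (orb n z - xi lam <> 0)%C.
Proof.
  intros Hz E. destruct xi_facts as (F1 & F2 & F3).
  assert (Hx : forall m, orb m (xi lam) = xi lam).
  { induction m as [|m IH]; [reflexivity|]. rewrite orb_S, IH. unfold quad.
    rewrite <- RtoC_mult, <- RtoC_minus. f_equal. lra. }
  destruct (Omega_orb z n (xi lam) Hz) as (m & Hm & Hlt).
  replace m with ((m - n) + n)%nat in Hlt by lia. rewrite orb_add in Hlt.
  replace (orb n z) with (RtoC (xi lam)) in Hlt.
  - rewrite Hx, Cmod_R, Rabs_pos_eq in Hlt; lra.
  - replace (orb n z) with (orb n z - xi lam + xi lam)%C by ring. rewrite E. ring.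
Qed.

Lemma Ln_has_lap n (x y : R) : Omega lam (x, y) -> has_lap (Ln n) x y 0.
Proof.
  intros HO. destruct (Omega_open _ HO) as (d & Hd & Hop).
  destruct (Cder_dorb n (x, y)) as [l Hl].
  apply (has_lap_ln_Cmod (fun z => orb n z - xi lam)%C (dorb n) x y d l); auto.
  intros z Hz. split.
  - apply orb_xi_neq0; auto.
  - eapply Cder_val; [apply (Cder_minus (orb n) (fun _ => RtoC (xi lam)));
      [apply Cder_orb|apply Cder_const]|]. ring.
Qed.

Lemma Ln_cont n z : Omega lam z -> forall eps, 0 < eps ->
  exists d, 0 < d /\ forall w, Cmod (w - z)%C < d -> Rabs (Ln n w - Ln n z) < eps.
Proof.
  intros Hz eps He. pose proof (orb_xi_neq0 n z Hz) as H0. apply Cmod_gt_0 in H0.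
  unfold Ln. set (m := Cmod (orb n z - xi lam)%C) in *.
  assert (Hc : continuity_pt ln m) by (apply derivable_continuous_pt; exists (/ m); now apply derivable_pt_lim_ln).
  destruct (Hc eps He) as (a & Ha & Hln).
  destruct (Ccont_near _ _ (Cder_cont _ _ _ (Cder_orb n z)) a Ha) as (d & Hd & H).
  exists d. split; auto. intros w Hw.
  specialize (H w Hw).
  set (m' := Cmod (orb n w - xi lam)%C).
  assert (Hm' : Rabs (m' - m) < a).
  { unfold m, m'. pose proof (Cmod_sub_triangle (orb n w - xi lam)%C (orb n z - xi lam)%C) as T1.
    pose proof (Cmod_sub_triangle (orb n z - xi lam)%C (orb n w - xi lam)%C) as T2.
    replace (orb n w - xi lam - (orb n z - xi lam))%C with (orb n w - orb n z)%C in T1 by ring.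
    replace (orb n z - xi lam - (orb n w - xi lam))%C with (- (orb n w - orb n z))%C in T2 by ring.
    rewrite Cmod_opp in T2. apply Rabs_def1; lra. }
  destruct (Req_dec m m') as [E|E].
  - rewrite <- E, Rminus_diag, Rabs_R0. auto.
  - apply (Hln m'). split; [split; [exact I|exact E]|exact Hm'].
Qed.

(** Adding lam turns the recursion into squaring, because w^2 + 2 lam <= (w + lam)^2.
    [orb_growth_below] subtracts lam for the opposite inequality. *)
Lemma orb_growth n z : Cmod (orb n z) + lam <= (Cmod z + lam) ^ (2 ^ n).
Proof.
  pose proof lam_pos. induction n as [|n IH]; [simpl; change (orb 0 z) with z; lra|].
  replace (2 ^ S n)%nat with (2 ^ n * 2)%nat by (simpl; lia).
  rewrite pow_mult. set (X := (Cmod z + lam) ^ (2 ^ n)) in *.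
  rewrite orb_S. pose proof (Cmod_quad_le (orb n z)) as Hq. rewrite Rabs_lam in Hq by auto.
  pose proof (Cmod_ge_0 (orb n z)). set (w := Cmod (orb n z)) in *.
  assert ((w + lam) * (w + lam) <= X * X) by (apply Rmult_le_compat; lra).
  simpl. nra.
Qed.

Lemma orb_growth_below n z : lam + 1 <= Cmod z ->
  (Cmod z - lam) ^ (2 ^ n) <= Cmod (orb n z) - lam.
Proof.
  pose proof lam_pos. intros Hz. induction n as [|n IH]; [simpl; change (orb 0 z) with z; lra|].
  replace (2 ^ S n)%nat with (2 ^ n * 2)%nat by (simpl; lia).
  rewrite pow_mult. set (X := (Cmod z - lam) ^ (2 ^ n)) in *.
  assert (1 <= X) by (apply pow_R1_Rle; lra).
  rewrite orb_S. pose proof (Cmod_quad_ge (orb n z)) as Hq. rewrite Rabs_lam in Hq by auto.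
  set (w := Cmod (orb n z)) in *.
  assert (X * X <= (w - lam) * (w - lam)) by (apply Rmult_le_compat; lra).
  simpl. nra.
Qed.

Lemma INR_pow2 n : INR (2 ^ n) = 2 ^ n.
Proof. rewrite pow_INR. reflexivity. Qed.

Lemma Ln_upper n z : lam <= Cmod z -> Omega lam z ->
  Ln n z <= 2 ^ n * (ln 2 + ln (Cmod z)).
Proof.
  intros Hz HO. pose proof lam_pos. destruct xi_facts as (F1 & F2 & F3).
  pose proof (orb_xi_neq0 n z HO) as H0. apply Cmod_gt_0 in H0.
  rewrite <- ln_mult by lra. rewrite <- INR_pow2, <- ln_pow by lra.
  apply ln_le; auto.
  eapply Rle_trans; [apply Cmod_minus_le|]. rewrite Cmod_R, Rabs_pos_eq by lra.
  apply Rle_trans with ((Cmod z + lam) ^ (2 ^ n)).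
  - pose proof (orb_growth n z). lra.
  - apply pow_incr. lra.
Qed.

Lemma Ln_lower n z : 2 * lam + 2 <= Cmod z ->
  2 ^ n * (ln (Cmod z) - ln 2) <= Ln n z.
Proof.
  intros Hz. pose proof lam_pos. destruct xi_facts as (F1 & F2 & F3).
  rewrite <- ln_div by lra. rewrite <- INR_pow2, <- ln_pow by lra.
  apply ln_le; [apply pow_lt; lra|].
  eapply Rle_trans; [|apply Cmod_sub_triangle]. rewrite Cmod_R, Rabs_pos_eq by lra.
  apply Rle_trans with ((Cmod z - lam) ^ (2 ^ n)); [apply pow_incr; lra|].
  pose proof (orb_growth_below n z ltac:(lra)). lra.
Qed.

Lemma ln_le_exp (x y : R) : 0 < x -> x <= exp y -> ln x <= y.
Proof. intros H1 H2. rewrite <- (ln_exp y). now apply ln_le. Qed.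

Lemma le_of_eps (a b c : R) : (forall eps, 0 < eps -> a <= b + eps * c) -> a <= b.
Proof.
  intros H. apply Rnot_lt_le. intros Hlt.
  destruct (Rle_dec c 0) as [Hc|Hc].
  - specialize (H 1). lra.
  - specialize (H ((a - b) / (2 * c)) ltac:(apply Rdiv_lt_0_compat; lra)).
    replace ((a - b) / (2 * c) * c) with ((a - b) / 2) in H by (field; lra). lra.
Qed.

(** Comparison on [Omega]: near the Julia set |z_n - xi| is at most about 2 xi while g tends to 0,
    and at infinity both [Ln n] and 2^n g grow like 2^n ln |z|. The factor 1 + eps on g makes the
    difference negative near infinity; eps is removed at the end. *)
Lemma green_lower n z : Omega lam z -> Ln n z <= ln (2 * xi lam) + 2 ^ n * g z.
Proof.
  intros Hz. apply le_of_eps with (2 ^ n * g z). intros eps He.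
  destruct xi_facts as (F1 & F2 & F3). pose proof lam_pos.
  destruct Hg as (_ & (M & r & Hinf) & _).
  pose proof (pow2_pos n) as H2n.
  set (c := - ((1 + eps) * 2 ^ n)).
  (* Once ln |z| >= K, the surplus eps 2^n ln |z| absorbs the error in [Ln_upper], the error M in g
     - ln |z| and the additive constant. *)
  set (K := (2 ^ n * ln 2 + (1 + eps) * 2 ^ n * M - ln (2 * xi lam)) / (eps * 2 ^ n)).
  assert (He2 : 0 < eps * 2 ^ n) by nra.
  assert (HK : K * (eps * 2 ^ n) = 2 ^ n * ln 2 + (1 + eps) * 2 ^ n * M - ln (2 * xi lam))
    by (unfold K; field; lra).
  set (B := Rmax (Rmax r lam) (exp K)).
  enough (E : Ln n z + c * g z + 1 * (- ln (2 * xi lam)) <= 0) by (unfold c in E; lra).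
  apply (max_principle (Omega lam) (fun z => Ln n z + c * g z + 1 * (- ln (2 * xi lam))) B); auto.
  - intros x y HO. replace 0 with ((0 + c * 0) + 1 * 0) by ring.
    apply has_lap_comb; [apply has_lap_comb|apply has_lap_const].
    + now apply Ln_has_lap.
    + now apply green_has_lap.
  - intros w Hw e He'. destruct (Omega_open w Hw) as (d1 & Hd1 & H1).
    destruct (Ln_cont n w Hw (e / 2)) as (d2 & Hd2 & H2); [lra|].
    assert (Hc : c < 0) by (unfold c; nra).
    destruct (green_cont w Hw (e / (2 * - c))) as (d3 & Hd3 & H3); [apply Rdiv_lt_0_compat; lra|].
    exists (Rmin d1 (Rmin d2 d3)). split; [repeat (apply Rmin_pos; auto)|].
    intros v Hv. destruct (Rlt_Rmin _ _ _ Hv) as [L1 L0].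
    destruct (Rlt_Rmin _ _ _ L0) as [L2 L3].
    split; [now apply H1|]. specialize (H2 v L2). specialize (H3 v L3).
    apply Rabs_def2 in H2, H3.
    assert (E : - c * (e / (2 * - c)) = e / 2) by (field; lra). nra.
  - intros w Hw e He'.
    destruct (green_boundary w Hw (e / (2 * - c))) as (d1 & Hd1 & H1).
    { apply Rdiv_lt_0_compat; unfold c; nra. }
    assert (Hc : c < 0) by (unfold c; nra).
    assert (Hxe : 0 < 2 * xi lam * (exp (e / 2) - 1)).
    { assert (1 < exp (e / 2)) by (rewrite <- exp_0; apply exp_increasing; lra). nra. }
    destruct (Ccont_near _ _ (Cder_cont _ _ _ (Cder_orb n w)) _ Hxe) as (d2 & Hd2 & H2).
    exists (Rmin d1 d2). split; [now apply Rmin_pos|].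
    intros v HOv Hv. destruct (Rlt_Rmin _ _ _ Hv) as [L1 L2].
    specialize (H1 v HOv L1). specialize (H2 v L2).
    assert (HL : Ln n v <= ln (2 * xi lam) + e / 2).
    { apply ln_le_exp; [apply Cmod_gt_0; now apply orb_xi_neq0|].
      rewrite exp_plus, exp_ln by lra.
      assert (Hj : julia lam w) by (now apply NNPP).
      pose proof (julia_bounded w n Hj).
      replace (orb n v - xi lam)%C with ((orb n v - orb n w) + (orb n w - xi lam))%C by ring.
      eapply Rle_trans; [apply Cmod_triangle|].
      pose proof (Cmod_minus_le (orb n w) (xi lam)) as T. rewrite Cmod_R, Rabs_pos_eq in T by lra. lra. }
    apply Rabs_def2 in H1.
    assert (E : - c * (e / (2 * - c)) = e / 2) by (field; lra). nra.
  - intros v HOv Hv. unfold B in Hv.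
    pose proof (Rmax_l (Rmax r lam) (exp K)). pose proof (Rmax_r (Rmax r lam) (exp K)).
    pose proof (Rmax_l r lam). pose proof (Rmax_r r lam).
    pose proof (Ln_upper n v ltac:(lra) HOv) as HL.
    specialize (Hinf v ltac:(lra)). apply Rabs_le_between in Hinf.
    assert (HlnK : K <= ln (Cmod v)).
    { rewrite <- (ln_exp K). apply ln_le; [apply exp_pos|lra]. }
    unfold c. set (L := ln (Cmod v)) in *.
    assert (A1 : (1 + eps) * 2 ^ n * (L - M) <= (1 + eps) * 2 ^ n * g v)
      by (apply Rmult_le_compat_l; nra).
    assert (A2 : K * (eps * 2 ^ n) <= L * (eps * 2 ^ n)) by (apply Rmult_le_compat_r; lra).
    lra.
Qed.

(** By compactness: near a point of [Omega] all orbits have escaped after a common time, and near a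
    point of the Julia set g is small. A point that has not escaped by a late time is therefore of
    the second kind. *)
Lemma green_small (eps : R) : 0 < eps -> exists n0 : nat, forall n z, (n0 <= n)%nat ->
  Omega lam z -> Cmod (orb n z) <= xi lam + 1 -> g z <= eps.
Proof.
  intros He. destruct xi_facts as (F1 & F2 & F3). pose proof lam_pos as Hl3.
  assert (H : forall w, exists p : R * nat, 0 < fst p /\ forall z, Cmod (z - w)%C < fst p ->
            forall n, (snd p <= n)%nat -> Omega lam z -> Cmod (orb n z) <= xi lam + 1 -> g z <= eps).
  { intros w. destruct (classic (Omega lam w)) as [Hw|Hw].
    - destruct (orb_escape_nbhd w (xi lam + 1) Hw) as (n & d & Hd & H).
      exists (d, n). split; [exact Hd|]. simpl. intros z Hz m Hm _ Hb. specialize (H z Hz m Hm). lra.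
    - destruct (green_boundary w Hw eps He) as (d & Hd & H).
      exists (d, O). split; [exact Hd|]. simpl. intros z Hz m _ HOz _.
      specialize (H z HOz Hz). apply Rabs_def2 in H. lra. }
  set (p := fun w => proj1_sig (constructive_indefinite_description _ (H w))).
  assert (Hp : forall w, 0 < fst (p w) /\ forall z, Cmod (z - w)%C < fst (p w) ->
            forall n, (snd (p w) <= n)%nat -> Omega lam z -> Cmod (orb n z) <= xi lam + 1 -> g z <= eps).
  { intros w. apply (proj2_sig (constructive_indefinite_description _ (H w))). }
  destruct (square_cover (lam + xi lam + 1) (fun w => fst (p w))) as (l & Hcov); [intros w; apply Hp|].
  exists (fold_right Nat.max O (map (fun w => snd (p w)) l)).
  intros n z Hn HO Hb.
  assert (Hzb : Cmod z <= xi lam + 1).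
  { apply Rnot_lt_le. intros Hlt.
    pose proof (orb_ge z (Cmod z - xi lam) n ltac:(lra) ltac:(lra)).
    assert (1 <= 4 ^ n) by (apply pow_R1_Rle; lra). nra. }
  destruct (Hcov z) as (w & Hw & _ & Hzw).
  { split; [eapply Rle_trans; [apply re_le_Cmod|]|eapply Rle_trans; [apply Im_le_Cmod|]]; lra. }
  destruct (Hp w) as [_ Hpw]. apply (Hpw z Hzw n); auto.
  eapply Nat.le_trans; [|exact Hn]. clear - Hw.
  induction l as [|a l IH]; [easy|]. simpl. destruct Hw as [->|Hw]; [lia|]. specialize (IH Hw). lia.
Qed.

(** Near the Julia set [Ln n] has no lower bound, as z_n may approach xi. The comparison is
    therefore made on |z_n| > xi + 1, where |z_n - xi| >= 1 gives [Ln n] >= 0, and on the boundary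
    [green_small] supplies g <= eps. *)
Lemma green_upper (eps : R) : 0 < eps -> exists n0 : nat, forall n z, (n0 <= n)%nat ->
  xi lam + 1 < Cmod (orb n z) -> 2 ^ n * (g z - eps) <= Ln n z.
Proof.
  intros He. destruct (green_small eps He) as (n0 & Hn0). exists n0. intros n z Hn Hz.
  destruct xi_facts as (F1 & F2 & F3). pose proof lam_pos.
  set (U := fun z => xi lam + 1 < Cmod (orb n z)).
  assert (HU : forall z, U z -> Omega lam z).
  { intros w Hw. apply Omega_escapes, (escapes_shift n), escapes_of_gt; auto. unfold U in Hw. lra. }
  assert (HL0 : forall z, U z -> 0 <= Ln n z).
  { intros w Hw. unfold Ln. rewrite <- ln_1. apply ln_le; [lra|].
    eapply Rle_trans; [|apply Cmod_sub_triangle]. rewrite Cmod_R, Rabs_pos_eq by lra. unfold U in Hw. lra. }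
  apply le_of_eps with (Ln n z). intros e He'.
  destruct Hg as (_ & (M & r & Hinf) & _).
  pose proof (pow2_pos n) as H2n.
  set (c := - ((1 + e) / 2 ^ n)).
  assert (Hc2 : c * 2 ^ n = - (1 + e)) by (unfold c; field; lra).
  assert (Hc : c < 0).
  { unfold c. assert (0 < (1 + e) / 2 ^ n) by (apply Rdiv_lt_0_compat; lra). lra. }
  set (K := (M + (1 + e) * ln 2 - eps) / e).
  assert (HK : K * e = M + (1 + e) * ln 2 - eps) by (unfold K; field; lra).
  set (B := Rmax (Rmax r (2 * lam + 2)) (exp K)).
  enough (E : g z + c * Ln n z + 1 * (- eps) <= 0).
  { assert (2 ^ n * (g z - eps) <= 2 ^ n * (- c * Ln n z)) by (apply Rmult_le_compat_l; lra).
    replace (2 ^ n * (- c * Ln n z)) with (- (c * 2 ^ n) * Ln n z) in H0 by ring.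
    rewrite Hc2 in H0. lra. }
  apply (max_principle U (fun z => g z + c * Ln n z + 1 * (- eps)) B); auto.
  - intros x y HO. replace 0 with ((0 + c * 0) + 1 * 0) by ring.
    apply has_lap_comb; [apply has_lap_comb|apply has_lap_const].
    + now apply green_has_lap, HU.
    + now apply Ln_has_lap, HU.
  - intros w Hw a Ha. pose proof (HU w Hw) as HOw.
    destruct (Ccont_near _ _ (Cder_cont _ _ _ (Cder_orb n w)) (Cmod (orb n w) - (xi lam + 1))) as (d1 & Hd1 & H1).
    { unfold U in Hw. lra. }
    destruct (green_cont w HOw (a / 2)) as (d2 & Hd2 & H2); [lra|].
    destruct (Ln_cont n w HOw (a / (2 * - c))) as (d3 & Hd3 & H3); [apply Rdiv_lt_0_compat; lra|].
    exists (Rmin d1 (Rmin d2 d3)). split; [repeat (apply Rmin_pos; auto)|].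
    intros v Hv. destruct (Rlt_Rmin _ _ _ Hv) as [L1 L0].
    destruct (Rlt_Rmin _ _ _ L0) as [L2 L3].
    split.
    + specialize (H1 v L1).
      rewrite Cmod_sub_sym in H1. pose proof (Cmod_sub_triangle (orb n w) (orb n v)).
      unfold U. lra.
    + specialize (H2 v L2). specialize (H3 v L3). apply Rabs_def2 in H2, H3.
      assert (E : - c * (a / (2 * - c)) = a / 2) by (field; lra). nra.
  - intros w Hw a Ha. unfold U in Hw. apply Rnot_lt_le in Hw.
    destruct (classic (Omega lam w)) as [HOw|HOw].
    + destruct (green_cont w HOw a Ha) as (d & Hd & H1). exists d. split; auto.
      intros v HUv Hv. specialize (H1 v Hv). apply Rabs_def2 in H1.
      specialize (Hn0 n w Hn HOw Hw). specialize (HL0 v HUv). nra.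
    + destruct (green_boundary w HOw a Ha) as (d & Hd & H1). exists d. split; auto.
      intros v HUv Hv. specialize (H1 v (HU v HUv) Hv). apply Rabs_def2 in H1.
      specialize (HL0 v HUv). nra.
  - intros v HUv Hv. unfold B in Hv.
    pose proof (Rmax_l (Rmax r (2 * lam + 2)) (exp K)). pose proof (Rmax_r (Rmax r (2 * lam + 2)) (exp K)).
    pose proof (Rmax_l r (2 * lam + 2)). pose proof (Rmax_r r (2 * lam + 2)).
    pose proof (Ln_lower n v ltac:(lra)) as HL.
    specialize (Hinf v ltac:(lra)). apply Rabs_le_between in Hinf.
    assert (HlnK : K <= ln (Cmod v)).
    { rewrite <- (ln_exp K). apply ln_le; [apply exp_pos|lra]. }
    set (L := ln (Cmod v)) in *.
    assert (A1 : c * Ln n v <= c * (2 ^ n * (L - ln 2))) by (apply Rmult_le_compat_neg_l; lra).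
    replace (c * (2 ^ n * (L - ln 2))) with ((c * 2 ^ n) * (L - ln 2)) in A1 by ring.
    rewrite Hc2 in A1.
    assert (A2 : K * e <= L * e) by (apply Rmult_le_compat_r; lra).
    lra.
Qed.

Lemma green_limit z : Omega lam z -> is_lim_seq (fun n => Ln n z / 2 ^ n) (g z).
Proof.
  intros Hz. apply is_lim_seq_spec. intros [eps He]. simpl.
  destruct (green_upper (eps / 2)) as (n0 & Hn0); [lra|].
  destruct (orb_escape_nbhd z (xi lam + 1) Hz) as (n1 & d & Hd & H1).
  assert (H1z : forall m, (n1 <= m)%nat -> xi lam + 1 < Cmod (orb m z)).
  { apply H1. replace (z - z)%C with (RtoC 0) by ring. now rewrite Cmod_0. }
  set (A := Rabs (ln (2 * xi lam))).
  destruct (Pow_x_infinity 2 ltac:(rewrite Rabs_pos_eq; lra) ((A + 1) / eps)) as (n2 & Hn2).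
  exists (n0 + n1 + n2)%nat. intros n Hn.
  specialize (Hn0 n z ltac:(lia) (H1z n ltac:(lia))). specialize (Hn2 n ltac:(lia)).
  pose proof (green_lower n z Hz) as Hlow.
  pose proof (pow2_pos n) as H2n.
  rewrite Rabs_pos_eq in Hn2 by lra. apply Rge_le in Hn2.
  apply (Rmult_le_compat_r eps) in Hn2; [|lra].
  replace ((A + 1) / eps * eps) with (A + 1) in Hn2 by (field; lra).
  pose proof (Rle_abs (ln (2 * xi lam))). fold A in H.
  assert (E : Ln n z / 2 ^ n * 2 ^ n = Ln n z) by (field; lra).
  set (q := Ln n z / 2 ^ n) in *.
  apply Rabs_def1.
  - apply Rmult_lt_reg_r with (2 ^ n); auto. lra.
  - apply Rmult_lt_reg_r with (2 ^ n); auto. nra.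
Qed.

Lemma green_quad z : Omega lam z -> g (quad lam z) = 2 * g z.
Proof.
  intros Hz.
  assert (Hq : Omega lam (quad lam z)).
  { apply Omega_escapes. apply (escapes_shift 1 z). now apply Omega_escapes. }
  pose proof (green_limit _ Hq) as H1.
  assert (H2 : is_lim_seq (fun n => Ln n (quad lam z) / 2 ^ n) (2 * g z)).
  { apply is_lim_seq_ext with (fun n => 2 * (Ln (S n) z / 2 ^ S n)).
    - intros n. unfold Ln. rewrite orb_S_l. simpl. field. apply pow_nonzero. lra.
    - apply (is_lim_seq_scal_l _ 2 (g z)). apply (is_lim_seq_incr_1 (fun n => Ln n z / 2 ^ n)).
      now apply green_limit. }
  apply is_lim_seq_unique in H1, H2. rewrite H1 in H2. now injection H2.
Qed.

Lemma orb_conj n z : orb n (Cconj z) = Cconj (orb n z).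
Proof.
  induction n as [|n IH]; [reflexivity|]. rewrite !orb_S, IH. unfold quad.
  rewrite Cminus_conj, Cmult_conj. f_equal. unfold Cconj, RtoC; simpl. f_equal. ring.
Qed.

Lemma green_reflect z : Omega lam z -> g (- Cconj z)%C = g z.
Proof.
  intros Hz.
  assert (E : quad lam (- Cconj z)%C = Cconj (quad lam z)).
  { change (quad lam z) with (orb 1 z). rewrite <- orb_conj.
    change (orb 1 (Cconj z)) with (quad lam (Cconj z)). unfold quad. ring. }
  (* From index 1 on: |z_0 - xi| is not symmetric under the reflection, but P(z) is merely
     conjugated and xi is real. *)
  assert (EL : forall n, Ln (S n) (- Cconj z)%C = Ln (S n) z).
  { intros n. unfold Ln. rewrite !orb_S_l, E, orb_conj.
    replace (RtoC (xi lam)) with (Cconj (xi lam)) at 1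
      by (unfold Cconj, RtoC; simpl; f_equal; ring).
    now rewrite <- Cminus_conj, Cmod_conj. }
  assert (Hc : Omega lam (- Cconj z)%C).
  { apply Omega_escapes, (escapes_shift 1). change (orb 1 (- Cconj z)%C) with (quad lam (- Cconj z)%C).
    rewrite E. apply Omega_escapes, (escapes_shift 1) in Hz.
    change (orb 1 z) with (quad lam z) in Hz. revert Hz. unfold escapes.
    apply is_lim_seq_ext. intros n. change (Cmod (orb n (quad lam z)) = Cmod (orb n (Cconj (quad lam z)))).
    now rewrite orb_conj, Cmod_conj. }
  pose proof (green_limit _ Hc) as H1. pose proof (green_limit _ Hz) as H2.
  apply is_lim_seq_incr_1 in H1, H2.
  assert (H3 : is_lim_seq (fun n => Ln (S n) (- Cconj z)%C / 2 ^ S n) (g z)).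
  { eapply is_lim_seq_ext; [|exact H2]. intros n. simpl. now rewrite EL. }
  apply is_lim_seq_unique in H1, H3. rewrite H1 in H3. now injection H3.
Qed.

(** * The functional equation and the derivative of G *)

Lemma Cseq_lim_unique (u : nat -> C) (l m : C) : Cseq_lim u l -> Cseq_lim u m -> l = m.
Proof.
  intros Hl Hm. apply NNPP. intros Hne.
  assert (H0 : (l - m)%C <> 0%C).
  { intros E. apply Hne. replace l with (l - m + m)%C by ring. rewrite E. ring. }
  apply Cmod_gt_0 in H0.
  destruct (Hl (Cmod (l - m)%C / 2)) as (N1 & H1); [lra|].
  destruct (Hm (Cmod (l - m)%C / 2)) as (N2 & H2); [lra|].
  specialize (H1 (N1 + N2)%nat ltac:(lia)). specialize (H2 (N1 + N2)%nat ltac:(lia)).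
  rewrite Cmod_sub_sym in H1.
  pose proof (Cmod_triangle (l - u (N1 + N2)%nat) (u (N1 + N2)%nat - m))%C as T.
  replace (l - u (N1 + N2)%nat + (u (N1 + N2)%nat - m))%C with (l - m)%C in T by ring. lra.
Qed.

Lemma Cseq_lim_val (u : nat -> C) (l m : C) : Cseq_lim u l -> l = m -> Cseq_lim u m.
Proof. now intros H <-. Qed.

Lemma re_scal_l (a : R) z : Re (a * z)%C = a * Re z.
Proof. unfold Re; simpl. ring. Qed.

Lemma Cder_conj (f : C -> C) (z l : C) :
  Cder f (Cconj z) l -> Cder (fun x => Cconj (f (Cconj x))) z (Cconj l).
Proof.
  intros H eps He. destruct (H eps He) as (d & Hd & Hh). exists d. split; auto.
  intros h Hlt. specialize (Hh (Cconj h)). rewrite Cmod_conj in Hh. specialize (Hh Hlt).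
  rewrite Cplus_conj, <- Cmod_conj, !Cminus_conj, !Cconj_conj, Cmult_conj, Cconj_conj. exact Hh.
Qed.

Lemma derive_line_zero (l : C) : (forall u, Re (l * u)%C = 0) -> l = 0%C.
Proof.
  intros H. specialize (H (Cconj l)). apply Cmod_eq_0.
  assert (E : Cmod l * Cmod l = 0).
  { rewrite Cmod_sq, <- H. unfold Re, Im; simpl. ring. }
  apply Rmult_integral in E. tauto.
Qed.

Context (G : C -> C) (HG : greens_coordinate lam g G).

Lemma tOmega_open z : tOmega lam z ->
  exists d, 0 < d /\ forall w, Cmod (w - z)%C < d -> tOmega lam w.
Proof.
  intros Hz. destruct z as [x y]. destruct (Req_dec y 0) as [->|Hy].
  - assert (Hx : xi lam < Rabs x).
    { apply Rnot_le_lt. intros H. apply Hz. simpl. split; auto. now apply Rabs_le_between. }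
    exists (Rabs x - xi lam). split; [lra|]. intros w Hw [H1 H2]. destruct w as [u v].
    simpl in *. subst v. rewrite Cmod_horizontal in Hw.
    apply Rabs_le in H2. pose proof (Rabs_triang_inv x u) as T. rewrite Rabs_minus_sym in Hw. lra.
  - exists (Rabs y). split; [now apply Rabs_pos_lt|]. intros w Hw [H1 _]. destruct w as [u v].
    simpl in *. subst v. pose proof (Im_le_Cmod ((u, 0) - (x, y))%C) as H.
    unfold Im in H. simpl in H. rewrite <- Rabs_Ropp in H.
    replace (- (0 + - y)) with y in H by ring. lra.
Qed.

(** Starlikeness with respect to infinity takes the place of connectedness: every point of the
    domain is joined to infinity by its outward ray. *)
Lemma tOmega_scale z (s : R) : 1 <= s -> tOmega lam z -> tOmega lam (s * z)%C.
Proof.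
  intros Hs Hz [H1 H2]. destruct z as [x y]. apply Hz. simpl in *.
  assert (Hy : s * y = 0) by lra. apply Rmult_integral in Hy. destruct Hy as [|Hy]; [lra|]. subst y.
  destruct xi_facts as (F1 & F2 & F3). split; auto.
  replace (s * x - 0 * 0) with (s * x) in H2 by ring. split; nra.
Qed.

Lemma tOmega_neq0 z : tOmega lam z -> z <> 0%C.
Proof.
  intros Hz ->. apply Hz. simpl. destruct xi_facts as (F1 & F2 & F3). split; auto. lra.
Qed.

(** A holomorphic function of modulus one has zero derivative, hence is constant along every ray to infinity. *)
Lemma unimodular_ray (Q : C -> C) :
  (forall z, tOmega lam z -> exists l, Cder Q z l) ->
  (forall z, tOmega lam z -> Cmod (Q z) = 1) ->
  forall z s, tOmega lam z -> 1 <= s -> Q (s * z)%C = Q z.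
Proof.
  intros HQ H1 z s Hz Hs.
  assert (H0 : forall w, tOmega lam w -> Cder Q w 0%C).
  { intros w Hw. destruct (HQ w Hw) as [l Hl].
    assert (Hn : Q w <> 0%C) by (apply Cmod_gt_0; rewrite H1; auto; lra).
    apply (Cder_val _ _ l); auto.
    assert (E : (l / Q w)%C = 0%C).
    { apply derive_line_zero. intros u.
      pose proof (Cder_line_ln_Cmod Q w u l 0) as L.
      replace (w + RtoC 0 * u)%C with w in L by ring. specialize (L Hn Hl).
      destruct (tOmega_open w Hw) as (d & Hd & Hop).
      rewrite <- (is_derive_unique _ _ _ L).
      apply is_derive_unique. apply (is_derive_ext_loc (fun _ : R => 0)).
      - generalize (line_near w u d Hd). apply filter_imp. intros t Ht.
        rewrite H1; [now rewrite ln_1|]. now apply Hop.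
      - apply (is_derive_const (V := R_NormedModule)). }
    replace l with (l / Q w * Q w)%C by (field; auto). rewrite E. ring. }
  assert (E : Cmod (Q (s * z) - Q z)%C <= 0 * Cmod (s * z - z)%C).
  { assert (Hseg : forall t, 0 <= t <= 1 -> tOmega lam (z + t * (s * z - z))%C).
    { intros t Ht. replace (z + t * (s * z - z))%C with (RtoC (1 + t * (s - 1)) * z)%C
        by (rewrite RtoC_plus, RtoC_mult, RtoC_minus; ring).
      apply tOmega_scale; auto. nra. }
    apply (Cder_lipschitz Q (fun _ => 0%C)).
    - intros t Ht. apply H0, Hseg, Ht.
    - intros t Ht. rewrite Cmod_0. lra. }
  pose proof (Cmod_ge_0 (Q (s * z) - Q z)%C).
  assert (E0 : (Q (s * z) - Q z)%C = 0%C) by (apply Cmod_eq_0; lra).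
  replace (Q (s * z)%C) with (Q (s * z) - Q z + Q z)%C by ring. rewrite E0. ring.
Qed.

Lemma G_hol z : tOmega lam z -> Cder G z (C_derive G z).
Proof.
  intros Hz. destruct HG as (H & _). destruct (H z Hz) as [l Hl].
  apply Cder_is_derive in Hl. rewrite (Cder_unique _ _ _ Hl). exact Hl.
Qed.

Lemma G_mod z : tOmega lam z -> Cmod (G z) = exp (- g z).
Proof. apply HG. Qed.

Lemma G_neq0 z : tOmega lam z -> G z <> 0%C.
Proof. intros Hz. apply Cmod_gt_0. rewrite G_mod; auto. apply exp_pos. Qed.

Lemma ray_infinity z (r : R) : tOmega lam z ->
  exists N, forall n, (N <= n)%nat -> r < Cmod (RtoC (INR n + 1) * z)%C.
Proof.
  intros Hz. pose proof (tOmega_neq0 z Hz) as H0. apply Cmod_gt_0 in H0.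
  destruct (INR_unbounded (Rabs r / Cmod z)) as [N HN]. exists N. intros n Hn.
  apply le_INR in Hn. rewrite Cmod_mult, Cmod_R.
  pose proof (pos_INR n). rewrite Rabs_pos_eq by lra.
  apply (Rmult_lt_compat_r (Cmod z)) in HN; auto.
  replace (Rabs r / Cmod z * Cmod z) with (Rabs r) in HN by (field; lra).
  pose proof (Rle_abs r). nra.
Qed.

(** The second alternative is there for p = [quad lam], which is known to enlarge the modulus only
    beyond lam + 1; the ray eventually stays beyond that radius. *)
Lemma G_ray_lim z (p : C -> C) : tOmega lam z ->
  (forall w, Cmod w <= Cmod (p w) \/ Cmod w <= lam + 1) ->
  Cseq_lim (fun n => p (RtoC (INR n + 1) * z) * G (p (RtoC (INR n + 1) * z)))%C 1%C.
Proof.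
  intros Hz Hp eps He. destruct HG as (_ & _ & H). destruct (H eps He) as [r Hr].
  destruct (ray_infinity z (Rmax r (lam + 1)) Hz) as [N HN]. exists N. intros n Hn.
  specialize (HN n Hn). apply Hr. pose proof (Rmax_l r (lam + 1)). pose proof (Rmax_r r (lam + 1)).
  destruct (Hp (RtoC (INR n + 1) * z)%C); lra.
Qed.

(** The constant value of Q on a ray is found at infinity as the quotient of the limits of N and D.
    In this way an identity between values of g is lifted to one between values of [G]. *)
Lemma unimodular_one (Q N D : C -> C) :
  (forall z, tOmega lam z -> exists l, Cder Q z l) ->
  (forall z, tOmega lam z -> Cmod (Q z) = 1) ->
  (forall z, tOmega lam z -> (Q z * D z = N z)%C) ->
  (forall z, tOmega lam z -> Cseq_lim (fun n => N (RtoC (INR n + 1) * z)%C) 1%C) ->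
  (forall z, tOmega lam z -> Cseq_lim (fun n => D (RtoC (INR n + 1) * z)%C) 1%C) ->
  forall z, tOmega lam z -> Q z = 1%C.
Proof.
  intros HQ H1 HND HN HD z Hz.
  assert (L : Cseq_lim (fun n => N (RtoC (INR n + 1) * z)%C) (Q z * 1)%C).
  { assert (L0 : Cseq_lim (fun n => Q z * D (RtoC (INR n + 1) * z))%C (Q z * 1)%C).
    { apply (Cseq_lim_mult (fun _ => Q z)); auto.
      intros e He. exists 0%nat. intros. replace (Q z - Q z)%C with (RtoC 0) by ring. now rewrite Cmod_0. }
    intros e He. destruct (L0 e He) as [M HM]. exists M. intros n Hn. specialize (HM n Hn).
    assert (Hn1 : 1 <= INR n + 1) by (generalize (pos_INR n); lra).
    rewrite <- HND by now apply tOmega_scale. rewrite (unimodular_ray Q HQ H1 z (INR n + 1)); auto. }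
  pose proof (Cseq_lim_unique _ _ _ L (HN z Hz)) as E. rewrite <- E. ring.
Qed.

Lemma G_quad z : tOmega lam z -> G (quad lam z) = (G z * G z)%C.
Proof.
  intros Hz. pose proof lam_pos as Hl.
  enough (E : (G (quad lam z) / (G z * G z))%C = 1%C).
  { pose proof (G_neq0 z Hz).
    replace (G (quad lam z)) with (G (quad lam z) / (G z * G z) * (G z * G z))%C by (field; auto).
    rewrite E. ring. }
  apply (unimodular_one (fun z => G (quad lam z) / (G z * G z))%C
           (fun z => quad lam z * G (quad lam z))%C
           (fun z => (z * G z) * (z * G z) * (1 - lam / (z * z)))%C); auto; clear z Hz; intros z Hz.
  - eexists. apply Cder_div; [apply Cmult_neq_0; apply G_neq0; auto| |].
    + apply (Cder_comp (quad lam) G); [apply Cder_quad|apply G_hol, tOmega_quad; auto].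
    + apply (Cder_mult G G); apply G_hol; auto.
  - pose proof (G_neq0 z Hz). rewrite Cmod_div by (apply Cmult_neq_0; auto).
    rewrite Cmod_mult, !G_mod by (auto; apply tOmega_quad; auto).
    rewrite (green_quad) by (apply tOmega_Omega; auto).
    rewrite <- exp_plus. replace (- (2 * g z)) with (- g z + - g z) by ring.
    field. apply Rgt_not_eq, exp_pos.
  - pose proof (G_neq0 z Hz). pose proof (tOmega_neq0 z Hz). unfold quad. field. auto.
  - apply (G_ray_lim z (quad lam)); auto. intros w.
    destruct (Rle_dec (Cmod w) (lam + 1)); [auto|left].
    eapply Rle_trans; [|apply Cmod_quad_ge]. rewrite Rabs_lam by auto. nra.
  - apply (Cseq_lim_val _ (1 * 1 * (1 - 0))%C); [|ring].
    pose proof (G_ray_lim z (fun w => w) Hz ltac:(intros; left; lra)) as L.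
    apply (Cseq_lim_mult (fun n => _ * _)%C); [exact (Cseq_lim_mult _ _ _ _ L L)|].
    intros e He. destruct (ray_infinity z (Rmax 1 (lam / e)) Hz) as [N HN].
    exists N. intros n Hn. specialize (HN n Hn). set (w := (RtoC (INR n + 1) * z)%C) in *.
    pose proof (Rmax_l 1 (lam / e)). pose proof (Rmax_r 1 (lam / e)).
    assert (Hw : w <> 0%C) by (apply Cmod_gt_0; lra).
    replace (1 - lam / (w * w) - (1 - 0))%C with (- (lam / (w * w)))%C by (field; auto).
    rewrite Cmod_opp, Cmod_div, Cmod_mult, Cmod_R, Rabs_lam by (auto; apply Cmult_neq_0; auto).
    set (m := Cmod w) in *.
    apply Rmult_lt_reg_r with (m * m); [nra|].
    replace (lam / (m * m) * (m * m)) with lam by (field; lra).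
    assert (E1 : lam / e * e = lam) by (field; lra).
    assert (E2 : lam < m * e) by (rewrite <- E1; apply Rmult_lt_compat_r; lra). nra.
Qed.

Lemma G_reflect z : tOmega lam z -> G (- Cconj z)%C = (- Cconj (G z))%C.
Proof.
  assert (Hr : forall z, tOmega lam z -> tOmega lam (- Cconj z)%C).
  { intros w Hw [H1 H2]. apply Hw. destruct w as [x y]. simpl in *. lra. }
  assert (Hrr : forall w : C, (- Cconj (- Cconj w))%C = w).
  { intros w. rewrite Copp_conj, Cconj_conj. ring. }
  intros Hz.
  enough (E : (- Cconj (G (- Cconj z)) / G z)%C = 1%C).
  { pose proof (G_neq0 z Hz).
    assert (E2 : (- Cconj (G (- Cconj z)))%C = G z).
    { replace (- Cconj (G (- Cconj z)))%C with (- Cconj (G (- Cconj z)) / G z * G z)%C by (field; auto).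
      rewrite E. ring. }
    rewrite <- E2, Copp_conj, Cconj_conj. ring. }
  apply (unimodular_one (fun z => - Cconj (G (- Cconj z)) / G z)%C
           (fun z => z * (- Cconj (G (- Cconj z))))%C (fun z => z * G z)%C); auto;
    clear z Hz; intros z Hz.
  - eexists. apply Cder_div; [apply G_neq0; auto| |apply G_hol; auto].
    apply Cder_opp. apply (Cder_conj (fun x => G (- x)%C)).
    apply (Cder_comp (fun x => - x)%C G); [apply Cder_opp, Cder_id|].
    apply G_hol; auto.
  - pose proof (G_neq0 z Hz). rewrite Cmod_div by auto.
    rewrite Cmod_opp, Cmod_conj, !G_mod by auto.
    rewrite (green_reflect) by (apply tOmega_Omega; auto).
    field. apply Rgt_not_eq, exp_pos.
  - field. apply G_neq0; auto.
  - pose proof (G_ray_lim z (fun w => - Cconj w)%C Hz) as L.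
    specialize (L ltac:(intros w; left; rewrite Cmod_opp, Cmod_conj; lra)).
    intros e He. destruct (L e He) as [N HN]. exists N. intros n Hn. specialize (HN n Hn).
    set (w := (RtoC (INR n + 1) * z)%C) in *. rewrite <- Cmod_conj.
    rewrite Cminus_conj, Cmult_conj, Copp_conj, Cconj_conj.
    replace (Cconj 1) with (RtoC 1) by (unfold Cconj, RtoC; simpl; f_equal; ring).
    replace (Cconj w * - G (- Cconj w) - 1)%C with (- Cconj w * G (- Cconj w) - 1)%C by ring. exact HN.
  - apply (G_ray_lim z (fun w => w) Hz). intros; left; lra.
Qed.

Lemma G_orb n z : tOmega lam z -> G (orb n z) = (G z ^ (2 ^ n))%C.
Proof.
  intros Hz. induction n as [|n IH]; [simpl; change (orb 0 z) with z; ring|].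
  rewrite orb_S, G_quad by (apply tOmega_orb; auto). rewrite IH.
  replace (2 ^ S n)%nat with (2 ^ n * 2)%nat by (simpl; lia). rewrite Cpow_mult_r. simpl. ring.
Qed.

Lemma green_orb n z : Omega lam z -> g (orb n z) = 2 ^ n * g z.
Proof.
  intros Hz. induction n as [|n IH]; [simpl; change (orb 0 z) with z; ring|].
  rewrite orb_S, (green_quad); [rewrite IH; simpl; ring|].
  apply Omega_escapes, (escapes_shift n), Omega_escapes. auto.
Qed.

Lemma far_tOmega z : Rinf <= Cmod z -> tOmega lam z.
Proof.
  intros Hz. apply tOmega_gt. unfold Rinf in Hz. destruct xi_facts as (F1 & F2 & F3). lra.
Qed.

(** Since g(z_n) = 2^n g(z) and g - ln |z| is bounded near infinity, dividing by 2^n gives the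
    limit. Unlike [Ln n], ln |z_n| has a derivative expressed directly by W_n. *)
Lemma green_ln_lim z : Rinf <= Cmod z ->
  is_lim_seq (fun n => ln (Cmod (orb n z)) / 2 ^ n) (g z).
Proof.
  intros Hz. pose proof lam_pos as Hl. pose proof Hz as Hz'. unfold Rinf in Hz'.
  assert (HO : Omega lam z) by (apply tOmega_Omega; auto; now apply far_tOmega).
  destruct Hg as (_ & (M & r & Hinf) & _).
  apply is_lim_seq_spec. intros [eps He]. simpl.
  destruct (Pow_x_infinity 2 ltac:(rewrite Rabs_pos_eq; lra) (Rmax ((Rabs M + 1) / eps) (Rabs r + 1))) as (n0 & H0).
  exists n0. intros n Hn. specialize (H0 n Hn).
  pose proof (pow2_pos n) as H2n.
  rewrite Rabs_pos_eq in H0 by lra. apply Rge_le in H0.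
  pose proof (Rmax_l ((Rabs M + 1) / eps) (Rabs r + 1)). pose proof (Rmax_r ((Rabs M + 1) / eps) (Rabs r + 1)).
  pose proof (Rle_abs r). pose proof (Rle_abs M).
  pose proof (orb_inf z n Hz).
  assert (H28 : 2 ^ n <= 8 ^ n) by (apply pow_incr; lra).
  specialize (Hinf (orb n z) ltac:(nra)). rewrite green_orb in Hinf by auto.
  assert (HM : Rabs M + 1 <= 2 ^ n * eps).
  { apply Rle_trans with ((Rabs M + 1) / eps * eps); [right; field; lra|]. apply Rmult_le_compat_r; lra. }
  assert (E : ln (Cmod (orb n z)) / 2 ^ n * 2 ^ n = ln (Cmod (orb n z))) by (field; lra).
  set (q := ln (Cmod (orb n z)) / 2 ^ n) in *. rewrite <- E in Hinf.
  apply Rabs_le_between in Hinf.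
  apply Rabs_def1; apply Rmult_lt_reg_r with (2 ^ n); auto; nra.
Qed.

(** In direction u the function 2^-n ln |z_n| has derivative Re (u / W_n), because z_n'/z_n = 2^n /
    W_n, and 1/W_n has Lipschitz constant 1 for every n. The quadratic error thus passes to the
    limit. *)
Lemma green_taylor (z u : C) : Rinf + 1 <= Cmod z -> Cmod u < 1 ->
  Rabs (g (z + u)%C - g z - Re (u / Winf z)%C) <= Cmod u * Cmod u.
Proof.
  intros Hz Hu.
  assert (Hzz : Cmod (z - z)%C < 1) by (replace (z - z)%C with (RtoC 0) by ring; rewrite Cmod_0; lra).
  assert (Hin : forall t, 0 <= t <= 1 -> Cmod (z + t * u - z)%C < 1).
  { intros t Ht. replace (z + t * u - z)%C with (t * u)%C by ring.
    rewrite Cmod_mult, Cmod_R, Rabs_pos_eq by lra. generalize (Cmod_ge_0 u). nra. }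
  assert (Hfar : forall t, 0 <= t <= 1 -> Rinf <= Cmod (z + t * u)%C).
  { intros t Ht. apply (ball_inf z); auto. }
  assert (Hzf : Rinf <= Cmod z) by lra.
  assert (Hzu : Rinf <= Cmod (z + u)%C).
  { replace (z + u)%C with (z + RtoC 1 * u)%C by ring. apply Hfar. lra. }
  assert (Hn : forall n, Rabs (ln (Cmod (orb n (z + u)%C)) / 2 ^ n - ln (Cmod (orb n z)) / 2 ^ n
                 - Re (u / Wn n z)%C) <= Cmod u * Cmod u).
  { intros n. pose proof (pow2_pos n) as H2n.
    assert (Hder : forall t, 0 <= t <= 1 ->
       is_derive (fun s : R => ln (Cmod (orb n (z + s * u)%C)) / 2 ^ n) t (Re (u / Wn n (z + t * u))%C)).
    { intros t Ht. pose proof (Hfar t Ht) as Hf. set (w := (z + t * u)%C) in *.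
      pose proof (orb_inf_neq0 w n Hf) as H0. pose proof (Wn_neq0 w n Hf) as HW.
      pose proof (Wn_porb w n (fun k _ => orb_inf_neq0 w k Hf)) as Hp.
      pose proof (Cder_line_ln_Cmod (orb n) z u (dorb n w) t H0 (Cder_orb n w)) as L.
      apply (is_derive_scal _ _ (/ 2 ^ n)) in L.
      replace (Re (u / Wn n w)%C) with (/ 2 ^ n * Re (dorb n w / orb n w * u)%C).
      - eapply is_derive_ext; [|exact L]. intros s. unfold Rdiv. apply Rmult_comm.
      - rewrite dorb_porb. fold w.
        replace (porb n w) with (orb n w / Wn n w)%C by (rewrite <- Hp; field; auto).
        replace (RtoC (2 ^ n) * (orb n w / Wn n w) / orb n w * u)%C
          with (RtoC (2 ^ n) * (u / Wn n w))%C by (field; auto).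
        rewrite re_scal_l. field. lra. }
    destruct (mvt_unit _ _ Hder) as (c & Hc & Heq).
    replace (z + RtoC 1 * u)%C with (z + u)%C in Heq by ring.
    replace (z + RtoC 0 * u)%C with z in Heq by ring.
    rewrite Heq.
    replace (Re (u / Wn n (z + c * u))%C - Re (u / Wn n z)%C)
      with (Re (u * (/ Wn n (z + c * u) - / Wn n z))%C) by (unfold Re, Cdiv; simpl; ring).
    eapply Rle_trans; [apply re_le_Cmod|]. rewrite Cmod_mult.
    apply Rmult_le_compat_l; [apply Cmod_ge_0|].
    eapply Rle_trans; [apply (Wn_inv_lipschitz n z); auto|].
    replace (z + c * u - z)%C with (c * u)%C by ring.
    rewrite Cmod_mult, Cmod_R, Rabs_pos_eq by lra. generalize (Cmod_ge_0 u). nra. }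
  pose proof (Winf_neq0 z Hzf) as HWi.
  assert (Lim : is_lim_seq (fun n => Re (u / Wn n z)%C) (Re (u / Winf z)%C)).
  { apply is_lim_seq_spec. intros [eps He].
    assert (Hc : Ccont (fun x => u * / x)%C (Winf z)).
    { apply (Ccont_mult (fun _ => u)); [apply Ccont_const|].
      apply (Ccont_inv (fun x => x)); auto. eapply Cder_cont, Cder_id. }
    destruct (Ccont_near _ _ Hc eps He) as (d & Hd & H).
    destruct (Wn_lim z Hzf d Hd) as (N & HN). exists N. intros n Hle.
    eapply Rle_lt_trans; [|exact (H _ (HN n Hle))].
    eapply Rle_trans; [|apply re_le_Cmod]. right. f_equal. }
  pose proof (is_lim_seq_minus' _ _ _ _
    (is_lim_seq_minus' _ _ _ _ (green_ln_lim _ Hzu) (green_ln_lim _ Hzf)) Lim) as L.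
  apply is_lim_seq_abs in L.
  exact (is_lim_seq_le _ _ _ _ Hn L (is_lim_seq_const (Cmod u * Cmod u))).
Qed.

(** The relation ln |G| = -g determines Re ((G'/G) u) in every direction u, hence G'/G itself, by
    comparison with [green_taylor]. *)
Lemma G_derive_far z : Rinf + 1 <= Cmod z -> Cder G z (- (G z / Winf z))%C.
Proof.
  intros Hz. assert (Hzf : Rinf <= Cmod z) by lra. pose proof (far_tOmega z Hzf) as Ht.
  pose proof (Winf_neq0 z Hzf) as HWi.
  pose proof (G_neq0 z Ht) as H0. pose proof (G_hol z Ht) as Hl. set (l := C_derive G z) in *.
  apply (Cder_val _ _ l); auto.
  assert (E : (l / G z + / Winf z)%C = 0%C).
  { apply derive_line_zero. intros u.
    pose proof (Cder_line_ln_Cmod G z u l 0) as L.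
    replace (z + RtoC 0 * u)%C with z in L by ring. specialize (L H0 Hl).
    assert (L2 : is_derive (fun t : R => ln (Cmod (G (z + t * u)%C))) 0 (- Re (u / Winf z)%C)).
    { apply (is_derive_ext_loc (fun t : R => - g (z + t * u)%C)).
      - destruct (tOmega_open z Ht) as (d & Hd & Hop).
        generalize (line_near z u d Hd). apply filter_imp. intros t Htt.
        rewrite G_mod; [now rewrite ln_exp|]. now apply Hop.
      - apply is_derive_Reals. intros eps He. pose proof (Cmod_ge_0 u).
        set (K := Cmod u * Cmod u + Cmod u + 1). assert (HK : 1 <= K) by (unfold K; nra).
        assert (Hd : 0 < Rmin 1 eps / K) by (apply Rdiv_lt_0_compat; [apply Rmin_pos|]; lra).
        exists (mkposreal _ Hd). intros h Hh0 Hh. simpl in Hh.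
        pose proof (Rmin_l 1 eps). pose proof (Rmin_r 1 eps).
        assert (HhK : Rabs h * K < Rmin 1 eps).
        { apply (Rmult_lt_compat_r K) in Hh; [|lra].
          now replace (Rmin 1 eps / K * K) with (Rmin 1 eps) in Hh by (field; lra). }
        pose proof (Rabs_pos_lt h Hh0) as Hhp.
        assert (Hhu : Cmod (h * u)%C = Rabs h * Cmod u) by (now rewrite Cmod_mult, Cmod_R).
        assert (Hhu1 : Cmod (h * u)%C < 1).
        { rewrite Hhu. assert (Rabs h * Cmod u <= Rabs h * K) by (apply Rmult_le_compat_l; [lra|unfold K; nra]). lra. }
        pose proof (green_taylor z (h * u)%C Hz Hhu1) as T.
        replace (z + RtoC (0 + h) * u)%C with (z + h * u)%C by (now rewrite Rplus_0_l).
        replace (z + RtoC 0 * u)%C with z by ring.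
        replace (Re (h * u / Winf z)%C) with (h * Re (u / Winf z)%C) in T
          by (unfold Re, Cdiv; simpl; ring).
        replace ((- g (z + h * u)%C - - g z) / h - - Re (u / Winf z)%C)
          with (- ((g (z + h * u)%C - g z - h * Re (u / Winf z)%C) / h)) by (field; auto).
        rewrite Rabs_Ropp. unfold Rdiv. rewrite Rabs_mult, Rabs_inv.
        rewrite Hhu in T.
        apply Rle_lt_trans with (Rabs h * Cmod u * (Rabs h * Cmod u) * / Rabs h).
        + apply Rmult_le_compat_r; [left; now apply Rinv_0_lt_compat|exact T].
        + replace (Rabs h * Cmod u * (Rabs h * Cmod u) * / Rabs h) with (Rabs h * (Cmod u * Cmod u)) by (field; lra).
          apply Rle_lt_trans with (Rabs h * K); [|lra]. apply Rmult_le_compat_l; [lra|unfold K; lra]. }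
    apply is_derive_unique in L, L2. rewrite L in L2.
    replace (Re ((l / G z + / Winf z) * u)%C) with (Re (l / G z * u)%C + Re (u / Winf z)%C)
      by (unfold Re, Cdiv; simpl; ring). lra. }
  replace l with ((l / G z + / Winf z) * G z - G z / Winf z)%C by (field; auto).
  rewrite E. ring.
Qed.

Lemma porb_neq0 n z : tOmega lam z -> porb n z <> 0%C.
Proof.
  intros Hz. induction n as [|n IH]; [apply C1_nz|]. simpl. apply Cmult_neq_0; auto.
  apply tOmega_neq0, tOmega_orb; auto.
Qed.

(** Differentiate G(z_n) = G(z)^(2^n): the factor 2^n arises on both sides, from z_n' and from the
    power, and cancels. *)
Lemma G_derive n z : tOmega lam z -> Rinf + 1 <= Cmod (orb n z) ->
  Cder G z (- (G z * porb n z / Winf (orb n z)))%C.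
Proof.
  intros Hz Hn. pose proof (G_neq0 z Hz) as H0. pose proof (G_hol z Hz) as Hl.
  set (l := C_derive G z) in *. apply (Cder_val _ _ l); auto.
  pose proof (Winf_neq0 (orb n z) ltac:(lra)) as HW.
  set (w := orb n z) in *.
  assert (D1 : Cder (fun x => G (orb n x)) z (- (G w / Winf w) * dorb n z)%C)
    by (apply (Cder_comp (orb n) G); [apply Cder_orb|now apply G_derive_far]).
  destruct (tOmega_open z Hz) as (d & Hd & Hop).
  assert (D2 : Cder (fun x => G (orb n x)) z (RtoC (INR (2 ^ n)) * G z ^ pred (2 ^ n) * l)%C).
  { apply (Cder_ext_loc (fun x => G x ^ (2 ^ n))%C _ z _ d); auto.
    - intros h Hh. symmetry. apply G_orb, Hop. now replace (z + h - z)%C with h by ring.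
    - now apply Cder_pow. }
  pose proof (Cder_eq _ _ _ _ D1 D2) as E. unfold w in E at 1. rewrite G_orb, dorb_porb, INR_pow2 in E by auto.
  assert (E2 : (G z ^ (2 ^ n) = G z * G z ^ pred (2 ^ n))%C).
  { destruct (2 ^ n)%nat as [|k] eqn:Ek; [|reflexivity].
    exfalso. apply (Nat.pow_nonzero 2 n); auto. }
  rewrite E2 in E.
  assert (H2n : RtoC (2 ^ n) <> 0%C).
  { intros X. injection X. apply pow_nonzero. lra. }
  assert (Hp : (G z ^ pred (2 ^ n))%C <> 0%C) by (now apply Cpow_nz).
  set (X := (G z ^ pred (2 ^ n))%C) in *.
  replace l with (RtoC (2 ^ n) * X * l / (RtoC (2 ^ n) * X))%C by (field; auto).
  rewrite <- E. field. auto.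
Qed.

(** The extension of [Winf] to the whole domain; [Wt_eq] is the iterated functional equation W(P(z))
    = z W(z). *)
Definition Wt z : C := (- (G z / C_derive G z))%C.

Lemma Wt_eq n z : tOmega lam z -> Rinf + 1 <= Cmod (orb n z) ->
  Wt z = (Winf (orb n z) / porb n z)%C.
Proof.
  intros Hz Hn. unfold Wt. rewrite (Cder_unique _ _ _ (G_derive n z Hz Hn)).
  pose proof (G_neq0 z Hz). pose proof (porb_neq0 n z Hz).
  pose proof (Winf_neq0 (orb n z) ltac:(lra)). field. auto.
Qed.

Lemma far_iterate z (B : R) : tOmega lam z -> exists n, B < Cmod (orb n z).
Proof.
  intros Hz. destruct (Omega_orb z 0 B (tOmega_Omega z Hz)) as (n & _ & Hn). eauto.
Qed.

Lemma Wt_neq0 z : tOmega lam z -> Wt z <> 0%C.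
Proof.
  intros Hz. destruct (far_iterate z (Rinf + 1) Hz) as (n & Hn).
  rewrite (Wt_eq n z Hz ltac:(lra)). pose proof (porb_neq0 n z Hz).
  pose proof (Winf_neq0 (orb n z) ltac:(lra)) as HW. intros E. apply HW.
  replace (Winf (orb n z)) with (Winf (orb n z) / porb n z * porb n z)%C by (field; auto).
  rewrite E. ring.
Qed.

Lemma G_derive_Wt z : tOmega lam z -> Cder G z (- (G z / Wt z))%C.
Proof.
  intros Hz. destruct (far_iterate z (Rinf + 1) Hz) as (n & Hn).
  eapply Cder_val; [apply (G_derive n z Hz); lra|].
  rewrite (Wt_eq n z Hz ltac:(lra)). pose proof (porb_neq0 n z Hz).
  pose proof (Winf_neq0 (orb n z) ltac:(lra)). field. auto.
Qed.

Fixpoint Lp (n : nat) (z : C) : C :=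
  match n with O => 0 | S k => Lp k z + dorb k z / orb k z end%C.

Lemma Cder_porb n z : tOmega lam z -> Cder (porb n) z (porb n z * Lp n z)%C.
Proof.
  intros Hz. induction n as [|n IH].
  - eapply Cder_val; [exact (Cder_const 1 z)|]. simpl. ring.
  - eapply Cder_val; [apply (Cder_mult (orb n) (porb n)); [apply Cder_orb|exact IH]|].
    simpl. pose proof (tOmega_neq0 _ (tOmega_orb z n Hz)). field. auto.
Qed.

Lemma far_nbhd n z (B : R) : tOmega lam z -> B < Cmod (orb n z) ->
  exists d, 0 < d /\ forall h, Cmod h < d -> tOmega lam (z + h)%C /\ B < Cmod (orb n (z + h)%C).
Proof.
  intros Hz Hn. destruct (tOmega_open z Hz) as (d1 & Hd1 & H1).
  destruct (Cder_cont _ _ _ (Cder_orb n z) (Cmod (orb n z) - B)) as (d2 & Hd2 & H2); [lra|].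
  exists (Rmin d1 d2). split; [now apply Rmin_pos|]. intros h Hh.
  specialize (H2 h (Rlt_le_trans _ _ _ Hh (Rmin_r _ _))). split.
  - apply H1. replace (z + h - z)%C with h by ring. apply (Rlt_le_trans _ _ _ Hh (Rmin_l _ _)).
  - rewrite Cmod_sub_sym in H2. generalize (Cmod_sub_triangle (orb n z) (orb n (z + h)%C)). lra.
Qed.

Definition dWt z : C := C_derive Wt z.

Lemma Cder_Wt_aux n z : tOmega lam z -> Rinf + 1 < Cmod (orb n z) ->
  Cder Wt z (RtoC (2 ^ n) * (Winf (orb n z) * Sinf (orb n z)) - Wt z * Lp n z)%C.
Proof.
  intros Hz Hn. destruct (far_nbhd n z _ Hz Hn) as (d & Hd & H).
  pose proof (porb_neq0 n z Hz) as Hp.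
  apply (Cder_ext_loc (fun z => Winf (orb n z) / porb n z)%C _ z _ d); auto.
  - intros h Hh. destruct (H h Hh). symmetry. apply Wt_eq; auto. lra.
  - rewrite (Wt_eq n z Hz ltac:(lra)). eapply Cder_val.
    + apply (Cder_div (fun z => Winf (orb n z)) (porb n)); [auto| |now apply Cder_porb].
      apply (Cder_comp (orb n) (Winf)); [apply Cder_orb|apply Cder_Winf; auto; lra].
    + rewrite dorb_porb. field. auto.
Qed.

Lemma dWt_eq n z : tOmega lam z -> Rinf + 1 < Cmod (orb n z) ->
  dWt z = (RtoC (2 ^ n) * (Winf (orb n z) * Sinf (orb n z)) - Wt z * Lp n z)%C.
Proof. intros Hz Hn. apply Cder_unique. now apply Cder_Wt_aux. Qed.

Lemma Cder_Wt z : tOmega lam z -> Cder Wt z (dWt z).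
Proof.
  intros Hz. destruct (far_iterate z (Rinf + 1) Hz) as (n & Hn).
  rewrite (dWt_eq n z Hz Hn). now apply Cder_Wt_aux.
Qed.

Lemma Ccont_Lp n z : tOmega lam z -> Ccont (Lp n) z.
Proof.
  intros Hz. induction n as [|n IH]; [exact (Ccont_const 0 z)|].
  apply (Ccont_plus (Lp n)); auto. apply (Ccont_mult (dorb n)).
  - destruct (Cder_dorb n z) as [l Hl]. now apply Cder_cont in Hl.
  - apply Ccont_inv; [apply tOmega_neq0, tOmega_orb; auto|]. eapply Cder_cont, Cder_orb.
Qed.

Lemma Ccont_dWt z : tOmega lam z -> Ccont dWt z.
Proof.
  intros Hz. destruct (far_iterate z (Rinf + 1) Hz) as (n & Hn).
  destruct (far_nbhd n z _ Hz Hn) as (d & Hd & H).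
  apply (Ccont_ext_loc (fun z => RtoC (2 ^ n) * (Winf (orb n z) * Sinf (orb n z))
     + (- (1)) * (Wt z * Lp n z))%C _ z d); auto.
  - intros h Hh. destruct (H h Hh). rewrite (dWt_eq n); auto. ring.
  - assert (Co : Ccont (orb n) z) by (eapply Cder_cont, Cder_orb).
    apply Ccont_plus; apply (Ccont_mult (fun _ => _)); try apply Ccont_const.
    + apply Ccont_mult; apply (Ccont_comp (orb n)); auto.
      * eapply Cder_cont, Cder_Winf; auto. lra.
      * apply Sinf_cont; auto. lra.
    + apply Ccont_mult; [|now apply Ccont_Lp]. eapply Cder_cont, Cder_Wt; auto.
Qed.

(** * The inverse mapping *)

Context (T : C -> C) (HT : greens_mapping lam G T).

Lemma G_lt_1 z : tOmega lam z -> Cmod (G z) < 1.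
Proof.
  intros Hz. rewrite (G_mod) by auto. rewrite <- exp_0. apply exp_increasing.
  destruct xi_facts as (F1 & F2 & F3).
  destruct (far_iterate z (3 * xi lam + 1) Hz) as (n & Hn).
  pose proof (green_lower n z (tOmega_Omega z Hz)) as L.
  assert (L2 : ln (2 * xi lam) < Ln n z).
  { apply ln_increasing; [lra|]. eapply Rlt_le_trans; [|apply Cmod_sub_triangle].
    rewrite Cmod_R, Rabs_pos_eq; lra. }
  pose proof (pow2_pos n). nra.
Qed.

Lemma orb_bounded (B : R) n : 0 <= B -> exists K, 0 < K /\
  forall z, Cmod z <= B -> Cmod (orb n z) <= K /\ Cmod (porb n z) <= K.
Proof.
  intros HB. pose proof lam_pos as Hl.
  induction n as [|n (K & HK & IH)].
  - exists (B + 1). split; [lra|]. intros z Hz. simpl. change (orb 0 z) with z. rewrite Cmod_1. lra.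
  - exists (K * K + lam). split; [nra|]. intros z Hz. destruct (IH z Hz) as [H1 H2].
    pose proof (Cmod_ge_0 (orb n z)). pose proof (Cmod_ge_0 (porb n z)). split.
    + rewrite orb_S. eapply Rle_trans; [apply Cmod_quad_le|]. rewrite Rabs_lam by auto. nra.
    + simpl. rewrite Cmod_mult.
      assert (Cmod (orb n z) * Cmod (porb n z) <= K * K) by (apply Rmult_le_compat; auto). lra.
Qed.

Lemma G_near_infinity : exists r0, forall z, r0 < Cmod z ->
  / 2 <= Cmod z * Cmod (G z) <= 2.
Proof.
  pose proof HG as (_ & _ & H). destruct (H (/ 2)) as [r Hr]; [lra|].
  exists r. intros z Hz. specialize (Hr z Hz). rewrite <- Cmod_mult.
  pose proof (Cmod_sub_triangle (z * G z) 1%C) as T1.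
  pose proof (Cmod_sub_triangle 1%C (z * G z)%C) as T2. rewrite (Cmod_sub_sym 1) in T2.
  rewrite Cmod_1 in T1, T2. lra.
Qed.

(** [G] maps the imaginary axis to itself by symmetry, and [G'/G = - 1/Wt] is bounded near the critical point [0]; so [G z] is nearly imaginary for [z] near [0]. *)
Lemma orbit_lower_bound (c : R) : 0 < c -> exists delta, 0 < delta /\ delta <= 1 /\
  forall z, tOmega lam z -> c * Cmod (G z) <= Rabs (Re (G z)) -> delta <= Cmod z.
Proof.
  intros Hc. destruct (gap_radius) as (q & Hq & Hqq).
  destruct G_near_infinity as (r0 & Hr0).
  destruct (gap_escapes q (Rmax (Rinf + 1) r0) ltac:(lra) Hqq) as (M & HM).
  pose proof lam_pos as Hl. destruct xi_facts as (F1 & F2 & F3).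
  destruct (orb_bounded q M ltac:(lra)) as (K & HK & Hb).
  assert (HM' : forall z, Cmod z < q -> Rinf + 1 < Cmod (orb M z) /\ r0 < Cmod (orb M z)).
  { intros z Hz. specialize (HM z Hz M (Nat.le_refl M)).
    pose proof (Rmax_l (Rinf + 1) r0). pose proof (Rmax_r (Rinf + 1) r0). lra. }
  (* In the disc, 1/2 <= |z_M| |G(z)|^(2^M) <= K |G(z)| because |G| < 1. *)
  set (c1 := / (2 * K)). assert (Hc1 : 0 < c1) by (apply Rinv_0_lt_compat; lra).
  assert (HG1 : forall z, tOmega lam z -> Cmod z < q -> c1 <= Cmod (G z)).
  { intros z Hz Hzq. destruct (HM' z Hzq) as [_ H]. specialize (Hr0 _ H).
    rewrite G_orb in Hr0 by auto. rewrite Cmod_pow in Hr0.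
    destruct (Hb z ltac:(lra)) as [Hb1 _]. pose proof (G_lt_1 z Hz) as H1.
    pose proof (Cmod_ge_0 (G z)) as H0. pose proof (Cmod_ge_0 (orb M z)) as H0'.
    assert (Hp : Cmod (G z) ^ (2 ^ M) <= Cmod (G z)).
    { destruct (2 ^ M)%nat as [|k] eqn:E; [exfalso; apply (Nat.pow_nonzero 2 M); auto|].
      simpl. assert (Cmod (G z) ^ k <= 1) by (rewrite <- (pow1 k); apply pow_incr; lra). nra. }
    assert (Hpp : 0 <= Cmod (G z) ^ (2 ^ M)) by (apply pow_le; auto).
    assert (Hf : / 2 <= K * Cmod (G z)) by nra.
    unfold c1. apply Rmult_le_reg_l with (2 * K); [lra|].
    rewrite Rinv_r by lra. lra. }
  assert (HW : forall z, tOmega lam z -> Cmod z < q -> Cmod (G z / Wt z)%C <= K).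
  { intros z Hz Hzq. destruct (HM' z Hzq) as [H _]. destruct (Hb z ltac:(lra)) as [_ Hb2].
    rewrite (Wt_eq M z Hz ltac:(lra)).
    pose proof (Winf_bounds (orb M z) ltac:(lra)) as [HW1 _].
    pose proof (Winf_neq0 (orb M z) ltac:(lra)) as HWn.
    pose proof (porb_neq0 M z Hz) as Hp.
    replace (G z / (Winf (orb M z) / porb M z))%C
      with (G z * porb M z / Winf (orb M z))%C by (field; auto).
    rewrite Cmod_div, Cmod_mult by auto. pose proof (G_lt_1 z Hz).
    pose proof (Cmod_ge_0 (G z)). pose proof (Cmod_ge_0 (porb M z)).
    unfold Rinf in H. set (w := Cmod (Winf (orb M z))) in *.
    apply Rmult_le_reg_r with w; [lra|].
    replace (Cmod (G z) * Cmod (porb M z) / w * w) with (Cmod (G z) * Cmod (porb M z)) by (field; lra).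
    apply Rle_trans with (1 * K); [apply Rmult_le_compat; lra|]. nra. }
  assert (HRe : forall z, tOmega lam z -> Cmod z < q -> Rabs (Re (G z)) <= K * Cmod z).
  { intros [x y] Hz Hzq.
    pose proof (re_le_Cmod (x, y)) as Hx. unfold Re in Hx. simpl in Hx.
    (* A real point of the disc lies on the removed segment, as q < 2 < xi. With y nonzero the
       horizontal segment to the imaginary axis stays in the domain. *)
    assert (Hy : y <> 0).
    { intros ->. apply Hz. simpl. split; auto. apply Rabs_le_between. lra. }
    assert (Hty : forall t, tOmega lam (t, y)) by (intros t [E _]; simpl in E; lra).
    assert (H0 : Re (G (0, y)) = 0).
    { pose proof (G_reflect (0, y) (Hty 0)) as E.
      replace (- Cconj (0, y))%C with (0, y) in E
        by (unfold Cconj, Copp; simpl; f_equal; ring).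
      apply (f_equal Re) in E. unfold Re in *. simpl in E. lra. }
    assert (L : Cmod (G (x, y) - G (0, y))%C <= K * Cmod ((x, y) - (0, y))%C).
    { assert (Hseg : forall t, 0 <= t <= 1 -> ((0, y) + t * ((x, y) - (0, y)))%C = (t * x, y)).
      { intros t Ht. unfold Cplus, Cmult, Cminus, Copp, RtoC; simpl. f_equal; ring. }
      assert (Hin : forall t, 0 <= t <= 1 -> Cmod (t * x, y) < q).
      { intros t Ht. apply Rle_lt_trans with (Cmod (x, y)); auto.
        unfold Cmod. apply sqrt_le_1_alt. simpl.
        assert (0 <= (1 - t * t) * (x * x)) by (apply Rmult_le_pos; nra). nra. }
      apply (Cder_lipschitz G (fun z => - (G z / Wt z))%C).
      - intros t Ht. rewrite Hseg by auto. apply G_derive_Wt. apply Hty.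
      - intros t Ht. rewrite Hseg by auto. rewrite Cmod_opp. apply HW; auto. }
    rewrite Cmod_horizontal, Rminus_0_r in L.
    apply Rle_trans with (Cmod (G (x, y) - G (0, y))%C).
    - eapply Rle_trans; [|apply re_le_Cmod]. right. f_equal. unfold Re in *. simpl. rewrite H0. ring.
    - eapply Rle_trans; [apply L|]. apply Rmult_le_compat_l; lra. }
  (* Inside the disc c c1 <= c |G(z)| <= |Re G(z)| <= K |z|; outside it |z| >= q > 1. *)
  exists (Rmin 1 (c * c1 / K)). split; [|split].
  - apply Rmin_pos; [lra|]. apply Rdiv_lt_0_compat; nra.
  - apply Rmin_l.
  - intros z Hz Hre. destruct (Rlt_le_dec (Cmod z) q) as [Hzq|Hzq].
    + eapply Rle_trans; [apply Rmin_r|].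
      specialize (HRe z Hz Hzq). specialize (HG1 z Hz Hzq).
      apply Rmult_le_reg_r with K; auto.
      replace (c * c1 / K * K) with (c * c1) by (field; lra). nra.
    + eapply Rle_trans; [apply Rmin_l|]. lra.
Qed.

(** * Bounds for W and W' along an orbit *)

(** The product is counted backwards from |z_(n-1)| because the factors that may be small are the
    last ones. *)
Fixpoint tailprod (n i : nat) (z : C) : R :=
  match i with O => 1 | S k => Cmod (orb (n - 1 - k) z) * tailprod n k z end.

Lemma porb_tailprod (n i : nat) z : (i <= n)%nat ->
  Cmod (porb n z) = Cmod (porb (n - i) z) * tailprod n i z.
Proof.
  induction i as [|i IH]; intros Hi; [simpl; rewrite Nat.sub_0_r; ring|].
  rewrite IH by lia. simpl. replace (n - i)%nat with (S (n - S i)) by lia. simpl.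
  rewrite Cmod_mult. replace (n - 1 - i)%nat with (n - S i)%nat by lia. ring.
Qed.

Lemma first_far z (B : R) : tOmega lam z -> exists n, B < Cmod (orb n z) /\
  forall j, (j < n)%nat -> Cmod (orb j z) <= B.
Proof.
  intros Hz. destruct (far_iterate z B Hz) as (n & Hn).
  induction n as [n IH] using lt_wf_ind.
  destruct (classic (exists j, (j < n)%nat /\ B < Cmod (orb j z))) as [(j & Hj & H)|H].
  - now apply (IH j).
  - exists n. split; auto. intros j Hj. apply Rnot_lt_le. intros Hlt. eauto.
Qed.

(** At most [M] of the points [z_j], the last ones, can lie in the disc [|z| < q]. *)
Lemma tailprod_lower (q delta B : R) (M n : nat) z :
  1 < q -> 0 < delta <= 1 ->
  (forall w, Cmod w < q -> forall m, (M <= m)%nat -> B < Cmod (orb m w)) ->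
  (forall j, delta <= Cmod (orb j z)) ->
  (forall j, (j < n)%nat -> Cmod (orb j z) <= B) ->
  forall i, (i <= n)%nat -> (delta / q) ^ M * q ^ i <= tailprod n i z.
Proof.
  intros Hq Hd HM Hdel HB.
  assert (H0 : 0 < delta / q) by (apply Rdiv_lt_0_compat; lra).
  assert (H1 : delta / q <= 1).
  { apply Rmult_le_reg_r with q; [lra|]. replace (delta / q * q) with delta by (field; lra). lra. }
  assert (Hm : forall k l, (k <= l)%nat -> (delta / q) ^ l <= (delta / q) ^ k).
  { intros k l Hkl. replace l with (k + (l - k))%nat by lia. rewrite pow_add.
    assert (0 < (delta / q) ^ k) by (apply pow_lt; lra).
    assert ((delta / q) ^ (l - k) <= 1) by (rewrite <- (pow1 (l - k)); apply pow_incr; lra). nra. }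
  (* Each of the last M factors is at least delta = (delta/q) q and every earlier one at least q,
     hence the exponent min(i, M). *)
  assert (Key : forall i, (i <= n)%nat -> (delta / q) ^ (Nat.min i M) * q ^ i <= tailprod n i z).
  { induction i as [|i IH]; intros Hi; [simpl; lra|]. specialize (IH ltac:(lia)).
    change (tailprod n (S i) z) with (Cmod (orb (n - 1 - i) z) * tailprod n i z).
    assert (P1 : 0 < (delta / q) ^ Nat.min i M * q ^ i).
    { apply Rmult_lt_0_compat; apply pow_lt; lra. }
    destruct (Nat.lt_ge_cases i M) as [Hlt|Hge].
    - rewrite Nat.min_l in * by lia. specialize (Hdel (n - 1 - i)%nat).
      replace ((delta / q) ^ S i * q ^ S i) with (delta * ((delta / q) ^ i * q ^ i)) by (simpl; field; lra).
      apply Rmult_le_compat; lra.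
    - rewrite Nat.min_r in * by lia.
      (* If z_(n-1-i) were in the disc with i >= M, then i steps later z_(n-1) would be beyond B,
         although no iterate before z_n is. *)
      assert (Hqj : q <= Cmod (orb (n - 1 - i) z)).
      { apply Rnot_lt_le. intros Hlt. specialize (HM _ Hlt i Hge). rewrite <- orb_add in HM.
        specialize (HB (i + (n - 1 - i))%nat ltac:(lia)). lra. }
      replace ((delta / q) ^ M * q ^ S i) with (q * ((delta / q) ^ M * q ^ i)) by (simpl; ring).
      apply Rmult_le_compat; lra. }
  intros i Hi. eapply Rle_trans; [|apply Key; auto].
  apply Rmult_le_compat_r; [apply pow_le; lra|]. apply Hm. lia.
Qed.

Lemma Wt_bounds (B B2 q delta c : R) n z : tOmega lam z ->
  Rinf + 1 < Cmod (orb n z) -> Cmod (orb n z) <= B2 -> 1 < q -> 0 < delta -> 0 < c ->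
  (forall j, delta <= Cmod (orb j z)) ->
  (forall i, (i <= n)%nat -> c * q ^ i <= tailprod n i z) ->
  Cmod (Wt z) <= 2 * B2 / c / q ^ n /\
  Cmod (dWt z) <= (2 * B2 + 2 * B2 / (c * delta)) * 2 ^ n.
Proof.
  intros Hz Hn HB2 Hq Hd Hc Hdel Htail.
  pose proof (Winf_bounds (orb n z) ltac:(lra)) as [HW1 HW2].
  pose proof (Sinf_bound (orb n z) ltac:(lra)) as HS.
  pose proof lam_pos as Hl. pose proof Hn as Hn'. unfold Rinf in Hn'.
  pose proof (porb_neq0 n z Hz) as Hp. apply Cmod_gt_0 in Hp as Hp'.
  set (W := Cmod (Winf (orb n z))) in *.
  assert (Hcq : forall i, 0 < c * q ^ i) by (intros i; apply Rmult_lt_0_compat; auto; apply pow_lt; lra).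
  assert (EW : Cmod (Wt z) = W / Cmod (porb n z)).
  { rewrite (Wt_eq n z Hz ltac:(lra)), Cmod_div; auto. }
  split.
  - rewrite EW. pose proof (porb_tailprod n n z (Nat.le_refl n)) as E.
    rewrite Nat.sub_diag in E. simpl in E. rewrite Cmod_1, Rmult_1_l in E. rewrite E.
    specialize (Htail n (Nat.le_refl n)). specialize (Hcq n).
    assert (0 < q ^ n) by (apply pow_lt; lra).
    replace (2 * B2 / c / q ^ n) with (2 * B2 * / (c * q ^ n)) by (field; lra).
    apply Rmult_le_compat; [unfold W; apply Cmod_ge_0|left; apply Rinv_0_lt_compat; lra|lra|].
    apply Rinv_le_contravar; auto.
  - rewrite (dWt_eq n z Hz Hn).
    (* In W z_k'/z_k the product z_0 ... z_(k-1) inside z_k' cancels against the denominator of W.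
       What remains is the tail product from k to n - 1, at least c, so the terms are dominated by a
       geometric sequence of ratio 2. *)
    assert (HLp : forall k, (k <= n)%nat -> Cmod (Wt z * Lp k z)%C <= 2 * B2 / (c * delta) * (2 ^ k - 1)).
    { induction k as [|k IH]; intros Hk.
      - simpl. rewrite Cmult_0_r, Cmod_0. lra.
      - specialize (IH ltac:(lia)). simpl Lp.
        rewrite Cmult_plus_distr_l.
        eapply Rle_trans; [apply Cmod_triangle|].
        assert (Ht : Cmod (Wt z * (dorb k z / orb k z))%C <= 2 * B2 / (c * delta) * 2 ^ k).
        { assert (H0 : orb k z <> 0%C) by (apply (tOmega_neq0), tOmega_orb; auto).
          pose proof (pow2_pos k) as H2.
          rewrite Cmod_mult, Cmod_div, dorb_porb, Cmod_mult, Cmod_R, Rabs_pos_eq, EW by (auto; lra).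
          pose proof (porb_neq0 k z Hz) as Hpk. apply Cmod_gt_0 in Hpk, H0.
          pose proof (porb_tailprod n (n - k) z ltac:(lia)) as E.
          replace (n - (n - k))%nat with k in E by lia. rewrite E.
          specialize (Htail (n - k)%nat ltac:(lia)).
          set (P := tailprod n (n - k) z) in *. set (p := Cmod (porb k z)) in *.
          set (o := Cmod (orb k z)) in *. pose proof (Hdel k) as Hdk. fold o in Hdk.
          assert (Hq1 : 1 <= q ^ (n - k)) by (apply pow_R1_Rle; lra).
          assert (HcP : c <= P) by nra.
          replace (W / (p * P) * (2 ^ k * p / o)) with (W * / (P * o) * 2 ^ k) by (field; lra).
          apply Rmult_le_compat_r; [lra|].
          apply Rmult_le_compat; [unfold W; apply Cmod_ge_0|left; apply Rinv_0_lt_compat; nra|lra|].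
          apply Rinv_le_contravar; [nra|]. apply Rmult_le_compat; lra. }
        simpl. lra. }
    specialize (HLp n (Nat.le_refl n)).
    pose proof (pow2_pos n) as H2.
    eapply Rle_trans; [apply Cmod_minus_le|].
    rewrite !Cmod_mult, Cmod_R, Rabs_pos_eq by lra. rewrite Cmod_mult in HLp. fold W.
    assert (HWS : W * Cmod (Sinf (orb n z)) <= 2 * B2).
    { apply Rle_trans with (2 * B2 * 1); [|lra]. apply Rmult_le_compat; try apply Cmod_ge_0; lra. }
    assert (0 < 2 * B2 / (c * delta)) by (apply Rdiv_lt_0_compat; nra). nra.
Qed.

(** The modulus [|G - zeta|] cannot have a nonzero local minimum since [G' <> 0]. *)
Lemma G_open (z0 : C) (eps : R) : tOmega lam z0 -> 0 < eps ->
  exists rho, 0 < rho /\ forall zeta, Cmod (zeta - G z0)%C < rho ->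
    exists z, tOmega lam z /\ Cmod (z - z0)%C < eps /\ G z = zeta.
Proof.
  intros Hz0 Heps.
  destruct (tOmega_open z0 Hz0) as (d0 & Hd0 & Hop).
  assert (Hl0 : (G z0 / Wt z0)%C <> 0%C).
  { pose proof (Wt_neq0 z0 Hz0). pose proof (G_neq0 z0 Hz0). intros E.
    apply H0. replace (G z0) with (G z0 / Wt z0 * Wt z0)%C by (field; auto). rewrite E. ring. }
  pose proof (G_derive_Wt z0 Hz0) as HD0.
  set (k := Cmod (G z0 / Wt z0)%C / 2).
  apply Cmod_gt_0 in Hl0. assert (Hk : 0 < k) by (unfold k; lra).
  destruct (HD0 k Hk) as (d1 & Hd1 & H1).
  set (s := Rmin (Rmin d0 d1) eps / 2).
  assert (Hmin : 0 < Rmin (Rmin d0 d1) eps) by (apply Rmin_pos; auto; now apply Rmin_pos).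
  pose proof (Rmin_l (Rmin d0 d1) eps). pose proof (Rmin_r (Rmin d0 d1) eps).
  pose proof (Rmin_l d0 d1). pose proof (Rmin_r d0 d1).
  assert (Hs : 0 < s) by (unfold s; lra).
  assert (Hs0 : s < d0 /\ s < d1 /\ s < eps) by (unfold s; lra).
  assert (Hbd : forall h, Cmod h = s -> k * s <= Cmod (G (z0 + h) - G z0)%C).
  { intros h Hh. specialize (H1 h ltac:(lra)). rewrite Hh in H1.
    set (X := (G (z0 + h) - G z0)%C) in *.
    pose proof (Cmod_sub_triangle (- (G z0 / Wt z0) * h)%C X) as Tr.
    rewrite Cmod_mult, Cmod_opp, Hh, Cmod_sub_sym in Tr. unfold k in *. lra. }
  exists (k * s / 2). split; [nra|]. intros zeta Hzeta.
  set (L := 2 + Cmod zeta).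
  set (D := fun z => Cmod (G z - zeta)%C).
  assert (HDL : forall z, tOmega lam z -> D z < L).
  { intros z Hz. unfold D, L. eapply Rle_lt_trans; [apply Cmod_minus_le|].
    pose proof (G_lt_1 z Hz). lra. }
  assert (Hdisc : forall z, Cmod (z - z0)%C <= s -> tOmega lam z) by (intros z Hz; apply Hop; lra).
  (* [usc_max] works on squares. Outside the closed disc the value drops to -L, below all values of
     -D, which keeps upper semicontinuity and puts the maximum in the disc. *)
  set (f := fun z => if Rle_dec (Cmod (z - z0)%C) s then - D z else - L).
  destruct (usc_max (Cmod z0 + s) f) as (m & Hm & Hmax).
  { pose proof (Cmod_ge_0 z0). lra. }
  { intros w e He. unfold f. destruct (Rle_dec (Cmod (w - z0)%C) s) as [Hw|Hw].
    - destruct (Ccont_near _ _ (Cder_cont _ _ _ (G_derive_Wt w (Hdisc w Hw))) e He) as (d & Hd & Hc).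
      exists d. split; auto. intros z Hz. destruct (Rle_dec (Cmod (z - z0)%C) s) as [Hz'|Hz'].
      + specialize (Hc z Hz).
        unfold D. pose proof (Cmod_sub_triangle (G w - zeta)%C (G z - zeta)%C) as Tr.
        replace (G w - zeta - (G z - zeta))%C with (G w - G z)%C in Tr by ring.
        rewrite (Cmod_sub_sym (G w) (G z)) in Tr. lra.
      + specialize (HDL w (Hdisc w Hw)). lra.
    - apply Rnot_le_lt in Hw. exists (Cmod (w - z0)%C - s). split; [lra|].
      intros z Hz. destruct (Rle_dec (Cmod (z - z0)%C) s) as [Hz'|Hz']; [|lra]. exfalso.
      pose proof (Cmod_sub_triangle (w - z0)%C (z - z0)%C) as Tr.
      replace (w - z0 - (z - z0))%C with (w - z)%C in Tr by ring.
      rewrite (Cmod_sub_sym w z) in Tr. lra. }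
  assert (Hin : forall z, Cmod (z - z0)%C <= s -> square (Cmod z0 + s) z).
  { intros z Hz. pose proof (Cmod_sub_triangle z z0).
    split; [eapply Rle_trans; [apply re_le_Cmod|]|eapply Rle_trans; [apply Im_le_Cmod|]]; lra. }
  assert (Hzz : Cmod (z0 - z0)%C <= s).
  { replace (z0 - z0)%C with (RtoC 0) by ring. rewrite Cmod_0. lra. }
  assert (Hm0 : - (k * s / 2) < f m).
  { eapply Rlt_le_trans; [|apply (Hmax z0 (Hin z0 Hzz))]. unfold f.
    destruct (Rle_dec (Cmod (z0 - z0)%C) s); [|easy]. unfold D. rewrite Cmod_sub_sym. lra. }
  assert (HfL : - L < f m).
  { eapply Rlt_le_trans; [|apply (Hmax z0 (Hin z0 Hzz))]. unfold f.
    destruct (Rle_dec (Cmod (z0 - z0)%C) s); [|easy]. specialize (HDL z0 Hz0). lra. }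
  assert (Hms : Cmod (m - z0)%C <= s /\ f m = - D m).
  { unfold f in HfL |- *. destruct (Rle_dec (Cmod (m - z0)%C) s); [auto|lra]. }
  destruct Hms as [Hms Efm]. rewrite Efm in Hm0.
  assert (Hms' : Cmod (m - z0)%C < s).
  { destruct Hms as [|E]; auto. exfalso. specialize (Hbd _ E).
    replace (z0 + (m - z0))%C with m in Hbd by ring.
    pose proof (Cmod_sub_triangle (G m - G z0)%C (zeta - G z0)%C) as Tr.
    replace (G m - G z0 - (zeta - G z0))%C with (G m - zeta)%C in Tr by ring. unfold D in Hm0. lra. }
  exists m. pose proof (Hdisc m Hms) as Htm. split; auto. split; [lra|].
  apply NNPP. intros Hne.
  assert (HDm : 0 < D m).
  { apply Cmod_gt_0. intros E. apply Hne. replace (G m) with (G m - zeta + zeta)%C by ring. rewrite E. ring. }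
  pose proof (G_derive_Wt m Htm) as HDer.
  assert (Hl : (- (G m / Wt m))%C <> 0%C).
  { pose proof (Wt_neq0 m Htm) as HWm. pose proof (G_neq0 m Htm) as HGm. intros E.
    apply HGm. replace (G m) with (- - (G m / Wt m) * Wt m)%C by (field; auto). rewrite E. ring. }
  set (l := (- (G m / Wt m))%C) in *. apply Cmod_gt_0 in Hl as Hl'.
  destruct (HDer (Cmod l / 2)) as (d & Hd & Hder); [lra|].
  set (t := Rmin (1 / 2) (Rmin d (s - Cmod (m - z0)%C) * Cmod l / (2 * D m))).
  assert (Hmm : 0 < Rmin d (s - Cmod (m - z0)%C)) by (apply Rmin_pos; lra).
  assert (Ht : 0 < t).
  { apply Rmin_pos; [lra|]. apply Rdiv_lt_0_compat; [nra|lra]. }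
  (* A damped Newton step towards zeta: the linear part lowers D(m) by t D(m), the remainder costs
     at most t D(m)/2, so m would not be a minimum. *)
  set (h := (- (RtoC t * (G m - zeta) / l))%C).
  assert (Hh : Cmod h = t * D m / Cmod l).
  { unfold h. rewrite Cmod_opp, Cmod_div, Cmod_mult, Cmod_R, Rabs_pos_eq by (auto; lra). reflexivity. }
  assert (Hhm : Cmod h <= Rmin d (s - Cmod (m - z0)%C) / 2).
  { rewrite Hh. apply Rmult_le_reg_r with (Cmod l / D m); [apply Rdiv_lt_0_compat; lra|].
    replace (t * D m / Cmod l * (Cmod l / D m)) with t by (field; lra).
    eapply Rle_trans; [apply Rmin_r|]. right. field. lra. }
  pose proof (Rmin_l d (s - Cmod (m - z0)%C)). pose proof (Rmin_r d (s - Cmod (m - z0)%C)).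
  specialize (Hder h ltac:(lra)).
  assert (Hmh : Cmod (m + h - z0)%C <= s).
  { replace (m + h - z0)%C with ((m - z0) + h)%C by ring.
    eapply Rle_trans; [apply Cmod_triangle|]. lra. }
  specialize (Hmax (m + h)%C (Hin _ Hmh)). rewrite Efm in Hmax.
  unfold f in Hmax. destruct (Rle_dec (Cmod (m + h - z0)%C) s) as [_|]; [|easy].
  assert (HDh : D (m + h)%C <= (1 - t) * D m + Cmod l / 2 * Cmod h).
  { unfold D at 1.
    replace (G (m + h) - zeta)%C with (RtoC (1 - t) * (G m - zeta) + (G (m + h) - G m - l * h))%C.
    - eapply Rle_trans; [apply Cmod_triangle|]. apply Rplus_le_compat; auto.
      rewrite Cmod_mult, Cmod_R, Rabs_pos_eq; [apply Rle_refl|].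
      assert (t <= 1 / 2) by apply Rmin_l. lra.
    - replace (l * h)%C with (- (RtoC t * (G m - zeta)))%C by (unfold h; field; auto).
      rewrite RtoC_minus. ring. }
  rewrite Hh in HDh. replace (Cmod l / 2 * (t * D m / Cmod l)) with (t * D m / 2) in HDh by (field; lra).
  nra.
Qed.

(** * Derivatives of the inverse mapping *)

(** The local form of [G_open] provides a preimage of each nearby point close to z0, and the left
    inverse [T] returns precisely this preimage. *)
Lemma T_cont (z0 : C) : tOmega lam z0 -> Ccont T (G z0).
Proof.
  intros Hz0 eps He. destruct (G_open z0 eps Hz0 He) as (rho & Hrho & H).
  exists rho. split; auto. intros h Hh.
  destruct (H (G z0 + h)%C) as (z & Hz & Hd & E); [now replace (G z0 + h - G z0)%C with h by ring|].
  rewrite <- E, !HT by auto. exact Hd.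
Qed.

Lemma Cder_T (z0 : C) : tOmega lam z0 -> Cder T (G z0) (- (Wt z0 / G z0))%C.
Proof.
  intros Hz0 eps He. pose proof (Wt_neq0 z0 Hz0) as HW. pose proof (G_neq0 z0 Hz0) as HG0.
  pose proof (G_derive_Wt z0 Hz0) as HD.
  assert (Hl : (- (G z0 / Wt z0))%C <> 0%C).
  { intros E. apply HG0. replace (G z0) with (- - (G z0 / Wt z0) * Wt z0)%C by (field; auto). rewrite E. ring. }
  replace (- (Wt z0 / G z0))%C with (/ (- (G z0 / Wt z0)))%C
    by (field; repeat split; auto; intros E; apply HG0; rewrite <- (Copp_involutive (G z0)), E; ring).
  set (l := (- (G z0 / Wt z0))%C) in *. apply Cmod_gt_0 in Hl as Hl'.
  set (m := Cmod l) in *.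
  (* For k = l h + o(h) with m = |l|: precision m/2 gives m |h| <= 2 |k|, and precision eps m^2/2
     then bounds |h - k/l| by eps |k|. *)
  set (e := Rmin (m / 2) (eps * m * m / 2)).
  assert (He' : 0 < e).
  { apply Rmin_pos; [lra|]. apply Rmult_lt_0_compat; [|lra]. repeat apply Rmult_lt_0_compat; auto. }
  destruct (HD e He') as (d & Hd & Hder).
  destruct (G_open z0 d Hz0 Hd) as (rho & Hrho & H).
  exists rho. split; auto. intros k Hk.
  destruct (H (G z0 + k)%C) as (z & Hz & Hzd & E); [now replace (G z0 + k - G z0)%C with k by ring|].
  rewrite <- E, !HT by auto. set (h := (z - z0)%C) in *.
  specialize (Hder h Hzd). replace (z0 + h)%C with z in Hder by (unfold h; ring).
  rewrite E in Hder. replace (G z0 + k - G z0 - l * h)%C with (k - l * h)%C in Hder by ring.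
  replace (h - / l * k)%C with (- (/ l * (k - l * h)))%C by (field; auto).
  rewrite Cmod_opp, Cmod_mult, Cmod_inv by auto. fold m.
  assert (e <= m / 2) by apply Rmin_l. assert (e <= eps * m * m / 2) by apply Rmin_r.
  pose proof (Cmod_ge_0 h). pose proof (Cmod_ge_0 k).
  assert (Hhk : m * Cmod h <= 2 * Cmod k).
  { pose proof (Cmod_sub_triangle (l * h)%C k) as Tr. rewrite Cmod_mult, Cmod_sub_sym in Tr. fold m in Tr. nra. }
  apply Rmult_le_reg_l with m; auto.
  replace (m * (/ m * Cmod (k - l * h)%C)) with (Cmod (k - l * h)%C) by (field; lra).
  apply Rle_trans with (eps * m * m / 2 * Cmod h); [nra|].
  replace (eps * m * m / 2 * Cmod h) with (eps * m / 2 * (m * Cmod h)) by field.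
  replace (m * (eps * Cmod k)) with (eps * m / 2 * (2 * Cmod k)) by field.
  apply Rmult_le_compat_l; [nra|auto].
Qed.

Lemma T_derive_nbhd (z0 : C) : tOmega lam z0 -> exists d, 0 < d /\ forall h, Cmod h < d ->
  exists z, tOmega lam z /\ G z = (G z0 + h)%C.
Proof.
  intros Hz0. destruct (G_open z0 1 Hz0 Rlt_0_1) as (rho & Hrho & H).
  exists rho. split; auto. intros h Hh.
  destruct (H (G z0 + h)%C) as (z & Hz & _ & E); [now replace (G z0 + h - G z0)%C with h by ring|].
  eauto.
Qed.

Lemma T_second_derive (z0 : C) : tOmega lam z0 ->
  C_derive (C_derive T) (G z0) = (Wt z0 * (1 + dWt z0) / (G z0 * G z0))%C.
Proof.
  intros Hz0. pose proof (G_neq0 z0 Hz0) as HG0.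
  destruct (T_derive_nbhd z0 Hz0) as (d & Hd & H).
  apply Cder_unique. apply (Cder_ext_loc (fun zeta => (- Wt (T zeta)) / zeta)%C _ _ _ d); auto.
  - intros h Hh. destruct (H h Hh) as (z & Hz & E). rewrite <- E, HT by auto.
    rewrite (Cder_unique _ _ _ (Cder_T z Hz)). pose proof (G_neq0 z Hz). field. auto.
  - eapply Cder_val.
    + apply (Cder_div (fun zeta => - Wt (T zeta))%C (fun zeta => zeta)); [auto| |apply Cder_id].
      apply Cder_opp. apply (Cder_comp T (Wt)); [now apply Cder_T|].
      rewrite HT by auto. now apply Cder_Wt.
    + cbv beta. rewrite HT by auto. field. auto.
Qed.

(** Continuity makes the integrand integrable on compact parts of the ray. *)
Lemma T_second_cont (z0 : C) : tOmega lam z0 -> Ccont (C_derive (C_derive T)) (G z0).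
Proof.
  intros Hz0. pose proof (G_neq0 z0 Hz0) as HG0.
  destruct (T_derive_nbhd z0 Hz0) as (d & Hd & H).
  apply (Ccont_ext_loc (fun zeta => Wt (T zeta) * (1 + dWt (T zeta)) * / (zeta * zeta))%C _ _ d); auto.
  - intros h Hh. destruct (H h Hh) as (z & Hz & E). rewrite <- E, HT by auto.
    rewrite T_second_derive; auto.
  - pose proof (T_cont z0 Hz0) as HTc. apply Ccont_mult; [apply Ccont_mult|].
    + apply (Ccont_comp T (Wt)); auto. rewrite HT by auto. eapply Cder_cont, Cder_Wt; auto.
    + apply (Ccont_plus (fun _ => 1%C)); [apply Ccont_const|].
      apply (Ccont_comp T (dWt)); auto. rewrite HT by auto.
      apply (Ccont_dWt); auto.
    + apply Ccont_inv; [now apply Cmult_neq_0|].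
      apply (Ccont_mult (fun x => x) (fun x => x)); eapply Cder_cont, Cder_id.
Qed.

Lemma T_second_bound (c r1 : R) : 0 < c -> 0 < r1 -> exists K theta, 0 < K /\ 0 < theta < 1 /\
  forall z, tOmega lam z -> r1 <= Cmod (G z) ->
    (forall j, c * Cmod (G (orb j z)) <= Rabs (Re (G (orb j z)))) ->
    Cmod (C_derive (C_derive T) (G z)) <= K * Rpower (1 - Cmod (G z)) (- theta).
Proof.
  intros Hc Hr1. destruct (orbit_lower_bound c Hc) as (delta & Hd0 & Hd1 & Hdelta).
  destruct (gap_radius) as (q & Hq & Hqq).
  destruct G_near_infinity as (r0 & Hr0).
  pose proof lam_pos as Hl.
  set (B := Rmax (Rinf + 1) r0).
  assert (HB1 : Rinf + 1 <= B) by apply Rmax_l. assert (HB2 : r0 <= B) by apply Rmax_r.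
  assert (HB0 : 20 <= B) by (unfold Rinf in HB1; lra).
  destruct (gap_escapes q B ltac:(lra) Hqq) as (M & HM).
  (* Bounds the first iterate beyond B: by B^2 + lam if its predecessor lies in the disc of radius
     B, and by 2/r1 if z itself is beyond B, since then |z| |G(z)| <= 2. *)
  set (B2 := Rmax (B * B + lam) (2 / r1)).
  assert (HB21 : B * B + lam <= B2) by apply Rmax_l. assert (HB22 : 2 / r1 <= B2) by apply Rmax_r.
  assert (HB20 : 400 <= B2) by nra.
  set (c' := (delta / q) ^ M). assert (Hc' : 0 < c') by (apply pow_lt, Rdiv_lt_0_compat; lra).
  set (A1 := 2 * B2 / c'). assert (HA1 : 0 < A1) by (apply Rdiv_lt_0_compat; lra).
  set (A2 := 2 * B2 + 2 * B2 / (c' * delta)).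
  assert (HA2 : 0 < A2) by (unfold A2; assert (0 < 2 * B2 / (c' * delta)) by (apply Rdiv_lt_0_compat; nra); lra).
  assert (Hln2 : 0 < ln 2) by (rewrite <- ln_1; apply ln_increasing; lra).
  assert (Hb : 0 < ln (2 / q) < ln 2).
  { assert (E : ln (2 / q) = ln 2 - ln q) by (apply ln_div; lra).
    assert (0 < ln q) by (rewrite <- ln_1; apply ln_increasing; lra).
    assert (ln q < ln 2) by (apply ln_increasing; lra). lra. }
  (* Chosen so that (2/q)^n = (2^n)^theta; theta < 1 because q > 1, and theta > 0 because q < 2. *)
  set (theta := ln (2 / q) / ln 2).
  assert (Hth : 0 < theta < 1).
  { split; [apply Rdiv_lt_0_compat; lra|]. apply Rmult_lt_reg_r with (ln 2); auto.
    unfold theta. replace (ln (2 / q) / ln 2 * ln 2) with (ln (2 / q)) by (field; lra). lra. }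
  assert (HlnB : 0 < ln (2 * B2)) by (rewrite <- ln_1; apply ln_increasing; lra).
  set (K := A1 * (1 + A2) / (r1 * r1) * Rpower (ln (2 * B2)) theta).
  exists K, theta. split; [|split; auto].
  { unfold K. apply Rmult_lt_0_compat; [|apply exp_pos]. apply Rdiv_lt_0_compat; nra. }
  intros z Hz Hr Hre.
  assert (Hdel : forall j, delta <= Cmod (orb j z)).
  { intros j. apply Hdelta; auto. now apply tOmega_orb. }
  destruct (first_far z B Hz) as (n & Hn & Hfirst).
  assert (HnB2 : Cmod (orb n z) <= B2).
  { destruct n as [|n].
    - change (orb 0 z) with z in *. specialize (Hr0 z ltac:(lra)).
      apply Rle_trans with (2 / r1); auto. apply Rmult_le_reg_r with r1; auto.
      replace (2 / r1 * r1) with 2 by (field; lra). nra.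
    - specialize (Hfirst n ltac:(lia)). rewrite orb_S.
      eapply Rle_trans; [apply Cmod_quad_le|]. rewrite Rabs_lam by auto.
      pose proof (Cmod_ge_0 (orb n z)) as Ho.
      assert (Cmod (orb n z) * Cmod (orb n z) <= B * B) by (apply Rmult_le_compat; lra). lra. }
  destruct (Wt_bounds B B2 q delta c' n z) as [W1 W2]; auto; try lra.
  { intros i Hi. apply (tailprod_lower q delta B M n z); auto; try lra. }
  fold A1 in W1. fold A2 in W2.
  pose proof (G_lt_1 z Hz) as Hlt1. set (r := Cmod (G z)) in *.
  assert (H2n : 1 <= 2 ^ n) by (apply pow_R1_Rle; lra).
  assert (Hqn : 0 < q ^ n) by (apply pow_lt; lra).
  (* From |G(z_n)| = r^(2^n) >= 1/(2 |z_n|) >= 1/(2 B2), by taking logarithms and using ln r <= r -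
     1. *)
  assert (Hpow : 2 ^ n * (1 - r) <= ln (2 * B2)).
  { specialize (Hr0 (orb n z) ltac:(lra)). rewrite G_orb, Cmod_pow in Hr0 by auto. fold r in Hr0.
    assert (Hrp : 0 < r ^ (2 ^ n)) by (apply pow_lt; lra).
    assert (Hlow : / (2 * B2) <= r ^ (2 ^ n)).
    { apply Rmult_le_reg_l with (2 * B2); [lra|]. rewrite Rinv_r by lra.
      assert (Cmod (orb n z) * r ^ (2 ^ n) <= B2 * r ^ (2 ^ n)) by (apply Rmult_le_compat_r; lra). lra. }
    apply ln_le in Hlow; [|apply Rinv_0_lt_compat; lra].
    rewrite ln_Rinv, ln_pow, INR_pow2 in Hlow by lra.
    pose proof (exp_ineq1_le (ln r)) as He. rewrite exp_ln in He by lra.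
    assert (2 ^ n * ln r <= 2 ^ n * (r - 1)) by (apply Rmult_le_compat_l; lra). lra. }
  assert (Hpow2 : (2 / q) ^ n <= Rpower (ln (2 * B2)) theta * Rpower (1 - r) (- theta)).
  { assert (E : (2 / q) ^ n = Rpower (2 ^ n) theta).
    { unfold Rpower. rewrite ln_pow by lra. unfold theta.
      replace (ln (2 / q) / ln 2 * (INR n * ln 2)) with (INR n * ln (2 / q)) by (field; lra).
      rewrite <- ln_pow by (apply Rdiv_lt_0_compat; lra). rewrite exp_ln; auto.
      apply pow_lt, Rdiv_lt_0_compat; lra. }
    rewrite E.
    replace (Rpower (2 ^ n) theta) with (Rpower (2 ^ n * (1 - r)) theta * Rpower (1 - r) (- theta)).
    - apply Rmult_le_compat_r; [left; apply exp_pos|]. apply Rle_Rpower_l; [lra|].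
      split; auto. apply Rmult_lt_0_compat; lra.
    - rewrite <- Rpower_mult_distr by lra. rewrite Rmult_assoc, <- Rpower_plus.
      rewrite Rplus_opp_r, Rpower_O; lra. }
  rewrite T_second_derive by auto. pose proof (G_neq0 z Hz) as HG0.
  rewrite Cmod_div, !Cmod_mult by (now apply Cmult_neq_0). fold r.
  assert (H1d : Cmod (1 + dWt z)%C <= (1 + A2) * 2 ^ n).
  { eapply Rle_trans; [apply Cmod_triangle|]. rewrite Cmod_1. clear - W2 H2n. lra. }
  assert (Hrr : 0 < r1 * r1) by (apply Rmult_lt_0_compat; lra).
  apply Rle_trans with (A1 / q ^ n * ((1 + A2) * 2 ^ n) / (r1 * r1)).
  - apply Rmult_le_compat.
    + apply Rmult_le_pos; apply Cmod_ge_0.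
    + left. apply Rinv_0_lt_compat. apply Rmult_lt_0_compat; lra.
    + apply Rmult_le_compat; auto using Cmod_ge_0.
    + apply Rinv_le_contravar; [lra|]. apply Rmult_le_compat; lra.
  - replace (A1 / q ^ n * ((1 + A2) * 2 ^ n) / (r1 * r1)) with (A1 * (1 + A2) / (r1 * r1) * (2 / q) ^ n).
    + unfold K. rewrite Rmult_assoc. apply Rmult_le_compat_l; auto.
      left. apply Rdiv_lt_0_compat; [apply Rmult_lt_0_compat|]; lra.
    + unfold Rdiv. rewrite Rpow_mult_distr, pow_inv. field. split; lra.
Qed.

End Julia.

(** * Digits and the radial integral *)

Definition bit (b : bool) : R := if b then 1 else 0.

Definition binary (e : nat -> bool) (x : R) : Prop := is_series (fun k => bit (e k) / 2 ^ S k) x.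

Lemma bit_bounds (b : bool) : 0 <= bit b <= 1.
Proof. destruct b; simpl; lra. Qed.

Lemma binary_shift (e : nat -> bool) (x : R) :
  binary e x -> binary (fun k => e (S k)) (2 * x - bit (e 0%nat)).
Proof.
  intros H. unfold binary in *.
  assert (H1 : is_series (fun k => bit (e (S k)) / 2 ^ S (S k)) (x - bit (e 0%nat) / 2)).
  { apply (is_series_incr_1 (fun k => bit (e k) / 2 ^ S k)).
    match goal with |- is_series _ ?y => replace y with x; [exact H|] end.
    change (x = x - bit (e 0%nat) / 2 + bit (e 0%nat) / 2 ^ 1). simpl. field. }
  apply (is_series_scal 2) in H1.
  replace (2 * x - bit (e 0%nat)) with (scal 2 (x - bit (e 0%nat) / 2)).
  - eapply is_series_ext; [|exact H1]. intros k.
    change (2 * (bit (e (S k)) / 2 ^ S (S k)) = bit (e (S k)) / 2 ^ S k). simpl.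
    field. apply pow_nonzero. lra.
  - change (2 * (x - bit (e 0%nat) / 2) = 2 * x - bit (e 0%nat)). field.
Qed.

Lemma binary_bounds (e : nat -> bool) (x : R) : binary e x -> 0 <= x <= 1.
Proof.
  intros H.
  assert (Hg : is_series (fun k => / 2 ^ S k) 1).
  { assert (G : is_series (fun k => (/ 2) ^ k) (/ (1 - / 2))) by (apply is_series_geom; rewrite Rabs_pos_eq; lra).
    apply (is_series_scal (/ 2)) in G.
    replace 1 with (scal (/ 2) (/ (1 - / 2))) by (change (/ 2 * / (1 - / 2) = 1); field; lra).
    eapply is_series_ext; [|exact G]. intros k.
    change (/ 2 * (/ 2) ^ k = / (2 * 2 ^ k)). now rewrite pow_inv, Rinv_mult. }
  assert (Hk : forall k, 0 < / 2 ^ S k) by (intros k; apply Rinv_0_lt_compat, pow_lt; lra).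
  unfold binary in H. apply is_series_unique in H as Hx. apply is_series_unique in Hg as H1.
  split.
  - rewrite <- Hx.
    apply Rle_trans with (0 * Series (fun k => bit (e k) / 2 ^ S k)); [lra|].
    rewrite <- Series_scal_l. apply Series_le; [|eexists; exact H]. intros k.
    pose proof (bit_bounds (e k)). specialize (Hk k). unfold Rdiv. nra.
  - rewrite <- Hx, <- H1. apply Series_le; [|eexists; exact Hg]. intros k.
    pose proof (bit_bounds (e k)). specialize (Hk k). unfold Rdiv. nra.
Qed.

Lemma binary_lower n : forall (e : nat -> bool) (x : R), binary e x ->
  (exists k, (k < n)%nat /\ e k = true) -> / 2 ^ n <= x.
Proof.
  induction n as [|n IH]; intros e x H (k & Hk & Hek); [lia|].
  pose proof (binary_shift e x H) as Hs. pose proof (binary_bounds _ _ Hs) as Hb.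
  assert (H2 : 1 <= 2 ^ n) by (apply pow_R1_Rle; lra).
  simpl. rewrite Rinv_mult. destruct (e 0%nat) eqn:E0.
  - unfold bit in Hb. assert (/ 2 ^ n <= 1) by (rewrite <- Rinv_1; apply Rinv_le_contravar; lra). lra.
  - destruct k as [|k]; [congruence|]. unfold bit in Hs.
    specialize (IH _ _ Hs). assert (/ 2 ^ n <= 2 * x - 0) by (apply IH; exists k; split; auto; lia). lra.
Qed.

Lemma binary_upper n : forall (e : nat -> bool) (x : R), binary e x ->
  (exists k, (k < n)%nat /\ e k = false) -> x <= 1 - / 2 ^ n.
Proof.
  induction n as [|n IH]; intros e x H (k & Hk & Hek); [lia|].
  pose proof (binary_shift e x H) as Hs. pose proof (binary_bounds _ _ Hs) as Hb.
  assert (H2 : 1 <= 2 ^ n) by (apply pow_R1_Rle; lra).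
  simpl. rewrite Rinv_mult. destruct (e 0%nat) eqn:E0.
  - destruct k as [|k]; [congruence|]. unfold bit in Hs.
    specialize (IH _ _ Hs). assert (2 * x - 1 <= 1 - / 2 ^ n) by (apply IH; exists k; split; auto; lia). lra.
  - unfold bit in Hb. assert (/ 2 ^ n <= 1) by (rewrite <- Rinv_1; apply Rinv_le_contravar; lra). lra.
Qed.

Fixpoint prefix (e : nat -> bool) (n : nat) : nat :=
  match n with O => O | S k => 2 * prefix e k + (if e k then 1 else 0) end%nat.

Lemma binary_tail (e : nat -> bool) (x : R) n : binary e x ->
  exists t : R, 2 ^ n * x = INR (prefix e n) + t /\ binary (fun k => e (n + k)%nat) t.
Proof.
  intros H. induction n as [|n (t & E & Hb)].
  - exists x. split; [simpl; lra|exact H].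
  - apply binary_shift in Hb. cbv beta in Hb. rewrite Nat.add_0_r in Hb.
    exists (2 * t - bit (e n)). split.
    + change (prefix e (S n)) with (2 * prefix e n + (if e n then 1 else 0))%nat.
      rewrite plus_INR, mult_INR. simpl (2 ^ S n). rewrite Rmult_assoc, E.
      unfold bit. destruct (e n); simpl; ring.
    + eapply is_series_ext; [|exact Hb]. intros k. simpl.
      now replace (n + S k)%nat with (S (n + k)) by lia.
Qed.

Lemma F_tail (N : nat) (psi : R) (j : nat) : F N psi -> exists (i : nat) (e : nat -> bool) (t : R),
  2 ^ j * psi = INR i + t /\ binary e t /\
  forall k, exists l l', (l < N + 2)%nat /\ (l' < N + 2)%nat /\ e (k + l)%nat = true /\ e (k + l')%nat = false.
Proof.
  intros (eps & Hs & Hrun).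
  (* The run condition in a form that passes to tails: both digits occur in every window of N + 2
     places. Digits of [eps] are numbered from 1, those of the tail from 0. *)
  assert (Hmix : forall k, (1 <= k)%nat -> exists l l', (l < N + 2)%nat /\ (l' < N + 2)%nat /\
             eps (k + l)%nat = true /\ eps (k + l')%nat = false).
  { intros k Hk. specialize (Hrun k Hk).
    assert (Hd : exists l, (l < N + 2)%nat /\ eps (k + l)%nat <> eps k).
    { apply NNPP. intros Hno. assert (Hall : forall l, (l < N + 2)%nat -> eps (k + l)%nat = eps k).
      { intros l Hl. apply NNPP. intros Hne. apply Hno. eauto. }
      apply Hrun; [intros l Hl; apply Hall; lia|].
      replace (k + N + 1)%nat with (k + (N + 1))%nat by lia.
      rewrite !Hall by lia. reflexivity. }
    destruct Hd as (l & Hl & Hne). destruct (eps k) eqn:Ek.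
    - exists 0%nat, l. rewrite Nat.add_0_r. repeat split; try lia; auto. now destruct (eps (k + l)%nat).
    - exists l, 0%nat. rewrite Nat.add_0_r. repeat split; try lia; auto. now destruct (eps (k + l)%nat). }
  destruct (binary_tail (fun k => eps (S k)) psi j Hs) as (t & E & Hb).
  exists (prefix (fun k => eps (S k)) j), (fun k => eps (S j + k)%nat), t. split; auto. split; auto.
  intros k. destruct (Hmix (S j + k)%nat ltac:(lia)) as (l & l' & H).
  exists l, l'. now rewrite !Nat.add_assoc.
Qed.

(** The window at the start keeps t away from 0 and 1. Distance from 1/2 costs one more doubling: 2
    t minus the leading digit is again such a tail, hence also away from 0 and 1. *)
Lemma F_tail_bounds (N : nat) (psi : R) (j : nat) : F N psi -> exists (i : nat) (t : R),
  2 ^ j * psi = INR i + t /\ / 2 ^ (N + 2) <= t <= 1 - / 2 ^ (N + 2) /\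
  / 2 ^ (N + 3) <= Rabs (t - / 2).
Proof.
  intros HF. destruct (F_tail N psi j HF) as (i & e & t & E & Hb & Hmix).
  assert (Hbd : forall e t, binary e t -> (forall k, exists l l', (l < N + 2)%nat /\ (l' < N + 2)%nat /\
             e (k + l)%nat = true /\ e (k + l')%nat = false) -> / 2 ^ (N + 2) <= t <= 1 - / 2 ^ (N + 2)).
  { clear. intros e t Hb Hmix. destruct (Hmix 0%nat) as (l & l' & H1 & H2 & H3 & H4).
    split; [apply (binary_lower _ e)|apply (binary_upper _ e)]; eauto. }
  exists i, t. split; auto. split; [now apply (Hbd e)|].
  pose proof (binary_shift e t Hb) as Hs.
  assert (Hb' : / 2 ^ (N + 2) <= 2 * t - bit (e 0%nat) <= 1 - / 2 ^ (N + 2)).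
  { apply (Hbd _ _ Hs). intros k. destruct (Hmix (S k)) as (l & l' & H). now exists l, l'. }
  replace (2 ^ (N + 3)) with (2 * 2 ^ (N + 2)) by (rewrite !pow_add; simpl; ring).
  assert (H0 : 0 < / 2 ^ (N + 2)) by (apply Rinv_0_lt_compat, pow_lt; lra).
  rewrite Rinv_mult. destruct (e 0%nat); unfold bit in Hb'.
  - rewrite Rabs_pos_eq; lra.
  - rewrite Rabs_left1; lra.
Qed.

Lemma cos_shift_abs (i : nat) (x : R) : Rabs (cos (PI * INR i + x)) = Rabs (cos x).
Proof.
  induction i as [|i IH]; [simpl; now rewrite Rmult_0_r, Rplus_0_l|].
  rewrite S_INR. replace (PI * (INR i + 1) + x) with (PI * INR i + x + PI) by ring.
  now rewrite neg_cos, Rabs_Ropp.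
Qed.

(** The value t = 1/2 is the direction of the central slit, where the cosine vanishes. The bound is
    uniform in j because every tail of the digit sequence obeys the same rule. *)
Lemma F_cos_lower (N : nat) : exists c, 0 < c /\ forall psi j, F N psi ->
  c <= Rabs (cos (2 ^ j * (PI * psi))).
Proof.
  pose proof PI_RGT_0 as Hpi.
  set (d := / 2 ^ (N + 3)).
  assert (Hd : 0 < d) by (apply Rinv_0_lt_compat, pow_lt; lra).
  assert (Hd2 : d <= / 8).
  { apply Rinv_le_contravar; [lra|]. rewrite pow_add.
    assert (1 <= 2 ^ N) by (apply pow_R1_Rle; lra). lra. }
  exists (sin (PI * d)). split; [apply sin_gt_0; nra|].
  intros psi j HF. destruct (F_tail_bounds N psi j HF) as (i & t & E & Ht & Hh). fold d in Hh.
  assert (H0 : 0 < / 2 ^ (N + 2)) by (apply Rinv_0_lt_compat, pow_lt; lra).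
  replace (2 ^ j * (PI * psi)) with (PI * INR i + PI * t)
    by (rewrite <- Rmult_plus_distr_l, <- E; ring).
  rewrite cos_shift_abs. rewrite <- (cos_shift (PI * d)).
  destruct (Rle_dec t (/ 2)) as [Hle|Hgt].
  - rewrite Rabs_left1 in Hh by lra. eapply Rle_trans; [|apply Rle_abs].
    apply cos_decr_1; nra.
  - rewrite Rabs_pos_eq in Hh by lra. rewrite <- Rabs_Ropp. eapply Rle_trans; [|apply Rle_abs].
    rewrite <- Rtrigo_facts.cos_pi_minus. apply cos_decr_1; nra.
Qed.

Lemma F_interval (N : nat) (psi : R) : F N psi -> 0 < psi < 1.
Proof.
  intros HF. destruct HF as (eps & Hs & Hrun).
  assert (HF : F N psi) by (exists eps; auto). clear eps Hs Hrun.
  destruct (F_tail N psi 0 HF) as (i & e & t & E & Hb & Hmix).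
  destruct (Hmix 0%nat) as (l & l' & H1 & H2 & H3 & H4).
  assert (H0 : 0 < / 2 ^ (N + 2)) by (apply Rinv_0_lt_compat, pow_lt; lra).
  destruct HF as (eps & Hs & Hrun). pose proof (binary_bounds _ _ Hs) as Hp.
  simpl in E. rewrite Rmult_1_l in E.
  assert (/ 2 ^ (N + 2) <= t) by (apply (binary_lower _ e); eauto).
  assert (t <= 1 - / 2 ^ (N + 2)) by (apply (binary_upper _ e); eauto).
  assert (i = 0%nat).
  { destruct i as [|i]; auto. exfalso. rewrite S_INR in E. pose proof (pos_INR i). lra. }
  subst i. simpl in E. lra.
Qed.

(** * Rays and slits in polar form *)

Definition unit_ray (x : R) : C := (cos x, - sin x).

Lemma Cmod_unit_ray (x : R) : Cmod (unit_ray x) = 1.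
Proof.
  transitivity (sqrt 1); [|apply sqrt_1]. unfold Cmod, unit_ray; simpl. f_equal.
  pose proof (sin2_cos2 x) as E. unfold Rsqr in E. lra.
Qed.

Lemma Cexp_ray (r x : R) n :
  ((RtoC r * unit_ray x) ^ n)%C = (r ^ n * cos (INR n * x), - (r ^ n * sin (INR n * x))).
Proof.
  induction n as [|n IH].
  - simpl. rewrite Rmult_0_l, cos_0, sin_0. unfold RtoC. f_equal; ring.
  - change ((RtoC r * unit_ray x) * (RtoC r * unit_ray x) ^ n = (r ^ S n * cos (INR (S n) * x), - (r ^ S n * sin (INR (S n) * x)))%R)%C.
    rewrite IH, S_INR. replace ((INR n + 1) * x) with (x + INR n * x) by ring.
    rewrite cos_plus, sin_plus. unfold Cmult, RtoC, unit_ray; simpl. f_equal; ring.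
Qed.

Lemma Cexp_polar (h x : R) :
  Cexp (- PI * (h + Ci * x))%C = (RtoC (exp (- PI * h)) * unit_ray (PI * x))%C.
Proof.
  unfold Cexp, Cmult, Cplus, Copp, Ci, RtoC; simpl.
  replace (- PI * (h + (0 * x - 1 * 0)) - - 0 * (0 + (0 * 0 + 1 * x))) with (- PI * h) by ring.
  replace (- PI * (0 + (0 * 0 + 1 * x)) + - 0 * (h + (0 * x - 1 * 0))) with (- (PI * x)) by ring.
  unfold unit_ray. rewrite cos_neg, sin_neg. simpl. f_equal; ring.
Qed.

Lemma Cexp_unit (x : R) : Cexp (- Ci * PI * x)%C = unit_ray (PI * x).
Proof.
  unfold Cexp, Cmult, Copp, Ci, RtoC; simpl.
  replace ((- 0 * PI - - (1) * 0) * x - (- 0 * 0 + - (1) * PI) * 0) with 0 by ring.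
  replace ((- 0 * PI - - (1) * 0) * 0 + (- 0 * 0 + - (1) * PI) * x) with (- (PI * x)) by ring.
  unfold unit_ray. rewrite exp_0, cos_neg, sin_neg. f_equal; ring.
Qed.

Lemma cos_odd_half (k : nat) : Nat.Odd k -> cos (INR k * (PI / 2)) = 0.
Proof.
  intros [p ->]. rewrite plus_INR, mult_INR. simpl.
  replace (((1 + 1) * INR p + 1) * (PI / 2)) with (PI * INR p + PI / 2) by field.
  destruct (Rabs_eq_0 (cos (PI * INR p + PI / 2))); auto.
  now rewrite cos_shift_abs, cos_PI2, Rabs_R0.
Qed.

(** A point on a slit of level m has argument - pi k / 2^m with k odd, so its power of exponent
    2^(m-1) is purely imaginary. On the ray of a number in [F N] the cosine bound excludes this. *)
Lemma F_ray_domain (lam : R) (G : C -> C) (a : R) (Ha : slit_parameter (greens_domain lam G) a)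
    (N : nat) (psi r : R) : F N psi -> 0 < r < 1 ->
  exists z, tOmega lam z /\ G z = (r * Cexp (- Ci * PI * psi))%C.
Proof.
  intros HF Hr. destruct Ha as [_ Ha]. rewrite Cexp_unit.
  set (zeta := (RtoC r * unit_ray (PI * psi))%C).
  pose proof PI_RGT_0 as Hpi. pose proof (F_interval N psi HF) as Hpsi.
  assert (Hsin : 0 < sin (PI * psi)) by (apply sin_gt_0; nra).
  assert (Him : snd zeta < 0).
  { unfold zeta; simpl. nra. }
  assert (Hmod : Cmod zeta = r).
  { unfold zeta. rewrite Cmod_mult, Cmod_R, Rabs_pos_eq, Cmod_unit_ray by lra. ring. }
  destruct (Ha zeta Him) as [_ H].
  destruct H as [H|(z & Hz & E)].
  - split; [lra|]. intros (m & k & h & Hm & Hk & _ & _ & E).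
    rewrite Cexp_polar in E.
    apply (f_equal (fun z => Re (z ^ (2 ^ (m - 1)))%C)) in E. unfold zeta in E.
    rewrite !Cexp_ray in E. unfold Re in E. simpl fst in E.
    rewrite INR_pow2 in E.
    replace (2 ^ (m - 1) * (PI * (INR k / 2 ^ m))) with (INR k * (PI / 2)) in E.
    + rewrite cos_odd_half in E by auto. rewrite Rmult_0_r in E.
      destruct (F_cos_lower N) as (c & Hc & Hcos). specialize (Hcos psi (m - 1)%nat HF).
      apply Rmult_integral in E. destruct E as [E|E].
      * revert E. apply pow_nonzero. lra.
      * rewrite E, Rabs_R0 in Hcos. lra.
    + replace m with (S (m - 1)) at 2 by lia. simpl. field. apply pow_nonzero. lra.
  - exfalso. rewrite H, Cmod_R, Rabs_R0 in Hmod. lra.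
  - exists z. auto.
Qed.

(** As f is nonnegative, its integrals up to c increase with c, and the explicit antiderivative of
    the majorant bounds them; the improper integral is their supremum. *)
Lemma improper_bound (f : R -> R) (r1 K theta : R) :
  r1 < 1 -> 0 < theta < 1 -> 0 < K ->
  (forall r, r1 <= r < 1 -> continuity_pt f r) ->
  (forall r, r1 <= r < 1 -> 0 <= f r <= K * Rpower (1 - r) (- theta)) ->
  exists I, is_RInt_gen f (at_point r1) (at_left 1) I /\
    I <= K / (1 - theta) * Rpower (1 - r1) (1 - theta).
Proof.
  intros Hr1 Hth HK Hcont Hf.
  set (B := K / (1 - theta) * Rpower (1 - r1) (1 - theta)).
  assert (Hc : 0 < K / (1 - theta)) by (apply Rdiv_lt_0_compat; lra).
  assert (Hex : forall b c, r1 <= b -> b <= c -> c < 1 -> ex_RInt f b c).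
  { intros b c H1 H2 H3. apply (ex_RInt_continuous (V := R_CompleteNormedModule)). intros z Hz.
    rewrite Rmin_left, Rmax_right in Hz by lra. apply continuity_pt_filterlim, Hcont. lra. }
  assert (Hpow : forall c, r1 <= c < 1 -> RInt f r1 c <= B).
  { intros c Hc1.
    set (phi := fun r => K * Rpower (1 - r) (- theta)).
    set (Phi := fun r => - (K / (1 - theta)) * Rpower (1 - r) (1 - theta)).
    assert (HI : is_RInt phi r1 c (minus (Phi c) (Phi r1))).
    { apply (is_RInt_derive Phi phi).
      - intros x Hx. rewrite Rmin_left, Rmax_right in Hx by lra.
        unfold Phi, phi, Rpower. auto_derive; [lra|].
        replace (exp (- theta * ln (1 - x))) with (exp ((1 - theta) * ln (1 - x)) * / (1 - x)).
        + change (1 + - x) with (1 - x). field. lra.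
        + rewrite <- (exp_ln (1 - x)) at 2 by lra. rewrite <- exp_Ropp, <- exp_plus. f_equal. ring.
      - intros x Hx. rewrite Rmin_left, Rmax_right in Hx by lra.
        apply (ex_derive_continuous (K := R_AbsRing) (V := R_NormedModule)).
        unfold phi, Rpower. auto_derive. lra. }
    apply Rle_trans with (RInt phi r1 c).
    - apply RInt_le; [lra|apply Hex; lra|eexists; exact HI|]. intros x Hx. apply Hf. lra.
    - rewrite (is_RInt_unique _ _ _ _ HI). unfold minus, plus, opp; simpl. unfold Phi, B.
      assert (0 < Rpower (1 - c) (1 - theta)) by apply exp_pos. nra. }
  assert (Hmono : forall b c, r1 <= b -> b <= c -> c < 1 -> RInt f r1 b <= RInt f r1 c).
  { intros b c H1 H2 H3. rewrite <- (RInt_Chasles f r1 b c); [|apply Hex; lra|apply Hex; lra].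
    assert (0 <= RInt f b c) by (apply RInt_ge_0; [lra|apply Hex; lra|intros x Hx; apply Hf; lra]).
    change plus with Rplus. lra. }
  set (E := fun y => exists b, r1 <= b < 1 /\ y = RInt f r1 b).
  destruct (completeness E) as (I & HI1 & HI2).
  - exists B. intros y (b & Hb & ->). now apply Hpow.
  - exists (RInt f r1 r1), r1. split; auto. lra.
  - exists I. split.
    + intros P [eps HP].
      assert (Hb0 : exists b0, r1 <= b0 < 1 /\ I - eps < RInt f r1 b0).
      { apply NNPP. intros Hno. pose proof (cond_pos eps).
        assert (I <= I - eps); [|lra]. apply HI2. intros y (b & Hb & ->).
        apply Rnot_lt_le. intros Hlt. apply Hno. eauto. }
      destruct Hb0 as (b0 & Hb0 & Hlt).
      apply (Filter_prod _ _ _ (fun x => x = r1) (fun x => b0 < x < 1)).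
      * reflexivity.
      * assert (Hd : 0 < 1 - b0) by lra. exists (mkposreal _ Hd). intros y Hy Hy1.
        change (Rabs (y - 1) < 1 - b0) in Hy. apply Rabs_def2 in Hy. lra.
      * intros x y -> Hy. exists (RInt f r1 y). simpl. split.
        -- apply (RInt_correct (V := R_CompleteNormedModule)). apply Hex; lra.
        -- apply HP. change (Rabs (RInt f r1 y - I) < eps).
           assert (RInt f r1 b0 <= RInt f r1 y) by (apply Hmono; lra).
           assert (RInt f r1 y <= I) by (apply HI1; exists y; split; auto; lra).
           pose proof (cond_pos eps). apply Rabs_def1; lra.
    + apply HI2. intros y (b & Hb & ->). now apply Hpow.
Qed.

Lemma second_derivative_integral (lam : R) (Hlam : 2 + sqrt 2 < lam)
    (g : C -> R) (Hg : greens_function (Omega lam) g)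
    (G : C -> C) (HG : greens_coordinate lam g G)
    (T : C -> C) (HT : greens_mapping lam G T)
    (a : R) (Ha : slit_parameter (greens_domain lam G) a) (N : nat) :
  exists CN : R, forall psi : R, F N psi ->
    exists I : R,
      is_RInt_gen
        (fun r : R => Cmod (C_derive (C_derive T) (r * Cexp (- Ci * PI * psi))%C))
        (at_point (exp (- PI * a))) (at_left 1) I /\ I <= CN.
Proof.
  set (r1 := exp (- PI * a)).
  assert (Hr1 : 0 < r1 < 1).
  { split; [apply exp_pos|]. unfold r1. rewrite <- exp_0. apply exp_increasing.
    pose proof PI_RGT_0. destruct Ha as [Ha0 _]. nra. }
  destruct (F_cos_lower N) as (c & Hc & Hcos).
  destruct (T_second_bound lam Hlam g Hg G HG T HT c r1) as (K & theta & HK & Hth & Hbound); try lra.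
  exists (K / (1 - theta) * Rpower (1 - r1) (1 - theta)). intros psi HF.
  assert (Hmod : forall r, 0 < r -> Cmod (r * Cexp (- Ci * PI * psi))%C = r).
  { intros r Hr. rewrite Cmod_mult, Cmod_R, Rabs_pos_eq, Cexp_unit, Cmod_unit_ray by lra. ring. }
  apply improper_bound; auto; try lra.
  - intros r Hr. destruct (F_ray_domain lam G a Ha N psi r HF) as (z & Hz & E); [lra|].
    pose proof (T_second_cont lam Hlam g Hg G HG T HT z Hz) as Hcn. rewrite E in Hcn.
    intros eps He. destruct (Hcn eps He) as (d & Hd & H). exists d. split; auto.
    intros x [_ Hx]. simpl in Hx |- *. unfold Rdist in *.
    set (e := Cexp (- Ci * PI * psi)) in *.
    specialize (H ((RtoC x - RtoC r) * e)%C).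
    replace (r * e + (RtoC x - RtoC r) * e)%C with (x * e)%C in H by ring.
    set (X := C_derive (C_derive T) (x * e)%C) in *. set (Y := C_derive (C_derive T) (r * e)%C) in *.
    assert (Hlt : Cmod (X - Y)%C < eps).
    { apply H. rewrite Cmod_mult, <- RtoC_minus, Cmod_R.
      specialize (Hmod 1 Rlt_0_1). fold e in Hmod. rewrite Cmult_1_l in Hmod. rewrite Hmod. lra. }
    pose proof (Cmod_sub_triangle X Y) as T1. pose proof (Cmod_sub_triangle Y X) as T2.
    rewrite (Cmod_sub_sym Y X) in T2. apply Rabs_def1; lra.
  - intros r Hr. split; [apply Cmod_ge_0|].
    destruct (F_ray_domain lam G a Ha N psi r HF) as (z & Hz & E); [lra|].
    rewrite <- E. assert (Hzr : Cmod (G z) = r) by (rewrite E; apply Hmod; lra).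
    rewrite <- Hzr. apply Hbound; auto; [lra|].
    (* Since G(z_j) = zeta^(2^j) has argument - 2^j pi psi, the hypothesis on the orbit becomes the
       cosine bound. *)
    intros j. rewrite (G_orb lam Hlam g Hg G HG) by auto. rewrite E, Cexp_unit, Cexp_ray, INR_pow2.
    set (x := 2 ^ j * (PI * psi)).
    assert (Hm : Cmod (r ^ (2 ^ j) * cos x, - (r ^ (2 ^ j) * sin x)) = r ^ (2 ^ j)).
    { replace (r ^ (2 ^ j) * cos x, - (r ^ (2 ^ j) * sin x)) with (RtoC (r ^ (2 ^ j)) * unit_ray x)%C
        by (unfold RtoC, Cmult, unit_ray; simpl; f_equal; ring).
      rewrite Cmod_mult, Cmod_R, Rabs_pos_eq, Cmod_unit_ray by (apply pow_le; lra). ring. }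
    rewrite Hm. unfold Re; simpl. rewrite Rabs_mult, (Rabs_pos_eq (r ^ _)) by (apply pow_le; lra).
    rewrite Rmult_comm. apply Rmult_le_compat_l; [apply pow_le; lra|]. now apply Hcos.
Qed.

(** * Hausdorff dimension *)

Lemma prefix_inj (e e' : nat -> bool) n : prefix e n = prefix e' n ->
  forall k, (k < n)%nat -> e k = e' k.
Proof.
  induction n as [|n IH]; intros H k Hk; [lia|]. simpl in H.
  assert (E : prefix e n = prefix e' n /\ e n = e' n).
  { destruct (e n), (e' n); split; auto; lia. }
  destruct E as [E1 E2]. destruct (Nat.eq_dec k n) as [->|]; auto. apply IH; auto. lia.
Qed.

Lemma prefix_ext (e e' : nat -> bool) n : (forall k, (k < n)%nat -> e k = e' k) ->
  prefix e n = prefix e' n.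
Proof.
  induction n as [|n IH]; intros H; auto. simpl. rewrite IH, H by auto. reflexivity.
Qed.

Lemma binary_close (e e' : nat -> bool) (x x' : R) n : binary e x -> binary e' x' ->
  (forall k, (k < n)%nat -> e k = e' k) -> Rabs (x - x') <= / 2 ^ n.
Proof.
  intros H H' Hk. destruct (binary_tail e x n H) as (t & E & Hb).
  destruct (binary_tail e' x' n H') as (t' & E' & Hb').
  rewrite (prefix_ext e e' n Hk) in E. apply binary_bounds in Hb, Hb'.
  pose proof (pow2_pos n) as H2.
  assert (Hi : / 2 ^ n * 2 ^ n = 1) by (field; lra).
  apply Rabs_le. split; apply Rmult_le_reg_r with (2 ^ n); auto; nra.
Qed.

Lemma binary_exists (e : nat -> bool) : exists x, binary e x.
Proof.
  apply (ex_series_le (K := R_AbsRing) (V := R_CompleteNormedModule) _ (fun k => (/ 2) ^ k)).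
  - intros k. change (Rabs (bit (e k) / 2 ^ S k) <= (/ 2) ^ k).
    assert (H2 : 0 < / 2 ^ k) by (apply Rinv_0_lt_compat, pow_lt; lra).
    pose proof (bit_bounds (e k)). unfold Rdiv. simpl. rewrite Rinv_mult, pow_inv.
    rewrite Rabs_pos_eq; nra.
  - apply ex_series_geom. rewrite Rabs_pos_eq; lra.
Qed.

Fixpoint remainder (y : R) (k : nat) : R :=
  match k with
  | O => y
  | S n => if Rle_dec (/ 2) (remainder y n) then 2 * remainder y n - 1 else 2 * remainder y n
  end.

Lemma binary_expansion (y : R) : 0 <= y < 1 -> exists e, binary e y.
Proof.
  intros Hy. set (r := remainder y).
  exists (fun k => if Rle_dec (/ 2) (r k) then true else false).
  assert (Hr : forall k, 0 <= r k < 1).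
  { induction k as [|k IH]; [exact Hy|]. unfold r in *. simpl.
    destruct (Rle_dec (/ 2) (remainder y k)); lra. }
  assert (Hsum : forall n, sum_n (fun k => bit (if Rle_dec (/ 2) (r k) then true else false) / 2 ^ S k) n
             = y - r (S n) * (/ 2) ^ S n).
  { induction n as [|n IH].
    - rewrite sum_O. unfold r. simpl. destruct (Rle_dec (/ 2) y); simpl; field.
    - rewrite sum_Sn, IH. change plus with Rplus.
      change (r (S (S n))) with (if Rle_dec (/ 2) (r (S n)) then 2 * r (S n) - 1 else 2 * r (S n)).
      rewrite !pow_inv. assert (2 ^ n <> 0) by (apply pow_nonzero; lra).
      destruct (Rle_dec (/ 2) (r (S n))); simpl; field; auto. }
  enough (HL : is_lim_seq (fun n => y - r (S n) * (/ 2) ^ S n) y)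
    by exact (is_lim_seq_ext _ _ _ (fun n => eq_sym (Hsum n)) HL).
  replace (Finite y) with (Finite (y - 0)) by (f_equal; ring).
  apply (is_lim_seq_minus' _ _ y 0); [apply is_lim_seq_const|].
  apply (is_lim_seq_le_le (fun _ => 0) _ (fun n => (/ 2) ^ S n)).
  - intros n. specialize (Hr (S n)). assert (0 < (/ 2) ^ S n) by (apply pow_lt; lra). nra.
  - apply is_lim_seq_const.
  - apply (is_lim_seq_incr_1 (fun n => (/ 2) ^ n)). apply is_lim_seq_geom. rewrite Rabs_pos_eq; lra.
Qed.

(** Every window of length [N + 2] in these blocks [0 1 b ... b] contains both digits. *)
Definition block (N : nat) (b : nat -> bool) (k : nat) : bool :=
  match (k mod (N + 2))%nat with
  | O => false
  | S O => true
  | S (S p) => b (N * (k / (N + 2)) + p)%nat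
  end.

Lemma block_digit (N : nat) (b : nat -> bool) (m p : nat) : (p < N + 2)%nat ->
  block N b ((N + 2) * m + p) =
  match p with O => false | S O => true | S (S p) => b (N * m + p)%nat end.
Proof.
  intros Hp. unfold block.
  replace ((N + 2) * m + p)%nat with (p + m * (N + 2))%nat by lia.
  rewrite Nat.Div0.mod_add, Nat.mod_small, Nat.div_add, Nat.div_small by lia. reflexivity.
Qed.

Lemma residue_in_window (L k p : nat) : (p < L)%nat ->
  exists l m, (l < L)%nat /\ (k + l = L * m + p)%nat.
Proof.
  intros Hp. pose proof (Nat.div_mod_eq k L) as E. pose proof (Nat.mod_upper_bound k L ltac:(lia)) as Hm.
  destruct (Nat.le_gt_cases (k mod L) p) as [H|H].
  - exists (p - k mod L)%nat, (k / L)%nat. lia.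
  - exists (p + L - k mod L)%nat, (S (k / L)). split; [lia|].
    rewrite Nat.mul_succ_r. lia.
Qed.

Lemma block_in_F (N : nat) (b : nat -> bool) (x : R) : binary (block N b) x -> F N x.
Proof.
  intros Hx. exists (fun k => block N b (pred k)). split; [exact Hx|].
  intros k Hk Hall Heq.
  assert (Hwin : forall l, (l < N + 2)%nat -> block N b (pred k + l)%nat = block N b (pred k)).
  { intros l Hl. destruct (Nat.eq_dec l (N + 1)) as [->|].
    - replace (pred k + (N + 1))%nat with (pred (k + N + 1)) by lia. rewrite Heq.
      apply Hall. lia.
    - replace (pred k + l)%nat with (pred (k + l)) by lia. apply Hall. lia. }
  destruct (residue_in_window (N + 2) (pred k) 0) as (l0 & m0 & H0 & E0); [lia|].
  destruct (residue_in_window (N + 2) (pred k) 1) as (l1 & m1 & H1 & E1); [lia|].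
  pose proof (Hwin l0 H0) as A0. pose proof (Hwin l1 H1) as A1.
  rewrite E0, block_digit in A0 by lia. rewrite E1, block_digit in A1 by lia. congruence.
Qed.

Lemma block_tail (N : nat) (b : nat -> bool) (m : nat) (t : R) :
  binary (fun k => block N b ((N + 2) * m + k)%nat) t -> 1 / 4 <= t <= 1 / 2.
Proof.
  intros H. pose proof (binary_shift _ _ H) as H1. cbv beta in H1.
  pose proof (binary_shift _ _ H1) as H2. cbv beta in H2.
  rewrite !block_digit in H2 by lia. apply binary_bounds in H2. unfold bit in H2. lra.
Qed.

(** Cut at a block boundary and scaled, both numbers are integers plus tails in [1/4, 1/2]. A scaled
    distance below 1/2 leaves the integers less than 3/4 apart, hence equal; a coincidence like
    0111... = 1000... cannot occur. *)
Lemma block_separation (N : nat) (b b' : nat -> bool) (x x' : R) (m : nat) :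
  binary (block N b) x -> binary (block N b') x' -> Rabs (x - x') < / 2 * / 2 ^ ((N + 2) * m) ->
  forall k, (k < N * m)%nat -> b k = b' k.
Proof.
  intros H H' Hlt.
  destruct (binary_tail _ x ((N + 2) * m) H) as (t & E & Hb).
  destruct (binary_tail _ x' ((N + 2) * m) H') as (t' & E' & Hb').
  apply block_tail in Hb, Hb'.
  set (n := ((N + 2) * m)%nat) in *.
  pose proof (pow2_pos n) as H2.
  apply (Rmult_lt_compat_r (2 ^ n)) in Hlt; auto.
  replace (/ 2 * / 2 ^ n * 2 ^ n) with (/ 2) in Hlt by (field; lra).
  rewrite <- (Rabs_pos_eq (2 ^ n)), <- Rabs_mult in Hlt by lra.
  replace ((x - x') * 2 ^ n) with (INR (prefix (block N b) n) - INR (prefix (block N b') n) + (t - t')) in Hlt by lra.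
  assert (Ep : prefix (block N b) n = prefix (block N b') n).
  { apply Rabs_def2 in Hlt.
    destruct (Nat.lt_trichotomy (prefix (block N b) n) (prefix (block N b') n)) as [Hl|[Hl|Hl]]; auto;
      exfalso; apply (le_INR (S _)) in Hl; rewrite S_INR in Hl; lra. }
  pose proof (prefix_inj _ _ _ Ep) as Hd. intros k Hk.
  assert (HN : N <> 0%nat) by lia.
  pose proof (Nat.div_mod_eq k N) as Ek. pose proof (Nat.mod_upper_bound k N HN) as Hm.
  assert (Hq : (k / N < m)%nat) by (apply Nat.Div0.div_lt_upper_bound; lia).
  (* Digit k of [b] sits in block k / N, at offset 2 + (k mod N). *)
  specialize (Hd ((N + 2) * (k / N) + S (S (k mod N)))%nat).
  assert (Hlt2 : ((N + 2) * (k / N) + S (S (k mod N)) < n)%nat).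
  { unfold n. apply Nat.lt_le_trans with ((N + 2) * S (k / N))%nat; [lia|]. apply Nat.mul_le_mono_l. lia. }
  specialize (Hd Hlt2). rewrite !block_digit in Hd by lia. now rewrite <- Ek in Hd.
Qed.

(** * Covers and Hausdorff premeasures *)

Lemma diam_bounds (U : R -> Prop) (d : R) : (forall x y, U x -> U y -> Rabs (x - y) <= d) ->
  (exists x, U x) -> 0 <= diam U <= d /\ forall x y, U x -> U y -> Rabs (x - y) <= diam U.
Proof.
  intros Hd [x0 H0]. unfold diam.
  set (E := fun d => exists x y, U x /\ U y /\ d = Rabs (x - y)).
  destruct (Lub_Rbar_correct E) as [Hub Hlub].
  assert (Hd' : Rbar_le (Lub_Rbar E) d).
  { apply Hlub. intros y (u & v & Hu & Hv & ->). simpl. auto. }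
  assert (HE : forall x y, U x -> U y -> E (Rabs (x - y))) by (intros x y Hx Hy; now exists x, y).
  pose proof (Hub _ (HE x0 x0 H0 H0)) as Hx0.
  replace (Rabs (x0 - x0)) with 0 in Hx0 by (rewrite Rminus_diag, Rabs_R0; auto).
  destruct (Lub_Rbar E) as [l| |]; simpl in Hx0, Hd'; try easy. simpl. split; auto.
  intros x y Hx Hy. exact (Hub _ (HE x y Hx Hy)).
Qed.

Lemma dpow_nonneg (d s : R) : 0 <= dpow d s.
Proof. unfold dpow. destruct (Rlt_dec 0 d); [left; apply exp_pos|lra]. Qed.

Lemma exp_nondecreasing (x y : R) : x <= y -> exp x <= exp y.
Proof. intros [H | ->]; [left; now apply exp_increasing|lra]. Qed.

(** The map sending a number with blocks [0 1 b b ... b] to the number with digits [b b ... b] is Hoelder continuous of exponent [N / (N + 2)]. *)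
Lemma block_hoelder (N : nat) (s : R) (U : R -> Prop) (b b' : nat -> bool) (x x' y y' : R) :
  (1 <= N)%nat -> 0 < s <= INR N / (INR N + 2) ->
  (forall u v, U u -> U v -> Rabs (u - v) <= 1) ->
  binary (block N b) x -> binary (block N b') x' -> U x -> U x' -> binary b y -> binary b' y' ->
  Rabs (y - y') <= 2 * 2 ^ N * dpow (diam U) s.
Proof.
  intros HN Hs HU Hx Hx' HUx HUx' Hy Hy'.
  destruct (diam_bounds U 1 HU (ex_intro _ x HUx)) as [[HD0 HD1] HD].
  specialize (HD x x' HUx HUx'). set (D := diam U) in *.
  assert (HN1 : 1 <= INR N) by (change 1 with (INR 1); now apply le_INR).
  assert (Hclose : forall m, D < / 2 * / 2 ^ ((N + 2) * m) -> Rabs (y - y') <= / 2 ^ (N * m)).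
  { intros m Hm. apply (binary_close b b'); auto.
    apply (block_separation N b b' x x' m); auto. lra. }
  assert (Hsmall : forall eps, 0 < eps -> exists m, / 2 ^ m < eps).
  { intros eps He. destruct (pow_lt_1_zero (/ 2) ltac:(rewrite Rabs_pos_eq; lra) eps He) as (m & Hm).
    exists m. specialize (Hm m (Nat.le_refl m)). rewrite pow_inv in Hm. apply Rabs_def2 in Hm. lra. }
  assert (Hmono : forall k l, (k <= l)%nat -> / 2 ^ l <= / 2 ^ k).
  { intros k l Hkl. apply Rinv_le_contravar; [apply pow_lt; lra|]. apply Rle_pow; [lra|auto]. }
  unfold dpow. destruct (Rlt_dec 0 D) as [HDp|HDp].
  - destruct (Hsmall (2 * D)) as (m1 & Hm1); [lra|].
    assert (Hex : exists m, / 2 * / 2 ^ ((N + 2) * S m) <= D).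
    { exists m1. specialize (Hmono m1 ((N + 2) * S m1)%nat ltac:(nia)). lra. }
    (* Descending from a scale finer than D gives an m for which the digits still agree on m blocks
       while D is no longer below the scale of m + 1 blocks. *)
    assert (Hleast : exists m, / 2 * / 2 ^ ((N + 2) * S m) <= D /\ Rabs (y - y') <= / 2 ^ (N * m)).
    { destruct Hex as (m & Hm). induction m as [|m IH].
      - exists 0%nat. split; auto. rewrite Nat.mul_0_r. apply (binary_close b b'); auto. lia.
      - destruct (Rle_dec (/ 2 * / 2 ^ ((N + 2) * S m)) D) as [H|H]; [now apply IH|].
        exists (S m). split; auto. apply Hclose. lra. }
    destruct Hleast as (m & Hm & Hyy). eapply Rle_trans; [exact Hyy|].
    set (n := ((N + 2) * S m)%nat) in *.
    assert (H2n : 0 < / 2 ^ n) by (apply Rinv_0_lt_compat, pow_lt; lra).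
    assert (Hlow : / 2 * / 2 ^ (N * S m) <= Rpower D s).
    { apply Rle_trans with (Rpower D (INR N / (INR N + 2))).
      - apply Rle_trans with (Rpower (/ 2 * / 2 ^ n) (INR N / (INR N + 2))).
        + rewrite <- Rpower_mult_distr by lra.
          assert (E : Rpower (/ 2 ^ n) (INR N / (INR N + 2)) = / 2 ^ (N * S m)).
          { rewrite <- (Rpower_pow n) by lra. rewrite <- (Rpower_pow (N * S m)) by lra.
            rewrite <- !Rpower_Ropp, Rpower_mult. f_equal.
            unfold n. rewrite !mult_INR, plus_INR. simpl (INR 2). field. lra. }
          rewrite E. apply Rmult_le_compat_r; [left; apply Rinv_0_lt_compat, pow_lt; lra|].
          rewrite <- (Rpower_1 (/ 2)) at 1 by lra. unfold Rpower. apply exp_nondecreasing.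
          assert (ln (/ 2) < 0) by (rewrite <- ln_1; apply ln_increasing; lra).
          assert (INR N / (INR N + 2) <= 1).
          { apply Rmult_le_reg_r with (INR N + 2); [lra|].
            replace (INR N / (INR N + 2) * (INR N + 2)) with (INR N) by (field; lra). lra. }
          nra.
        + apply Rle_Rpower_l; [lra|]. split; [nra|auto].
      - unfold Rpower. apply exp_nondecreasing.
        assert (ln D <= 0) by (rewrite <- ln_1; apply ln_le; lra). nra. }
    (* The factor 2^N pays for the one block between the two scales, and 2 for the constant 1/2 of
       the separation, raised to a power at most 1. *)
    replace (/ 2 ^ (N * m)) with (2 * 2 ^ N * (/ 2 * / 2 ^ (N * S m))).
    + apply Rmult_le_compat_l; auto. pose proof (pow2_pos N). lra.
    + rewrite Nat.mul_succ_r, pow_add. field. split; apply pow_nonzero; lra.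
  (* Diameter zero: [dpow] is 0 here, so y = y' has to be shown, which follows from agreement at
     every scale. *)
  - rewrite Rmult_0_r. apply Rnot_lt_le. intros Hpos.
    destruct (Hsmall _ Hpos) as (m & Hm).
    assert (H1 : Rabs (y - y') <= / 2 ^ (N * m)).
    { apply Hclose. assert (0 < / 2 ^ ((N + 2) * m)) by (apply Rinv_0_lt_compat, pow_lt; lra). lra. }
    specialize (Hmono m (N * m)%nat ltac:(nia)). lra.
Qed.

Lemma sum_n_le' (u v : nat -> R) n : (forall k, u k <= v k) -> sum_n u n <= sum_n v n.
Proof. intros H. apply sum_n_m_le. exact H. Qed.

(** The supremum of the [t] for which finitely many of the intervals have total length at least [t] on the left of [t] must be [1]. *)
Lemma interval_cover_length (l r : nat -> R) :
  (forall i, l i <= r i) -> (forall t, 0 <= t < 1 -> exists i, l i < t < r i) ->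
  forall B, (forall n, sum_n (fun i => r i - l i) n <= B) -> 1 <= B.
Proof.
  intros Hlr Hcov B HB.
  set (len := fun t i => Rmax 0 (Rmin t (r i) - l i)).
  assert (Hlen0 : forall t i, 0 <= len t i) by (intros; apply Rmax_l).
  assert (Hlen1 : forall t i, len t i <= r i - l i).
  { intros t i. specialize (Hlr i). unfold len. apply Rmax_lub; [lra|].
    pose proof (Rmin_r t (r i)). lra. }
  assert (Hmono : forall t t' i, t <= t' -> len t i <= len t' i).
  { intros t t' i Ht. unfold len. apply Rle_max_compat_l.
    pose proof (Rle_min_compat_r t t' (r i) Ht). lra. }
  set (A := fun t => 0 <= t <= 1 /\ exists n, t <= sum_n (len t) n).
  destruct (completeness A) as (T & HT1 & HT2).
  - exists 1. intros t [Ht _]. lra.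
  - exists 0. split; [lra|]. exists 0%nat. rewrite sum_O. apply Hlen0.
  - assert (HAB : forall t, A t -> t <= B).
    { intros t [_ [n Hn]]. eapply Rle_trans; [exact Hn|]. eapply Rle_trans; [|apply (HB n)].
      now apply sum_n_le'. }
    assert (HT0 : 0 <= T <= 1).
    { split.
      - apply HT1. split; [lra|]. exists 0%nat. rewrite sum_O. apply Hlen0.
      - apply HT2. intros t [Ht _]. lra. }
    destruct (Req_dec T 1) as [E|E].
    + rewrite <- E. apply HT2. exact HAB.
    + exfalso. destruct (Hcov T ltac:(lra)) as (i & Hi1 & Hi2).
      assert (Ht : exists t, A t /\ l i < t).
      { apply NNPP. intros Hno. assert (T <= l i); [|lra]. apply HT2. intros t Ht.
        apply Rnot_lt_le. intros Hlt. apply Hno. eauto. }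
      destruct Ht as (t & HAt & Hlt). pose proof (HT1 t HAt) as HtT.
      destruct HAt as [Ht01 [n Hn]].
      (* Interval i contains [t, t'], so its part left of t' is longer by t' - t than its part left
         of t; the estimate at t thus extends to t' > T. *)
      set (t' := Rmin 1 ((T + r i) / 2)).
      assert (Ht' : T < t' /\ t' <= 1 /\ t' < r i).
      { unfold t'. pose proof (Rmin_l 1 ((T + r i) / 2)). pose proof (Rmin_r 1 ((T + r i) / 2)).
        split; [apply Rmin_glb_lt; lra|lra]. }
      assert (HA' : A t').
      { split; [lra|]. exists (n + i)%nat.
        assert (Hgrow : forall u : nat -> R, (forall k, 0 <= u k) -> forall p q, (p <= q)%nat -> sum_n u p <= sum_n u q).
        { intros u Hu p q Hpq. induction Hpq as [|q Hpq IH]; [lra|].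
          rewrite sum_Sn. change plus with Rplus. specialize (Hu (S q)). lra. }
        set (u := fun k => len t' k - len t k).
        assert (Hu : forall k, 0 <= u k) by (intros k; unfold u; specialize (Hmono t t' k ltac:(lra)); lra).
        assert (Hui : u i <= sum_n u (n + i)).
        { apply Rle_trans with (sum_n u i); [|apply Hgrow; auto; lia].
          destruct i as [|i]; [rewrite sum_O; lra|]. rewrite sum_Sn. change plus with Rplus.
          assert (0 <= sum_n u i).
          { apply Rle_trans with (sum_n u 0); [rewrite sum_O; auto|apply Hgrow; auto; lia]. }
          lra. }
        assert (Eu : u i = t' - t).
        { unfold u, len. rewrite !Rmin_left by lra. rewrite !Rmax_right by lra. ring. }
        assert (Es : sum_n (len t') (n + i) = sum_n (len t) (n + i) + sum_n u (n + i)).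
        { rewrite <- (sum_n_plus (G := R_AbelianMonoid)). apply sum_n_ext. intros k.
          change (len t' k = len t k + (len t' k - len t k)). ring. }
        pose proof (Hgrow (len t) (Hlen0 t) n (n + i)%nat ltac:(lia)). lra. }
      specialize (HT1 t' HA'). lra.
Qed.

(** The digit map of [block_hoelder] sends the U i to sets V i that cover [0,1). Each nonempty V i
    lies within w i of one of its points, so intervals of radius slightly above w i have total
    length at least 1, which bounds the sum of the diam^s from below. *)
Lemma premeasure_lower (N : nat) (s total : R) (U : nat -> R -> Prop) :
  (1 <= N)%nat -> 0 < s <= INR N / (INR N + 2) ->
  (forall (i : nat) (x y : R), U i x -> U i y -> Rabs (x - y) <= 1) ->
  (forall x : R, F N x -> exists i : nat, U i x) ->
  is_series (fun i => dpow (diam (U i)) s) total ->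
  / (8 * 2 ^ N) <= total.
Proof.
  intros HN Hs HU Hcov Htot.
  set (C := 2 * 2 ^ N). assert (HC : 0 < C) by (unfold C; pose proof (pow2_pos N); lra).
  set (w := fun i => C * dpow (diam (U i)) s).
  assert (Hw : forall i, 0 <= w i) by (intros i; unfold w; pose proof (dpow_nonneg (diam (U i)) s); nra).
  set (V := fun i y => exists b x, binary b y /\ binary (block N b) x /\ U i x).
  assert (HV : forall i y y', V i y -> V i y' -> Rabs (y - y') <= w i).
  { intros i y y' (b & x & H1 & H2 & H3) (b' & x' & H1' & H2' & H3').
    apply (block_hoelder N s (U i) b b' x x' y y'); auto. exact (HU i). }
  assert (Hc : forall i, exists c, forall y, V i y -> Rabs (y - c) <= w i).
  { intros i. destruct (classic (exists c, V i c)) as [[c Hc]|Hno].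
    - exists c. intros y Hy. now apply HV.
    - exists 0. intros y Hy. exfalso. eauto. }
  set (c := fun i => proj1_sig (constructive_indefinite_description _ (Hc i))).
  assert (Hcc : forall i y, V i y -> Rabs (y - c i) <= w i).
  { intros i. apply (proj2_sig (constructive_indefinite_description _ (Hc i))). }
  (* Open intervals are required, so the radii grow by eta i, of sum 1/4. This costs 1/2 in length
     and leaves 2 C total >= 1/2. *)
  set (eta := fun i => / 8 * (/ 2) ^ i).
  assert (Heta : forall i, 0 < eta i).
  { intros i. unfold eta. assert (0 < (/ 2) ^ i) by (apply pow_lt; lra). lra. }
  assert (H1 : 1 <= 2 * (C * total) + / 2).
  { apply (interval_cover_length (fun i => c i - (w i + eta i)) (fun i => c i + (w i + eta i))).
    - intros i. specialize (Hw i). specialize (Heta i). lra.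
    - intros t Ht. destruct (binary_expansion t Ht) as [b Hb].
      destruct (binary_exists (block N b)) as [x Hx].
      destruct (Hcov x (block_in_F N b x Hx)) as [i Hi]. exists i.
      specialize (Hcc i t ltac:(exists b, x; auto)). specialize (Heta i).
      apply Rabs_le_between in Hcc. lra.
    - intros n.
      assert (Hg : is_series eta (/ 8 * / (1 - / 2))).
      { apply (is_series_scal (K := R_AbsRing) (V := R_NormedModule) (/ 8) (fun i => (/ 2) ^ i)).
        apply is_series_geom. rewrite Rabs_pos_eq; lra. }
      assert (Hw' : is_series w (C * total)).
      { apply (is_series_scal (K := R_AbsRing) (V := R_NormedModule) C (fun i => dpow (diam (U i)) s)). exact Htot. }
      pose proof (is_series_plus (K := R_AbsRing) (V := R_NormedModule) w eta _ _ Hw' Hg) as Hp.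
      pose proof (is_series_scal (K := R_AbsRing) (V := R_NormedModule) 2 _ _ Hp) as Hp2.
      assert (El : 2 * (C * total) + / 2 = 2 * (C * total + / 8 * / (1 - / 2))) by field.
      rewrite El.
      assert (Hincr : forall m, sum_n (fun i => 2 * (w i + eta i)) m <= sum_n (fun i => 2 * (w i + eta i)) (S m)).
      { intros m. rewrite sum_Sn. change plus with Rplus. specialize (Hw (S m)). specialize (Heta (S m)). lra. }
      apply Rle_trans with (sum_n (fun i => 2 * (w i + eta i)) n).
      + apply sum_n_le'. intros k. lra.
      + exact (is_lim_seq_incr_compare _ _ Hp2 Hincr n). }
  apply Rmult_le_reg_l with (8 * 2 ^ N); [unfold C in HC; lra|].
  rewrite Rinv_r by (unfold C in HC; lra). unfold C in H1. lra.
Qed.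

(** The measure is a supremum over all scales, so measure zero would make the premeasure at scale 1
    at most zero, against [premeasure_lower] when s < N/(N + 2). *)
Lemma Hdim_F_lower (N : nat) : (1 <= N)%nat -> Rbar_le (INR N / (INR N + 2)) (Hdim (F N)).
Proof.
  intros HN. unfold Hdim.
  match goal with |- Rbar_le _ (Glb_Rbar ?E) => destruct (Glb_Rbar_correct E) as [_ Hglb] end.
  apply Hglb. intros s [Hs Hmeas]. simpl. apply Rnot_lt_le. intros Hlt.
  assert (Hpre : Rbar_le (/ (8 * 2 ^ N)) (hausdorff_premeasure s 1 (F N))).
  { unfold hausdorff_premeasure.
    match goal with |- Rbar_le _ (Glb_Rbar ?E) => destruct (Glb_Rbar_correct E) as [_ Hg] end.
    apply Hg. intros total (U & H1 & H2 & H3). simpl.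
    apply (premeasure_lower N s total U); auto. lra. }
  assert (Hle : Rbar_le (hausdorff_premeasure s 1 (F N)) (hausdorff_measure s (F N))).
  { unfold hausdorff_measure, Rbar_lub.
    match goal with |- Rbar_le _ (proj1_sig ?p) => destruct (proj2_sig p) as [Hub _] end.
    apply Hub. exists 1. split; [lra|reflexivity]. }
  rewrite Hmeas in Hle. pose proof (Rbar_le_trans _ _ _ Hpre Hle) as H. simpl in H.
  assert (0 < / (8 * 2 ^ N)).
  { apply Rinv_0_lt_compat. pose proof (pow2_pos N). lra. }
  lra.
Qed.

Theorem theorem1p1 (lam : R) (Hlam : 2 + sqrt 2 < lam)
    (g : C -> R) (Hg : greens_function (Omega lam) g)
    (G : C -> C) (HG : greens_coordinate lam g G)
    (T : C -> C) (HT : greens_mapping lam G T)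
    (a : R) (Ha : slit_parameter (greens_domain lam G) a) :
  (forall N : nat, (1 <= N)%nat ->
     exists CN : R, forall psi : R, F N psi ->
       exists I : R,
         is_RInt_gen
           (fun r : R =>
              Cmod (C_derive (C_derive T) (r * Cexp (- Ci * PI * psi))%C))
           (at_point (exp (- PI * a))) (at_left 1) I /\
         I <= CN) /\
  (exists c : R, 0 < c /\
     forall N : nat, (1 <= N)%nat ->
       Rbar_lt (Finite (1 - c / INR N)) (Hdim (F N))).
Proof.
  split.
  - intros N _. exact (second_derivative_integral lam Hlam g Hg G HG T HT a Ha N).
  (* With c = 2 the inequality N/(N + 2) > 1 - 2/N amounts to N^2 > N^2 - 4. *)
  - exists 2. split; [lra|]. intros N HN.
    assert (HN1 : 1 <= INR N) by (change 1 with (INR 1); now apply le_INR).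
    apply (Rbar_lt_le_trans _ (INR N / (INR N + 2))); [|now apply Hdim_F_lower].
    simpl. apply Rmult_lt_reg_r with (INR N * (INR N + 2)); [nra|].
    replace ((1 - 2 / INR N) * (INR N * (INR N + 2))) with (INR N * INR N - 4) by (field; lra).
    replace (INR N / (INR N + 2) * (INR N * (INR N + 2))) with (INR N * INR N) by (field; lra). lra.
Qed.
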